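(* Let $d\ge2$ and let $\mathcal{R}$ be $d$-dimensional Skorokhod-reflected Brownian motion, $$\mathcal{R}_t=\big(B^{(1)}_t-(0\wedge\underline{B}^{(1)}_t),\dots,B^{(d)}_t-(0\wedge\underline{B}^{(d)}_t)\big),\qquad\underline{B}^{(i)}_t=\inf_{s\le t}B^{(i)}_s,$$ with $B^{(1)},\dots,B^{(d)}$ independent one-dimensional standard Brownian motions, killed and absorbed at its first hitting time of $\boldsymbol{0}_d$. Let $(\rho,\Theta)$ be the underlying MAP of $\mathcal{R}$ with respect to $\|\cdot\|_1$. Then the operator $A$ defined for $f\in\mathcal{D}$ by $$Af(x,\boldsymbol{\theta})=\sum_{i=0}^db_i(\boldsymbol{\theta})\frac{\partial f}{\partial y_i}(x,\boldsymbol{\theta})+\frac12\sum_{i,j=0}^da_{ij}(\boldsymbol{\theta})\frac{\partial^2f}{\partial y_i\partial y_j}(x,\boldsymbol{\theta}),$$ where, for $\boldsymbol{\theta}=(\theta_1,\dots,\theta_d)\in\mathcal{S}$ and $1\le i\le d$, $$b_0(\boldsymbol{\theta})=-\tfrac d2,\quad b_i(\boldsymbol{\theta})=d\theta_i-1,\quad a_{00}(\boldsymbol{\theta})=d,\quad a_{ii}(\boldsymbol{\theta})=(1-\theta_i)^2+(d-1)\theta_i^2,\quad a_{0i}(\boldsymbol{\theta})=a_{i0}(\boldsymbol{\theta})=1-d\theta_i,$$ and $a_{ij}(\boldsymbol{\theta})=a_{ji}(\boldsymbol{\theta})=d\theta_i\theta_j-\theta_i-\theta_j$ for $i,j\in\{1,\dots,d\}$,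 $i\neq j$, solves the martingale problem for $(\rho,\Theta)$. That is, for every $f\in\mathcal{D}$ and every starting point, $$f(\rho_t,\Theta_t)-f(\rho_0,\Theta_0)-\int_0^tAf(\rho_s,\Theta_s)\,ds$$ is a martingale, for $t$ less than the lifetime of $(\rho,\Theta)$.
   Context: $\|\boldsymbol{x}\|_1=\sum_k|x_k|$, $\arg(\boldsymbol{w})=\boldsymbol{w}/\|\boldsymbol{w}\|_1$, and $\mathcal{S}=\{\boldsymbol{x}\in[0,\infty)^d:\|\boldsymbol{x}\|_1=1\}$ is the closed simplex. $\mathcal{R}$ is a self-similar Markov process with index $2$. Its underlying Markov additive process (MAP) with respect to $\|\cdot\|_1$, with values in $\mathbb{R}\times\mathcal{S}$, is $$(\rho_t,\Theta_t)=\big(\log\|\mathcal{R}_{I_t}\|_1,\arg(\mathcal{R}_{I_t})\big),\qquad I_t=\inf\Big\{s>0:\int_0^s\|\mathcal{R}_r\|_1^{-2}dr>t\Big\},$$ for $t$ less than its lifetime $\int_0^\upsilon\|\mathcal{R}_r\|_1^{-2}dr$, where $\upsilon=\inf\{t>0:\mathcal{R}_t=\boldsymbol{0}_d\}$. Points of $\mathbb{R}\times\mathcal{S}\subset\mathbb{R}^{d+1}$ are written $(x,\boldsymbol{\theta})=(x,\theta_1,\dots,\theta_d)$; the coordinates $y_0,y_1,\dots,y_d$ of $\mathbb{R}^{d+1}$ are indexed $0,1,\dots,d$, with standard basis $\{\boldsymbol{e}_0,\dots,\boldsymbol{e}_d\}$ and gradient $\nabla$. $C^2_b(\mathbb{R}\times\mathcal{S})$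 denotes the functions which are restrictions of $C^2$ functions on a neighbourhood of $\mathbb{R}\times\mathcal{S}$ in $\mathbb{R}^{d+1}$ and which are bounded on $\mathbb{R}\times\mathcal{S}$ together with their first and second derivatives. (The operator only involves directions tangent to $\mathbb{R}\times\mathcal{S}$, so nothing depends on the extension.) The class $\mathcal{D}$ consists of all $f\in C^2_b(\mathbb{R}\times\mathcal{S})$ such that for each $1\le i\le d$ and each $\boldsymbol{w}\in[0,\infty)^d\setminus\{\boldsymbol{0}_d\}$ with $w_i=0$, $$\Big(\boldsymbol{e}_0+\boldsymbol{e}_i-\|\boldsymbol{w}\|_1^{-1}\sum_{j\ne i}w_j\boldsymbol{e}_j\Big)\cdot\nabla f\big(\log\|\boldsymbol{w}\|_1,\arg(\boldsymbol{w})\big)=0.$$ *)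

(* Defs.v *)
From mathcomp Require Import all_boot all_order all_algebra.
From mathcomp Require Import all_classical all_reals all_analysis.
Import Order.TTheory GRing.Theory Num.Theory.
Import numFieldNormedType.Exports.

Set Implicit Arguments.
Unset Strict Implicit.
Unset Printing Implicit Defensive.

Local Open Scope classical_set_scope.
Local Open Scope ring_scope.

(* Processes are functions [R -> T -> E] of a real time and an outcome; only
   times [0 <= t] are ever constrained or used. *)
Section Processes.
Context {R : realType} {disp : measure_display} {T : measurableType disp}.

(* sigma(X_u ; 0 <= u /\ J u) *)
Definition process_sigma (J : set R) (X : R -> T -> R) : set_system T :=
  <<s [set A | exists u (Y : set R),
         [/\ 0 <= u, J u, measurable Y & A = X u @^-1` Y]] >>.

Definition independent_processes (P : probability T R) (I : finType)
    (X : I -> R -> T -> R) : Prop :=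
  forall A : I -> set T, (forall i, process_sigma setT (X i) (A i)) ->
    P (\bigcap_i A i) = (\prod_i fine (P (A i)))%:E.

(* One-dimensional standard Brownian motion issued from x0; every path is
   continuous.  The second argument of [normal_prob] is the standard
   deviation. *)
Record brownian_motion (P : probability T R) (x0 : R) (X : R -> T -> R) : Prop :=
  BrownianMotion {
    bm_measurable : forall t : R, 0 <= t -> measurable_fun [set: T] (X t);
    bm_start : forall w, X 0 w = x0;
    bm_continuous : forall w, {within `[0, +oo[, continuous (fun t => X t w)};
    bm_gaussian : forall s t : R, 0 <= s -> s < t ->
      forall Y : set R, measurable Y ->
      P ((X t \- X s) @^-1` Y) = normal_prob 0 (Num.sqrt (t - s)) Y;
    bm_independent : forall s t : R, 0 <= s -> s < t ->
      forall (A : set T) (Y : set R),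
      process_sigma [set u | u <= s] X A -> measurable Y ->
      P (A `&` (X t \- X s) @^-1` Y) = (P A * P ((X t \- X s)%R @^-1` Y))%E }.

Definition filtration (F : R -> set_system T) : Prop :=
  [/\ forall t : R, 0 <= t -> sigma_algebra [set: T] (F t),
      forall t : R, 0 <= t -> F t `<=` measurable &
      forall s t : R, 0 <= s -> s <= t -> F s `<=` F t].

(* The last clause is E[M_t | F_s] = M_s, by the defining property of
   conditional expectation. *)
Definition martingale (P : probability T R) (F : R -> set_system T)
    (M : R -> T -> R) : Prop :=
  [/\ filtration F,
      forall t : R, 0 <= t -> forall Y : set R, measurable Y -> F t (M t @^-1` Y),
      forall t : R, 0 <= t -> P.-integrable [set: T] (EFin \o M t) &
      forall s t : R, 0 <= s -> s <= t -> forall A, F s A ->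
        (\int[P]_(w in A) (M t w)%:E = \int[P]_(w in A) (M s w)%:E)%E].

(* For a process with values in R^n killed at its lifetime, [None] being the
   cemetery, the sigma-algebra generated by (X_u)_{0 <= u <= t}. *)
Definition natural_filtration n (X : R -> T -> option 'rV[R]_n) (t : R) :
    set_system T :=
  <<s [set A | exists u (i : 'I_n) (Y : set R),
         [/\ 0 <= u, u <= t, measurable Y &
             A = [set w | exists2 y, X u w = Some y & Y (y 0 i)]]] >>.

(* Functions on the state space are extended by 0 to the cemetery, so for
   t < lifetime the process below is f(X_t) - f(X_0) - int_0^t Af(X_s) ds. *)
Definition solves_martingale_problem (P : probability T R) n
    (D : set ('rV[R]_n -> R)) (A : ('rV[R]_n -> R) -> 'rV[R]_n -> R)
    (X : R -> T -> option 'rV[R]_n) : Prop :=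
  forall f, D f -> martingale P (natural_filtration X)
    (fun t w => oapp f 0 (X t w) - oapp f 0 (X 0 w)
       - \int[lebesgue_measure]_(s in `[0, t]) oapp (A f) 0 (X s w)).

End Processes.

Section Paths.
Context {R : realType} {d : nat}.
Implicit Types (x : R -> 'rV[R]_d) (v w theta : 'rV[R]_d) (s t : R).

Definition norm1 v : R := \sum_k `|v 0 k|.

Definition argv v : 'rV[R]_d := (norm1 v)^-1 *: v.

Definition orthant : set 'rV[R]_d := [set v | forall i, 0 <= v 0 i].

Definition simplex : set 'rV[R]_d := [set v | orthant v /\ norm1 v = 1].

Definition skorokhod_reflection (b : 'I_d -> R -> R) t : 'rV[R]_d :=
  \row_i (b i t - Num.min 0 (inf [set b i s | s in `[0, t]])).

Definition hitting_time0 x : \bar R :=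
  ereal_inf [set t%:E | t in [set t | 0 < t /\ x t = 0]].

Definition absorb0 x t : 'rV[R]_d :=
  if (t%:E < hitting_time0 x)%E then x t else 0.

(* The inverse is taken in [\bar R], where [0^-1 = +oo]. *)
Definition clock x s : \bar R :=
  (\int[lebesgue_measure]_(r in `[0%R, s]) ((norm1 (x r) ^+ 2)%:E)^-1)%E.

Definition map_lifetime x : \bar R :=
  (\int[lebesgue_measure]_(r in [set r | (0 <= r)%R /\ r%:E < hitting_time0 x])
     ((norm1 (x r) ^+ 2)%:E)^-1)%E.

Definition time_change x t : R := inf [set s | 0 < s /\ (t%:E < clock x s)%E].

(* The point (x, theta) of R x R^d = R^(1 + d): coordinate 0 is [lshift d 0]
   and coordinate i >= 1 is [rshift 1 (i - 1)]. *)
Definition polar_point (r : R) theta : 'rV[R]_(1 + d) := row_mx r%:M theta.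

Definition underlying_map x t : option 'rV[R]_(1 + d) :=
  if (t%:E < map_lifetime x)%E then
    let y := x (time_change x t) in Some (polar_point (ln (norm1 y)) (argv y))
  else None.

End Paths.

Section Operator.
Context {R : realType} {d : nat}.
Implicit Types (f : 'rV[R]_(1 + d) -> R) (y : 'rV[R]_(1 + d)) (theta w : 'rV[R]_d).

Let e0 : 'rV[R]_(1 + d) := 'e_(lshift d 0).
Let e (i : 'I_d) : 'rV[R]_(1 + d) := 'e_(rshift 1 i).

Definition pderiv (i : 'I_(1 + d)) f : 'rV[R]_(1 + d) -> R :=
  'D_('e_i) f.

Definition grad f y : 'rV[R]_(1 + d) := \row_i pderiv i f y.

Definition dot (u v : 'rV[R]_(1 + d)) : R := \sum_i u 0 i * v 0 i.

Definition C2_on (U : set 'rV[R]_(1 + d)) f : Prop :=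
  forall y, U y ->
    [/\ {for y, continuous f},
        forall i, derivable f y 'e_i /\
                  {for y, continuous (pderiv i f)} &
        forall i j, derivable (pderiv j f) y 'e_i /\
                    {for y, continuous (pderiv i (pderiv j f))}].

Definition RxS : set 'rV[R]_(1 + d) := [set y | simplex (rsubmx y)].

(* [f] is an extension to R^(1 + d) of the function on R x S; its values
   outside a neighbourhood of R x S play no role. *)
Definition C2b f : Prop :=
  (exists U, [/\ open U, RxS `<=` U & C2_on U f]) /\
  (exists K : R, forall y, RxS y ->
     [/\ `|f y| <= K, forall i, `|pderiv i f y| <= K &
         forall i j, `|pderiv i (pderiv j f) y| <= K]).

Definition classD : set ('rV[R]_(1 + d) -> R) :=
  [set f | C2b f /\
    forall (i : 'I_d) w, orthant w -> w != 0 -> w 0 i = 0 ->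
      dot (e0 + e i - (norm1 w)^-1 *: \sum_(j | j != i) w 0 j *: e j)
          (grad f (polar_point (ln (norm1 w)) (argv w))) = 0].

Definition drift theta (i : 'I_(1 + d)) : R :=
  match fintype.split i with
  | inl _ => - (d%:R / 2)
  | inr k => d%:R * theta 0 k - 1
  end.

Definition diffusion theta (i j : 'I_(1 + d)) : R :=
  match fintype.split i, fintype.split j with
  | inl _, inl _ => d%:R
  | inl _, inr k | inr k, inl _ => 1 - d%:R * theta 0 k
  | inr k, inr l =>
      if k == l then (1 - theta 0 k) ^+ 2 + (d%:R - 1) * theta 0 k ^+ 2
      else d%:R * theta 0 k * theta 0 l - theta 0 k - theta 0 l
  end.

Definition generator f y : R :=
  \sum_i drift (rsubmx y) i * pderiv i f y +
  2^-1 * \sum_i \sum_j diffusion (rsubmx y) i j * pderiv i (pderiv j f) y.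

End Operator.

(* Main.v *)
From HB Require Import structures.
Require Import Defs.
From mathcomp Require Import all_boot all_order all_algebra.
From mathcomp Require Import all_classical all_reals all_analysis.
From mathcomp Require Import measurable_realfun ring lra.
Import Order.TTheory GRing.Theory Num.Theory.
Import numFieldNormedType.Exports.
Local Open Scope classical_set_scope.
Local Open Scope ring_scope.
Set Implicit Arguments.
Unset Strict Implicit.
Unset Printing Implicit Defensive.

(* No stochastic calculus is used.  In the reflected motion [R = B + L], where
   [L_i] increases only when [R_i = 0], the function [F w = f (ln |w|, w / |w|)]
   satisfies [|w|^2 (Laplacian F) / 2 = A f] off the origin, and the boundary
   condition defining [classD] says that the normal derivatives of [F] vanish
   on the faces of the orthant.  Summing second-order Taylor expansions of [F]
   along a grid, the first-order terms along [dL] are negligible, those along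
   [dB] are centered, and the second-order terms converge to the integral of
   the Laplacian; dominated convergence, with Doob's L2 inequality for the
   domination, yields Dynkin's formula
     E [F (R_b) - F (R_a) - int_a^b (Laplacian F)(R_u) / 2 du] = 0
   for adapted random windows ]a, b] on which [|R|] stays above [delta].
   Applied to [ln (delta^2 + |x|^2)], which is subharmonic as [d >= 2], it shows
   that [R] never hits the origin.  On [2^k, 2^(k+1)] the clock increases by at
   least [1 / W >= 2 c - c^2 W], with [W = O(sup |R|^2 / 2^k)] of bounded mean;
   by Markov's inequality the clock is infinite.  So every MAP time is reached.
   For [A] in the natural filtration of the MAP at time [s], the window where
   the clock lies in ]s, t], restricted to [A], is adapted to the Brownian
   filtration; Dynkin's formula and the change of variables by the clock give
   the martingale property as [delta] tends to 0. *)

(** * Integration and Gaussian moments *)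

(** Since functions are extended by 0 to the cemetery, non-explosion is part of the claim: for the
    constant function 1, which lies in [classD], the process is the indicator of survival minus 1,
    and it is a martingale only if the MAP almost surely lives forever. Two filtrations are in play.
    An event A of the MAP at time s belongs to no deterministic Brownian time; it becomes known at
    time u only on the event that the clock has already passed s. Dynkin's formula is therefore
    stated for windows described by a family of events J_u, each known at time u, and no
    sigma-algebra at a stopping time is formed. The level [delta] keeps the path away from the
    origin, where the derivatives of F are unbounded. The bounds on the stopped increments do not
    depend on [delta], because time is measured by the clock; and on each surviving path the cut has
    no effect once [delta] is below the minimum of |R| up to the relevant time. *)

Section ConvergenceOfIntegrals.
Context {R : realType} {disp : measure_display} {T : measurableType disp}.
Variable mu : {measure set T -> \bar R}.

Lemma integrable_le (f g : T -> R) : measurable_fun [set: T] f ->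
  (forall x, `|f x| <= g x) -> mu.-integrable [set: T] (EFin \o g) ->
  mu.-integrable [set: T] (EFin \o f).
Proof.
move=> mf fg ig; apply: (le_integrable _ _ _ ig) => //; first exact/measurable_EFinP.
by move=> x _ /=; rewrite lee_fin (le_trans (fg x))// ler_norm.
Qed.

Lemma le_Rintegral_setT (f g : T -> R) :
  mu.-integrable [set: T] (EFin \o f) -> mu.-integrable [set: T] (EFin \o g) ->
  (forall x, f x <= g x) -> \int[mu]_x f x <= \int[mu]_x g x.
Proof. by move=> If Ig fg; apply: le_Rintegral. Qed.

Lemma cvg_Rintegral (f_ : (T -> R)^nat) (f g : T -> R) :
  (forall n, measurable_fun [set: T] (f_ n)) ->
  (forall x, f_ ^~ x @ \oo --> f x) ->
  (forall n x, `|f_ n x| <= g x) -> mu.-integrable [set: T] (EFin \o g) ->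
  mu.-integrable [set: T] (EFin \o f) /\
  \int[mu]_x f_ n x @[n --> \oo] --> \int[mu]_x f x.
Proof.
move=> mf_ cf fg ig.
have mf : measurable_fun [set: T] f.
  by apply: (measurable_fun_cvg (h := f_)) => // x _; exact: cf.
have := @dominated_convergence _ _ _ mu _ measurableT (fun n => EFin \o f_ n)
  (EFin \o f) (EFin \o g).
case.
- by move=> n; exact/measurable_EFinP.
- exact/measurable_EFinP.
- by apply: aeW => x _; apply: cvg_EFin; [near=> n|exact: cf].
- by [].
- by apply: aeW => x n _; rewrite /= lee_fin.
move=> If _ h; split => //; apply: fine_cvg.
by rewrite fineK//; exact: integrable_fin_num.
Unshelve. all: by end_near. Qed.

Lemma fatou_Rintegral (f_ : (T -> R)^nat) (f : T -> R) (C : R) :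
  (forall n, mu.-integrable [set: T] (EFin \o f_ n)) ->
  (forall n x, 0 <= f_ n x) ->
  (forall x, f_ ^~ x @ \oo --> f x) ->
  (forall n, \int[mu]_x f_ n x <= C) ->
  mu.-integrable [set: T] (EFin \o f) /\ \int[mu]_x f x <= C.
Proof.
move=> if_ f0 cf fC.
have mf_ n : measurable_fun [set: T] (f_ n).
  by apply/measurable_EFinP; exact: measurable_int (if_ n).
have mf : measurable_fun [set: T] f.
  by apply: (measurable_fun_cvg (h := f_)) => // x _; exact: cf.
have fge0 x : 0 <= f x.
  by apply: (cvgr_to_ge (cf x)); apply: nearW => n.
have le : (\int[mu]_x (f x)%:E <= C%:E)%E.
  rewrite (eq_integral (fun x => limn_einf (fun n => (f_ n x)%:E))); last first.
    move=> x _; apply/esym; apply: (cvg_limn_einf_sup _).1.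
    by apply: cvg_EFin; [near=> n|exact: cf].
  apply: le_trans.
    apply: (@fatou _ _ _ mu _ measurableT (fun n => EFin \o f_ n)) => //.
    - by move=> n; exact/measurable_EFinP.
    - by move=> n x _; rewrite /= lee_fin.
  rewrite limn_einf_lim; apply: lime_le; first exact: is_cvg_einfs.
  apply: nearW => n; apply: (@le_trans _ _ (\int[mu]_x (f_ n x)%:E)%E).
    by apply: ereal_inf_lbound; exists n => /=.
  by have := fC n; rewrite -lee_fin /Rintegral fineK//; exact: integrable_fin_num (if_ n).
split.
  apply/integrableP; split; first exact/measurable_EFinP.
  under eq_integral do rewrite /= ger0_norm//.
  exact: le_lt_trans le (ltry _).
rewrite -lee_fin /Rintegral fineK// ge0_fin_numE; first exact: le_lt_trans le (ltry _).
by apply: integral_ge0 => x _; rewrite lee_fin.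
Unshelve. all: by end_near. Qed.

End ConvergenceOfIntegrals.

Lemma Rintegral_FTC {R : realType} (F f : R -> R) (a b : R) : a <= b ->
  (forall x, x \in `[a, b] -> {for x, continuous f}) ->
  (forall x, x \in `[a, b] -> is_derive x 1 F (f x)) ->
  \int[lebesgue_measure]_(x in `[a, b]) f x = F b - F a.
Proof.
rewrite le_eqVlt => /predU1P[<- _ _|ab cf dF].
  by rewrite set_itv1 Rintegral_set1 subrr.
rewrite /Rintegral (@continuous_FTC2 _ f F)//.
- apply: continuous_in_subspaceT => x; rewrite inE => xab; exact: cf.
- have cF x : x \in `[a, b] -> {for x, continuous F}.
    by move=> /dF h; apply: differentiable_continuous; apply/derivable1_diffP; case: h.
  split.
  + move=> x xab; suff: is_derive x 1 F (f x) by case.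
    by apply: dF; apply: subset_itv_oo_cc.
  + by apply: cvg_at_right_filter; apply: cF; rewrite in_itv/= lexx ltW.
  + by apply: cvg_at_left_filter; apply: cF; rewrite in_itv/= lexx ltW.
- move=> x xab; rewrite derive1E.
  suff h : is_derive x 1 F (f x) by rewrite (@derive_val _ _ _ _ _ _ _ h).
  by apply: dF; apply: subset_itv_oo_cc.
Qed.

Section IndependentProduct.
Context {R : realType} {disp : measure_display} {T : measurableType disp}.
Variable P : probability T R.

(** Independence says that the law of the pair (X, Y) is the product of the two laws; Tonelli gives
    integrability of the product and Fubini its integral. *)
Lemma expectation_mul_indep (X Y : T -> R) :
  P.-integrable [set: T] (EFin \o X) -> P.-integrable [set: T] (EFin \o Y) ->
  (forall A B : set R, measurable A -> measurable B ->
     P (X @^-1` A `&` Y @^-1` B) = (P (X @^-1` A) * P (Y @^-1` B))%E) ->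
  P.-integrable [set: T] (EFin \o (fun w => X w * Y w)) /\
  \int[P]_w (X w * Y w) = \int[P]_w X w * \int[P]_w Y w.
Proof.
move=> iX iY indep.
have mX : measurable_fun [set: T] X by apply/measurable_EFinP; exact: measurable_int iX.
have mY : measurable_fun [set: T] Y by apply/measurable_EFinP; exact: measurable_int iY.
pose X' : {mfun T >-> R} := HB.pack X (isMeasurableFun.Build _ _ _ _ X mX).
pose Y' : {mfun T >-> R} := HB.pack Y (isMeasurableFun.Build _ _ _ _ Y mY).
pose Z w := (X w, Y w).
have mZ : measurable_fun [set: T] Z by exact: measurable_fun_pair.
pose Z' : {mfun T >-> (R * R)%type} := HB.pack Z (isMeasurableFun.Build _ _ _ _ Z mZ).
pose m1 := distribution P X'; pose m2 := distribution P Y'.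
have mf : measurable_fun [set: R * R] (fun z : R * R => (z.1 * z.2)%:E).
  by apply/measurable_EFinP; apply: measurable_funM; [exact: measurable_fst|exact: measurable_snd].
have lawE A : measurable A -> (m1 \x m2)%E A = distribution P Z' A.
  by move=> mA; apply: product_measure_unique => // B C mB mC; exact: indep.
have i1 : m1.-integrable [set: R] EFin.
  by apply: integrable_pushforward => //; exact: EFin_measurable.
have i2 : m2.-integrable [set: R] EFin.
  by apply: integrable_pushforward => //; exact: EFin_measurable.
have f1 : (\int[m1]_x `|x%:E| < +oo)%E by case/integrableP : i1.
have f2 : (\int[m2]_x `|x%:E| < +oo)%E by case/integrableP : i2.
have iprod : (m1 \x m2)%E.-integrable [set: R * R] (fun z : R * R => (z.1 * z.2)%:E).
  apply/integrable12ltyP => //=.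
  under eq_integral => x _.
    under eq_integral => y _ do rewrite /= normrM EFinM.
    rewrite ge0_integralZl//; last by apply: measurableT_comp => //.
    over.
  rewrite /= ge0_integralZr//; last 2 first.
  - by apply: measurableT_comp => //.
  - by apply: integral_ge0.
  by rewrite lte_mul_pinfty// ?integral_ge0// ge0_fin_numE// integral_ge0.
have iZ : (distribution P Z').-integrable [set: R * R] (fun z : R * R => (z.1 * z.2)%:E).
  have [m h] := integrableP _ _ _ iprod; apply/integrableP; split => //.
  rewrite (eq_measure_integral (m1 \x m2)%E)// => A mA _.
  exact/esym/lawE.
have iXY : P.-integrable [set: T] (EFin \o (fun w => X w * Y w)).
  apply/integrableP; split.
    by apply/measurable_EFinP; exact: measurable_funM.
  have [_ h] := integrableP _ _ _ iZ; move: h.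
  by rewrite ge0_integral_distribution//; exact: measurableT_comp.
split => //.
have e1 : (\int[P]_w (X w * Y w)%:E = \int[(m1 \x m2)%E]_z (z.1 * z.2)%:E)%E.
  rewrite -(@integral_distribution _ _ _ _ _ P Z' (fun z : R * R => (z.1 * z.2)%:E))//.
  by apply: eq_measure_integral => A mA _; exact/esym/lawE.
rewrite /Rintegral e1 -integral12_prod_meas1//=.
have E2 : (\int[m2]_y y%:E = \int[P]_w (Y w)%:E)%E.
  by rewrite (@integral_distribution _ _ _ _ _ P Y' EFin)//.
have E1 : (\int[m1]_y y%:E = \int[P]_w (X w)%:E)%E.
  by rewrite (@integral_distribution _ _ _ _ _ P X' EFin)//.
have fY : (\int[P]_w (Y w)%:E)%E \is a fin_num by apply: integrable_fin_num.
have fX : (\int[P]_w (X w)%:E)%E \is a fin_num by apply: integrable_fin_num.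
rewrite (eq_integral (fun x : R => x%:E * (\int[P]_w (Y w)%:E)%E)%E); last first.
  by move=> x _; rewrite /fubini_F -E2 -integralZl.
by rewrite -{1}(fineK fY) integralZr// E1 fineM.
Qed.

End IndependentProduct.

(** The density of [normal_prob] is known through the measure of sets. The Radon-Nikodym derivative
    carries this over to integrals: it equals the density almost everywhere, both having the same
    integral over every measurable set. *)
Lemma integral_normal_prob {R : realType} (m s : R) (U : set R) (f : R -> \bar R) :
  measurable U -> (normal_prob m s).-integrable U f ->
  (\int[normal_prob m s]_(x in U) f x =
   \int[lebesgue_measure]_(x in U) (f x * (normal_pdf m s x)%:E))%E.
Proof.
move=> mU intf; have mf := measurable_int _ intf.
have dom := normal_prob_dominates m s.
have iD : lebesgue_measure.-integrable U
    (Radon_Nikodym (charge_of_finite_measure (normal_prob m s)) lebesgue_measure).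
  apply: (integrableS _ _ (@subsetT _ _)) => //=.
  by apply: Radon_Nikodym_integrable; exact: dom.
have mp : measurable_fun U (EFin \o normal_pdf m s).
  by apply/measurable_EFinP/measurable_funTS; exact: measurable_normal_pdf.
rewrite -(Radon_Nikodym_change_of_variables dom mU intf).
apply: ae_eq_integral => //.
- by apply: emeasurable_funM => //; exact: measurable_int iD.
- exact: emeasurable_funM.
apply: ae_eqe_mul2l; apply: integral_ae_eq => // E EU mE.
by rewrite -Radon_Nikodym_integral.
Qed.

(** * Moments of the centered normal law *)

Section NormalMoments.
Context {R : realType}.
Notation mu := lebesgue_measure.
Variables (s : R) (s0 : s != 0).

Let p := normal_pdf 0 s.

Lemma is_derive_normal_pdf (x : R) :
  is_derive x 1 (normal_pdf 0 s : R -> R) (- (x / s ^+ 2) * normal_pdf 0 s x).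
Proof.
rewrite normal_pdfE//.
pose h (x : R) := - (x - 0) ^+ 2 / (s ^+ 2 *+ 2).
have dh : is_derive x 1 h (- (x / s ^+ 2)).
  have -> : h = (- (s ^+ 2 *+ 2)^-1) *: ((id : R -> R) ^+ 2).
    by apply/funext => y; rewrite /h /= subr0 mulNr mulrC -mulNr.
  apply: is_derive_eq; rewrite !scaler1 /= expr1 -[LHS]/(_ * _).
  by rewrite -[s ^+ 2 *+ 2]mulr_natl; field.
have de : is_derive x 1 (expR \o h) (expR (h x) * - (x / s ^+ 2)).
  exact: is_derive1_comp.
have -> : (fun y : R => normal_peak s * normal_fun 0 s y) = normal_peak s *: (expR \o h).
  by apply/funext.
apply: is_derive_eq.
by rewrite -[LHS]/(_ * _) /normal_fun -/(h x); ring.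
Qed.

Lemma is_derive_normal_moment (k : nat) (x : R) :
  is_derive x 1 (fun x : R => x ^+ k * normal_pdf 0 s x : R)
    (k%:R * x ^+ k.-1 * normal_pdf 0 s x - x ^+ k.+1 * normal_pdf 0 s x / s ^+ 2).
Proof.
have dp := is_derive_normal_pdf x.
have -> : (fun x : R => x ^+ k * normal_pdf 0 s x : R) = ((id : R -> R) ^+ k) * (normal_pdf 0 s : R -> R).
  by apply/funext => y; rewrite [RHS]/(_ * _) exprfctE.
apply: is_derive_eq.
transitivity (x ^+ k * (- (x / s ^+ 2) * normal_pdf 0 s x) +
  normal_pdf 0 s x * (k%:R * x ^+ k.-1 * 1)); first by rewrite exprfctE.
rewrite (exprS x k); move: (x ^+ k) (x ^+ k.-1) (normal_pdf 0 s x) (k%:R : R) => u v q l.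
by field.
Qed.

Let N : probability _ R := normal_prob 0 s.
Let I (k n : nat) : R := \int[mu]_(x in `[- n%:R, n%:R]) (x ^+ k * normal_pdf 0 s x).

Lemma continuous_normal_moment (k : nat) : continuous (fun x : R => x ^+ k * normal_pdf 0 s x).
Proof.
move=> x; apply: differentiable_continuous; apply/derivable1_diffP.
by case: (is_derive_normal_moment k x).
Qed.

Lemma integrable_normal_moment (k : nat) (a b : R) :
  mu.-integrable `[a, b] (EFin \o (fun x : R => x ^+ k * normal_pdf 0 s x)).
Proof.
apply: continuous_compact_integrable; first exact: segment_compact.
by apply: continuous_subspaceT; exact: continuous_normal_moment.
Qed.

(** Integration by parts: the derivative of x^k p(x) is integrated over [-n, n], and the two
    boundary terms are joined by evenness of p. For [k = 0] the term with [k.-1] has coefficient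
    0. *)
Lemma normal_moment_rec (k n : nat) :
  k%:R * I k.-1 n - I k.+1 n / s ^+ 2 =
  (n%:R ^+ k - (- n%:R) ^+ k) * normal_pdf 0 s n%:R.
Proof.
have pN : normal_pdf 0 s (- n%:R) = normal_pdf 0 s n%:R.
  by rewrite normal_pdfE// /normal_fun !subr0 sqrrN.
rewrite mulrBl -{2}pN.
transitivity (\int[mu]_(x in `[- n%:R, n%:R])
    (k%:R * (x ^+ k.-1 * normal_pdf 0 s x) - (s ^+ 2)^-1 * (x ^+ k.+1 * normal_pdf 0 s x))); last first.
  apply: (@Rintegral_FTC _ (fun x => x ^+ k * normal_pdf 0 s x : R)).
  - by rewrite ge0_cp.
  - move=> x _; apply: cvgB; apply: cvgM; try exact: cvg_cst; exact: continuous_normal_moment.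
  - move=> x _; apply: is_derive_eq; first exact: is_derive_normal_moment.
    by rewrite mulrA; congr (_ - _); rewrite mulrC.
rewrite RintegralB//=; last 2 first.
- by apply: (@integrableZl _ _ _ mu _ _ _ (EFin \o (fun x => x ^+ k.-1 * normal_pdf 0 s x))) => //; exact: integrable_normal_moment.
- by apply: (@integrableZl _ _ _ mu _ _ _ (EFin \o (fun x => x ^+ k.+1 * normal_pdf 0 s x))) => //; exact: integrable_normal_moment.
rewrite !RintegralZl//; last 2 first.
- exact: integrable_normal_moment.
- exact: integrable_normal_moment.
by rewrite [X in _ - X]mulrC.
Qed.

Lemma normal_truncated_moment (k n : nat) :
  \int[N]_x (x ^+ k * \1_(`[- n%:R, n%:R] : set R) x) = I k n /\
  N.-integrable [set: R] (EFin \o (fun x => x ^+ k * \1_(`[- n%:R, n%:R] : set R) x)).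
Proof.
have mI : measurable (`[- n%:R, n%:R] : set R) by [].
have iN : N.-integrable [set: R] (EFin \o (fun x => x ^+ k * \1_(`[- n%:R, n%:R] : set R) x)).
  apply: (@integrable_le _ _ _ _ _ (cst (n%:R ^+ k))).
  - apply: measurable_funM => //; exact: measurable_indic.
  - move=> x; rewrite indicE; case: (boolP (_ \in _)) => [|_]; last by rewrite mulr0 normr0 exprn_ge0.
    by rewrite inE/= in_itv/= mulr1 normrX => xn; rewrite lerXn2r ?nnegrE// ler_norml.
  - exact: finite_measure_integrable_cst.
split => //.
rewrite /Rintegral /I integral_normal_prob//; congr fine.
rewrite [RHS]integral_mkcond; apply: eq_integral => x _.
rewrite patchE indicE; case: (boolP (_ \in _)) => h; rewrite ?h ?(negbTE h) -EFinM ?mulr1//.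
by rewrite mulr0 mul0r.
Qed.

(** From e^y >= y one gets n e^(-n^2 / (2 s^2)) <= 2 s^2 / n. *)
Lemma cvg_normal_pdf_id : n%:R * normal_pdf 0 s n%:R @[n --> \oo] --> (0 : R).
Proof.
have s2 : 0 < s ^+ 2 by rewrite exprn_even_gt0.
apply: (@squeeze_cvgr _ _ _ _ (cst 0) (fun n => (normal_peak s * (s ^+ 2 *+ 2)) * n%:R^-1)).
- near=> n; have n0 : 0 < n%:R :> R by rewrite ltr0n; near: n; exact: nbhs_infty_gt.
  rewrite mulr_ge0 ?normal_pdf_ge0//= normal_pdfE// /normal_fun subr0 mulrCA -mulrA.
  rewrite ler_wpM2l ?normal_peak_ge0//.
  rewrite mulNr expRN ler_pdivrMr ?expR_gt0// mulrAC ler_pdivlMr// -expr2.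
  rewrite -ler_pdivrMl ?mulrn_wgt0// mulrC.
  by rewrite (le_trans _ (expR_ge1Dx _))// lerDr.
- exact: cvg_cst.
- rewrite -[X in _ --> X](mulr0 (normal_peak s * (s ^+ 2 *+ 2))).
  apply: cvgMr; apply/gtr0_cvgV0; last exact: cvgr_idn.
  by near=> n; rewrite ltr0n; near: n; exact: nbhs_infty_gt.
Unshelve. all: by end_near. Qed.

Let J (k n : nat) (x : R) := x ^+ k * \1_(`[- n%:R, n%:R] : set R) x.

Let measurable_J k n : measurable_fun [set: R] (J k n).
Proof. by apply: measurable_funM => //; exact: measurable_indic. Qed.

Let J_le k n x : `|J k n x| <= `|x| ^+ k.
Proof.
rewrite /J indicE; case: (_ \in _); rewrite ?mulr1 ?normrX// mulr0 normr0.
by rewrite exprn_ge0.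
Qed.

Let cvg_J k (x : R) : J k n x @[n --> \oo] --> x ^+ k.
Proof.
apply: cvg_near_cst; near=> n; rewrite /J indicE mem_set ?mulr1//= in_itv/= -ler_norml.
by near: n; exact: nbhs_infty_ger.
Unshelve. all: by end_near. Qed.

Let cvg_moment k (g : R -> R) : N.-integrable [set: R] (EFin \o g) ->
  (forall x, `|x| ^+ k <= g x) ->
  N.-integrable [set: R] (EFin \o (fun x => x ^+ k)) /\
  I k n @[n --> \oo] --> \int[N]_x (x ^+ k).
Proof.
move=> ig kg.
have [|||h1 h2] := @cvg_Rintegral _ _ _ N (J k) (fun x => x ^+ k) g _ _ _ ig.
- exact: measurable_J.
- exact: cvg_J.
- by move=> n x; exact: le_trans (J_le k n x) (kg x).
split => //; apply: cvg_trans h2; apply: near_eq_cvg; near=> n.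
by rewrite (normal_truncated_moment k n).1.
Unshelve. all: by end_near. Qed.

Let cvg_moment0 : I 0 n @[n --> \oo] --> (1 : R).
Proof.
have [] := @cvg_moment 0 (cst 1).
- exact: finite_measure_integrable_cst.
- by move=> x.
move=> _; rewrite (_ : \int[N]_x x ^+ 0 = 1)//.
by rewrite Rintegral_cst//= probability_setT mul1r.
Qed.

Let moment0_le1 n : I 0 n <= 1.
Proof.
rewrite -(normal_truncated_moment 0 n).1.
apply: (@le_trans _ _ (\int[N]_x (cst 1 x))).
  apply: le_Rintegral_setT; first exact: (normal_truncated_moment 0 n).2.
  - exact: finite_measure_integrable_cst.
  - by move=> x; rewrite /= (le_trans (ler_norm _))// (le_trans (J_le 0 n x)).
by rewrite Rintegral_cst//= probability_setT mul1r.
Qed.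

Let s2_gt0 : 0 < s ^+ 2. Proof. by rewrite exprn_even_gt0. Qed.

Let moment2E n : I 2 n = s ^+ 2 * (I 0 n - 2 * (n%:R * normal_pdf 0 s n%:R)).
Proof.
have := normal_moment_rec 1 n; rewrite /= mul1r !expr1 => h.
have -> : I 0 n - 2 * (n%:R * normal_pdf 0 s n%:R) = I 2 n / s ^+ 2.
  rewrite -[X in _ = X](subKr (I 0 n)) h; ring.
by rewrite mulrC divfK// gt_eqF.
Qed.

Let fatou_moment k C : ~~ odd k -> (forall n, I k n <= C) ->
  N.-integrable [set: R] (EFin \o (fun x => x ^+ k)) /\
  \int[N]_x (x ^+ k) <= C.
Proof.
move=> ek kC; apply: (@fatou_Rintegral _ _ _ N (J k)).
- by move=> n; exact: (normal_truncated_moment k n).2.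
- by move=> n x; rewrite /J mulr_ge0 ?indicE ?ler0n// exprn_even_ge0.
- exact: cvg_J.
- by move=> n; rewrite (normal_truncated_moment k n).1.
Qed.

Let I2_le n : I 2 n <= s ^+ 2.
Proof.
rewrite moment2E ler_piMr ?(ltW s2_gt0)//; apply: le_trans (moment0_le1 n); rewrite gerBl.
by rewrite !mulr_ge0// normal_pdf_ge0.
Qed.

(** Fatou's lemma first makes x^2 integrable; x^2 then dominates its own truncations, and the limit
    of the truncated moments can be computed exactly. *)
Lemma normal_moment2 : N.-integrable [set: R] (EFin \o (fun x => x ^+ 2)) /\
  \int[N]_x (x ^+ 2) = s ^+ 2.
Proof.
have [i2 _] := @fatou_moment 2 (s ^+ 2) isT I2_le; split => //.
have [|_ c2] := @cvg_moment 2 _ i2.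
  by move=> x; rewrite real_normK ?num_real.
apply: (cvg_unique _ c2) => //.
rewrite /= -[s ^+ 2]mulr1 -[X in _ * X]subr0 -(mulr0 2).
under eq_fun do rewrite moment2E.
apply: cvgMr; apply: cvgB; first exact: cvg_moment0.
by apply: cvgMr; exact: cvg_normal_pdf_id.
Qed.

(** In the recursion for [k = 3] the boundary term is nonnegative; dropping it leaves I_4 <= 3 s^2
    I_2 <= 3 s^4. *)
Lemma normal_moment4 : N.-integrable [set: R] (EFin \o (fun x => x ^+ 4)) /\
  \int[N]_x (x ^+ 4) <= 3 * s ^+ 4.
Proof.
apply: fatou_moment => // n.
have := normal_moment_rec 3 n; rewrite /= => h.
have : I 4 n / s ^+ 2 <= 3 * I 2 n.
  rewrite -subr_ge0 h mulr_ge0 ?normal_pdf_ge0// subr_ge0.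
  by rewrite (@le_trans _ _ 0)// ?exprn_ge0// exprn_odd_le0//= oppr_le0.
rewrite ler_pdivrMr// => /le_trans; apply.
by rewrite -mulrA ler_wpM2l// -[4%N]/(2 + 2)%N exprD ler_wpM2r// ?(ltW s2_gt0)//.
Qed.

Lemma normal_moment1 : N.-integrable [set: R] (EFin \o (fun x => x)) /\
  \int[N]_x x = 0.
Proof.
have [||i1 c1] := @cvg_moment 1 (fun x => 1 + x ^+ 2).
- apply: (@integrableD _ _ _ N _ _ (EFin \o cst 1) (EFin \o (fun x => x ^+ 2))) => //.
    exact: finite_measure_integrable_cst.
  exact: normal_moment2.1.
- move=> x; rewrite expr1 -(real_normK (num_real x)).
  by have := sqr_ge0 (`|x| - 1); have := normr_ge0 x; nra.
split; first exact: i1.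
apply: (cvg_unique _ c1) => //.
have I10 n : I 1 n = 0.
  have := normal_moment_rec 0 n; rewrite mul0r !expr0 subrr mul0r sub0r.
  by move/eqP; rewrite oppr_eq0 mulf_eq0 invr_eq0 (gt_eqF s2_gt0) orbF => /eqP.
by rewrite /= (_ : I 1 = fun=> 0); [exact: cvg_cst|apply/funext].
Qed.

End NormalMoments.

(** * Riemann sums and the reflection map *)

Section Grid.
Context {R : realType}.
Implicit Types (b h N s t u : R) (n k : nat).

(** [side] selects cells [kh, (k+1)h[ when [true] and ]kh, (k+1)h] when [false], so that one
    statement serves right-continuous and left-continuous integrands. *)
Lemma grid_cell (side : bool) h s n : 0 < h ->
  s \in Interval (BSide side 0) (BSide side (n%:R * h)) ->
  exists2 k : 'I_n, s \in Interval (BSide side (k%:R * h)) (BSide side (k.+1%:R * h))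
    & forall j : 'I_n, j != k ->
      s \notin Interval (BSide side (j%:R * h)) (BSide side (j.+1%:R * h)).
Proof.
move=> h0; elim: n => [|n IH].
  by rewrite mul0r; case: side; rewrite in_itv/= => /andP[a b]; exfalso; lra.
move=> sn.
have [sl|sl] := boolP (s \in Interval (BSide side 0) (BSide side (n%:R * h))).
  have [k kP kU] := IH sl.
  exists (widen_ord (leqnSn n) k) => // j jk.
  have [jn|jn] := ltnP j n.
    by apply: (kU (Ordinal jn)); apply: contra jk => /eqP/(congr1 val)/= jk; apply/eqP/val_inj.
  have -> : j = n :> nat by apply/eqP; rewrite eqn_leq jn -ltnS ltn_ord.
  move: sl; rewrite !itv_boundlr => /andP[_ sl]; rewrite negb_and; apply/orP; left.
  by move: sl; case: side {IH sn kP kU}; rewrite !bnd_simp -?ltNge -?leNgt.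
have kn : s \in Interval (BSide side (n%:R * h)) (BSide side (n.+1%:R * h)).
  move: sn sl; rewrite !itv_boundlr negb_and => /andP[-> ->] /=; rewrite andbT.
  by case: side {IH}; rewrite !bnd_simp -?ltNge -?leNgt.
exists ord_max => // j jn; have {}jn : (j < n)%N.
  by rewrite ltn_neqAle -ltnS ltn_ord andbT; apply: contra jn => /eqP jn; apply/eqP/val_inj.
move: kn; rewrite !itv_boundlr => /andP[kn _]; rewrite negb_and; apply/orP; right.
have : j.+1%:R * h <= n%:R * h by rewrite ler_pM2r// ler_nat.
by move: kn; case: side {IH sn sl}; rewrite !bnd_simp -?ltNge -?leNgt => a c; lra.
Qed.

(** The indices with kh <= b form an initial segment, so the sum telescopes up to the first grid
    point beyond b, or to the last one. The final two clauses place jh within one mesh of b. *)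
Lemma telescope_stopped (Y : R -> R) h b n : 0 < h ->
  exists j : nat, [/\ (j <= n)%N,
    \sum_(k < n) (k%:R * h <= b)%R%:R * (Y (k.+1%:R * h) - Y (k%:R * h)) = Y (j%:R * h) - Y 0,
    j = n \/ b < j%:R * h & j = 0%N \/ j%:R * h - h <= b].
Proof.
move=> h0; elim: n => [|n [j [jn E j1 j2]]].
  by exists 0%N; split => //; [rewrite big_ord0 mul0r subrr|left|left].
rewrite big_ord_recr/=; have [nb|nb] := leP (n%:R * h) b.
  exists n.+1; split => //; [|by left|by right; rewrite -natr1 mulrDl mul1r addrK].
  have nj : n = j.
    case: j1 => [//|]; rewrite ltNge (le_trans _ nb)// ler_pM2r// ler_nat//.
  by rewrite E mul1r nj; ring.
exists j; split => //; first exact: leqW.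
- by rewrite E mul0r addr0.
- by case: j1 => [jE|]; right => //; rewrite jE.
Qed.

Lemma cvg_mesh N : N / n.+1%:R @[n --> \oo] --> (0 : R).
Proof. by rewrite -[X in _ --> X](mulr0 N); apply: cvgMr; exact: cvg_harmonic. Qed.

Lemma cvg_telescope_stopped (Y : R -> R) N b : 0 < N -> 0 <= b <= N ->
  {for b, continuous Y} ->
  \sum_(k < n.+1) (k%:R * (N / n.+1%:R) <= b)%R%:R *
     (Y (k.+1%:R * (N / n.+1%:R)) - Y (k%:R * (N / n.+1%:R))) @[n --> \oo] --> Y b - Y 0.
Proof.
move=> N0 /andP[b0 bN] cY.
apply/cvgrPdist_le => e e0.
have /cvgrPdist_le/(_ _ e0) : Y x @[x --> b] --> Y b by exact: cY.
move=> [d /= d0 dP].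
have := cvg_mesh N => /cvgrPdist_lt/(_ _ d0); apply: filterS => n.
rewrite sub0r normrN => hd.
have h0 : 0 < N / n.+1%:R by rewrite divr_gt0.
have [j [jn -> j1 j2]] := @telescope_stopped Y (N / n.+1%:R) b n.+1 h0.
rewrite opprB addrA subrK; apply: dP => /=.
rewrite gtr0_norm// in hd; rewrite distrC ltr_norml.
have NE : n.+1%:R * (N / n.+1%:R) = N by rewrite mulrC divfK.
have jN : j%:R * (N / n.+1%:R) <= N by rewrite -{2}NE ler_pM2r// ler_nat.
have j0 : 0 <= j%:R * (N / n.+1%:R) by rewrite mulr_ge0// ltW.
have J1 : j%:R * (N / n.+1%:R) = N \/ b < j%:R * (N / n.+1%:R).
  by case: j1 => [->|]; [left|right].
have J2 : j%:R * (N / n.+1%:R) = 0 \/ j%:R * (N / n.+1%:R) - N / n.+1%:R <= b.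
  by case: j2 => [->|]; [left; rewrite mul0r|right].
move: J1 J2 jN j0 hd; move: (j%:R * (N / n.+1%:R)) (N / n.+1%:R) => y z J1 J2 *.
by apply/andP; split; [case: J1|case: J2] => *; lra.
Qed.

(** The tag (k + side)h lies strictly on the side of every point of its cell where one-sided
    continuity is assumed: to the right for [true], to the left for [false]. The step functions then
    converge pointwise and dominated convergence applies. *)
Lemma cvg_riemann_sum (side : bool) (g : R -> R) N C : 0 < N ->
  (forall s, 0 <= s <= N -> `|g s| <= C) ->
  (forall s, s \in Interval (BSide side 0) (BSide side N) ->
     forall e, 0 < e -> exists2 d, 0 < d & forall u,
       (if side then s < u else u < s) -> `|u - s| < d -> `|g u - g s| <= e) ->
  \sum_(k < n.+1) g ((k + side)%:R * (N / n.+1%:R)) * (N / n.+1%:R) @[n --> \oo] -->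
    \int[lebesgue_measure]_(s in `[0, N]) g s.
Proof.
move=> N0 gC gcont.
pose D := Interval (BSide side 0) (BSide side N).
pose h n : R := N / n.+1%:R.
have h0 n : 0 < h n by rewrite divr_gt0.
have NE n : n.+1%:R * h n = N by rewrite mulrC divfK.
pose I n (k : nat) := Interval (BSide side (k%:R * h n)) (BSide side (k.+1%:R * h n)).
pose phi n s := \sum_(k < n.+1) g ((k + side)%:R * h n) * \1_([set` I n k]) s.
have mI n k : measurable [set` I n k] by exact: measurable_itv.
have iI n k (c : R) : lebesgue_measure.-integrable [set: R] (EFin \o (fun s => c * \1_([set` I n k]) s)).
  apply: (@integrableZl _ _ _ lebesgue_measure _ _ c (EFin \o \1_([set` I n k]))) => //.
  exact: integrable_indic_itv.
have intphi n : \int[lebesgue_measure]_s phi n s = \sum_(k < n.+1) g ((k + side)%:R * h n) * h n.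
  rewrite /Rintegral /phi.
  under eq_integral do rewrite -sumEFin.
  rewrite integral_sum//; last by move=> k; exact: iI.
  rewrite (eq_bigr (fun k : 'I_n.+1 => (g ((k + side)%:R * h n) * h n)%:E)) ?sumEFin// => k _.
  under eq_integral do rewrite EFinM.
  rewrite integralZl//; last first.
    exact: integrable_indic_itv.
  rewrite integral_indic//= setIT lebesgue_measure_itv/= lte_fin.
  have -> : k%:R * h n < k.+1%:R * h n by rewrite ltr_pM2r// ltr_nat.
  by rewrite -EFinB -EFinM -mulrBl -natrB// subSnn mul1r.
have tag n (k : 'I_n.+1) : 0 <= (k + side)%:R * h n <= N.
  rewrite mulr_ge0 ?(ltW (h0 n))//= -[leRHS](NE n) ler_pM2r// ler_nat.
  by case: side {D I phi mI iI intphi gcont} => //; rewrite ?addn1 ?addn0// ltnW.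
have phiE n s : s \in D -> exists k : 'I_n.+1, s \in I n k /\ phi n s = g ((k + side)%:R * h n).
  rewrite /D -(NE n) => sD; have [k sk skj] := grid_cell (h0 n) sD.
  exists k; split => //; rewrite /phi (bigD1 k)//= indicE mem_set// mulr1 big1 ?addr0// => j jk.
  by rewrite indicE memNset ?mulr0//; apply/negP; exact: skj.
have phi0 n s : s \notin D -> phi n s = 0.
  move=> sD; rewrite /phi big1// => k _; rewrite indicE memNset ?mulr0//= => sk.
  move/negP: sD; apply; rewrite /D -(NE n).
  move: sk; rewrite /I !itv_boundlr => /andP[a b]; apply/andP; split.
    by apply: le_trans a; rewrite bnd_simp mulr_ge0// ltW.
  by apply: (le_trans b); rewrite bnd_simp ler_pM2r// ler_nat.
have [||||ig c] := @cvg_Rintegral _ _ _ lebesgue_measure phi (fun s => g s * \1_[set` D] s) (fun s => C * \1_[set` D] s).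
- by move=> n; apply: measurable_sum => k; apply: measurable_funM => //; exact: measurable_indic.
- move=> s; rewrite indicE; have [sD|sD] := boolP (s \in D); last first.
    rewrite memNset; last exact/negP.
    by rewrite mulr0; apply: cvg_near_cst; apply: nearW => n; rewrite phi0.
  rewrite mem_set// mulr1; apply/cvgrPdist_le => e e0.
  have [d d0 dP] := gcont _ sD _ e0.
  have := cvg_mesh N => /cvgrPdist_lt/(_ _ d0); apply: filterS => n.
  rewrite sub0r normrN -/(h n) (gtr0_norm (h0 n)) => hd.
  have [k [sk ->]] := phiE n _ sD.
  rewrite distrC; move: sk; rewrite /I itv_boundlr.
  have nn : k.+1%:R * h n = k%:R * h n + h n by rewrite -natr1 mulrDl mul1r.
  move: dP hd nn; move: (h n) => hn.
  case: side {D I phi mI iI intphi gcont tag phiE phi0 sD} => /= dP hd nn;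
    rewrite !bnd_simp => /andP[a b]; apply: dP; rewrite ?addn1 ?addn0//;
    by rewrite ltr_norml; apply/andP; split; lra.
- move=> n s; rewrite indicE; have [sD|sD] := boolP (s \in D); last first.
    by rewrite phi0// normr0 memNset ?mulr0//; exact/negP.
  have [k [sk ->]] := phiE n _ sD.
  by rewrite mem_set// mulr1; apply: gC; exact: tag.
- apply: (@integrableZl _ _ _ lebesgue_measure _ _ C (EFin \o \1_([set` D]))) => //.
  exact: integrable_indic_itv.
have -> : \int[lebesgue_measure]_(s in `[0, N]) g s = \int[lebesgue_measure]_s (g s * \1_[set` D] s).
  rewrite [RHS](_ : _ = \int[lebesgue_measure]_(s in [set` D]) g s); last first.
    rewrite [RHS]Rintegral_mkcond; apply: eq_Rintegral => s _.
    rewrite patchE indicE; case: (boolP (_ \in _)) => sD; rewrite ?sD ?mulr1//.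
    by rewrite mulr0.
  have g_meas : measurable_fun [set` D] g.
    have : measurable_fun [set: R] (fun s => g s * \1_[set` D] s).
      by apply/measurable_EFinP; exact: measurable_int ig.
    move=> /(measurable_funS measurableT (subsetT [set` D])); apply: eq_measurable_fun.
    by move=> s sD; rewrite indicE sD mulr1.
  have mg : measurable_fun `]0, N[ (EFin \o g).
    apply/measurable_EFinP; apply: measurable_funS g_meas => //.
    by apply: subset_itv; rewrite bnd_simp//; case: side {D I phi mI iI intphi gcont tag phiE phi0 ig c}; rewrite ?bnd_simp.
  by rewrite /Rintegral integral_itv_bndoo// [in RHS]integral_itv_bndoo.
by apply: cvg_trans c; apply: near_eq_cvg; apply: nearW => n; rewrite intphi.
Qed.

(** Turns an infimum over an interval into a limit of finite minima, from which measurability and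
    Doob's inequality follow. The default [b 0] of the minimum accounts for the grid point 0. *)
Lemma cvg_grid_min (b : R -> R) t : 0 <= t -> continuous b ->
  \big[Num.min/b 0]_(k < n.+1) b (k.+1%:R * (t / n.+1%:R)) @[n --> \oo] -->
  inf [set b s | s in `[0, t]].
Proof.
move=> t0 cb.
have [c ct cmin] := EVT_min t0 (continuous_subspaceT cb).
have infE : inf [set b s | s in `[0, t]] = b c.
  apply/eqP; rewrite eq_le; apply/andP; split.
    by apply: ge_inf; [exists (b c) => _ [s st <-]; exact: cmin|exists c].
  by apply: lb_le_inf; [exists (b c), c|move=> _ [s st <-]; exact: cmin].
rewrite infE; apply/cvgrPdist_le => e e0.
have /cvgrPdist_le/(_ _ e0) [d /= d0 dP] := cb c.
have := cvg_mesh t => /cvgrPdist_lt/(_ _ d0); apply: filterS => n.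
rewrite sub0r normrN => hd.
have NE : n.+1%:R * (t / n.+1%:R) = t by rewrite mulrC divfK.
have lb : b c <= \big[Num.min/b 0]_(k < n.+1) b (k.+1%:R * (t / n.+1%:R)).
  apply/bigmin_geP; split; first by apply: cmin; rewrite in_itv/= lexx t0.
  move=> k _; apply: cmin; rewrite in_itv/=; apply/andP; split.
    by rewrite mulr_ge0// divr_ge0.
  by rewrite -[leRHS]NE ler_wpM2r ?divr_ge0// ler_nat.
rewrite ler0_norm ?subr_le0// opprB lerBlDr.
have [c0|c0] := eqVneq c 0.
  by rewrite c0 (le_trans (bigmin_le_id _ _ _ _))// lerDr ltW.
have cp : 0 < c by rewrite lt_neqAle eq_sym c0; move: ct; rewrite in_itv/= => /andP[].
have h0 : 0 < t / n.+1%:R by rewrite divr_gt0// (lt_le_trans cp)//; move: ct; rewrite in_itv/= => /andP[].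
have cI : c \in Interval (BSide false 0) (BSide false (n.+1%:R * (t / n.+1%:R))).
  by move: ct; rewrite NE !in_itv/= cp => /andP[].
have [k ck _] := grid_cell h0 cI.
have := bigmin_le_cond (b 0) (fun k : 'I_n.+1 => b (k.+1%:R * (t / n.+1%:R))) (isT : xpredT k).
move/le_trans; apply; rewrite -lerBlDr.
have /andP[ck1 ck2] : k%:R * (t / n.+1%:R) < c <= k.+1%:R * (t / n.+1%:R) by move: ck; rewrite in_itv.
have kz : k.+1%:R * (t / n.+1%:R) = k%:R * (t / n.+1%:R) + t / n.+1%:R by rewrite -natr1 mulrDl mul1r.
rewrite gtr0_norm// in hd.
have : `|b c - b (k.+1%:R * (t / n.+1%:R))| <= e.
  apply: dP => /=; move: kz ck1 ck2 hd.
  set y := k%:R * _; set y' := k.+1%:R * _; set z := t / _; move: y y' z => y y' z kz yc cz zd.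
  by rewrite ltr_norml; apply/andP; split; lra.
by rewrite distrC => /(le_trans (ler_norm _)).
Qed.

Lemma grid_in N n k : 0 <= N -> (k <= n.+1)%N -> 0 <= k%:R * (N / n.+1%:R) <= N.
Proof.
move=> N0 kn; have NE : n.+1%:R * (N / n.+1%:R) = N by rewrite mulrC divfK.
by rewrite mulr_ge0 ?divr_ge0//= -[leRHS]NE ler_wpM2r ?divr_ge0// ler_nat.
Qed.

End Grid.

(** * The one-dimensional Skorokhod reflection map *)

Section Reflection.
Context {R : realType}.
Implicit Types (b : R -> R) (s t u : R).

Definition running_inf b t := inf [set b s | s in `[0, t]].

(** The increasing term of the Skorokhod decomposition. [Num.max 0 t] freezes it at negative times,
    so that it is continuous on the whole line. *)
Definition pushing b t := - Num.min 0 (running_inf b (Num.max 0 t)).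

Definition reflected b t := b t + pushing b t.

Lemma running_inf_attained b t : 0 <= t -> continuous b ->
  exists c, [/\ 0 <= c <= t, running_inf b t = b c & forall s, 0 <= s <= t -> b c <= b s].
Proof.
move=> t0 cb.
have [c ct cmin] := EVT_min t0 (continuous_subspaceT cb).
have cmin' s : 0 <= s <= t -> b c <= b s by move=> st; apply: cmin; rewrite in_itv.
have ct' : 0 <= c <= t by move: ct; rewrite in_itv.
exists c; split => //.
apply/eqP; rewrite eq_le; apply/andP; split.
  by apply: ge_inf; [exists (b c) => _ [s st <-]; exact: cmin|exists c].
by apply: lb_le_inf; [exists (b c), c|move=> _ [s st <-]; exact: cmin].
Qed.

Lemma pushing_ge0 b t : 0 <= pushing b t.
Proof. by rewrite oppr_ge0 ge_min lexx. Qed.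

Lemma reflected_ge0 b t : 0 <= t -> continuous b -> 0 <= reflected b t.
Proof.
move=> t0 cb; rewrite /reflected /pushing max_r// subr_ge0 ge_min; apply/orP; right.
have [c [ct -> cmin]] := running_inf_attained t0 cb.
by apply: cmin; rewrite t0 lexx.
Qed.

(* The minimum over [0, u] is either already reached on [0, t], or reached at
   some c in [t, u], where the reflected path vanishes. *)
Lemma pushing_incr b t u : 0 <= t <= u -> continuous b ->
  pushing b t <= pushing b u /\
  (pushing b t < pushing b u -> exists c, [/\ t <= c <= u,
    reflected b c = 0 & pushing b u - pushing b t <= `|b t - b c|]).
Proof.
move=> /andP[t0 tu] cb; have u0 := le_trans t0 tu.
rewrite /pushing !max_r//.
have [c [/andP[c0 cu] Eu cmin]] := running_inf_attained u0 cb.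
have [e [/andP[e0 et] Et emin]] := running_inf_attained t0 cb.
have ue : running_inf b u <= running_inf b t.
  by rewrite Eu Et; apply: cmin; rewrite e0 (le_trans et).
have mono : Num.min 0 (running_inf b u) <= Num.min 0 (running_inf b t) by rewrite le_min2.
split; first by rewrite lerN2.
rewrite ltrN2 => lt; exists c.
have tc : t < c.
  rewrite ltNge; apply/negP => ct; move: lt; rewrite Eu Et.
  have := emin c; rewrite c0 ct => /(_ isT) h.
  by rewrite ltNge le_min2.
have un : running_inf b u < 0.
  by rewrite ltNge; apply/negP => h; move: lt; rewrite (min_l h) lt_min ltxx.
have Ec : running_inf b c = b c.
  have [f [/andP[f0 fc] Ef fmin]] := running_inf_attained c0 cb.
  apply/eqP; rewrite eq_le Ef fmin ?c0 ?lexx//= cmin// f0.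
  exact: le_trans fc cu.
split.
- by rewrite (ltW tc) cu.
- by rewrite /reflected /pushing max_r// Ec min_r ?subrr// -Eu ltW.
- rewrite opprK addrC (min_r (ltW un)) Eu.
  apply: (@le_trans _ _ (b t - b c)); last exact: ler_norm.
  by rewrite lerB// ge_min; apply/orP; right; rewrite Et; apply: emin; rewrite t0 lexx.
Qed.

(** By [pushing_incr] an increase of the pushing term is at most the distance of two values of b
    taken in between. When u < t neither of them is [b t]; they are compared through it, hence
    [e + e]. *)
Lemma pushing_dist b t u d e : continuous b -> 0 <= t -> 0 <= u ->
  (forall s, 0 <= s -> `|s - t| <= d -> `|b s - b t| <= e) -> `|u - t| <= d ->
  `|pushing b u - pushing b t| <= e + e.
Proof.
move=> cb t0 u0 be ut.
have e0 : 0 <= e.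
  by apply: le_trans (be t t0 _); rewrite ?subrr ?normr0// (le_trans _ ut).
have [tu|/ltW tu] := leP t u.
  have [|m h] := @pushing_incr b t u _ cb; first by rewrite t0.
  rewrite ger0_norm ?subr_ge0//.
  move: m; rewrite le_eqVlt => /predU1P[->|/h[c [/andP[tc cu] _ cP]]]; first by rewrite subrr addr_ge0.
  apply: (le_trans cP); rewrite distrC (@le_trans _ _ e) ?lerDl//; apply: be.
    exact: le_trans tc.
  by move: ut; rewrite !ger0_norm ?subr_ge0// => ut; lra.
have [|m h] := @pushing_incr b u t _ cb; first by rewrite u0.
rewrite distrC ger0_norm ?subr_ge0//.
move: m; rewrite le_eqVlt => /predU1P[->|/h[c [/andP[uc ct] _ cP]]]; first by rewrite subrr addr_ge0.
apply: (le_trans cP); rewrite -[b u - b c](subrKA (b t)) (le_trans (ler_normD _ _))// lerD//.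
  exact: be.
rewrite distrC; apply: be; first exact: le_trans uc.
by move: ut; rewrite !ler0_norm ?subr_le0// => ut; lra.
Qed.

Lemma pushing_max0 b t : pushing b (Num.max 0 t) = pushing b t.
Proof. by rewrite /pushing; congr (- Num.min 0 (running_inf b _)); rewrite maxA maxxx. Qed.

Lemma continuous_pushing b : continuous b -> continuous (pushing b).
Proof.
move=> cb t; apply/cvgrPdist_le => e e0.
have e2 : 0 < e / 2 by rewrite divr_gt0.
have /cvgrPdist_lt/(_ _ e2) [d /= d0 dP] := cb (Num.max 0 t).
have d2 : 0 < d / 2 by rewrite divr_gt0.
exists (d / 2) => //= u; rewrite /= distrC => ut; rewrite distrC.
rewrite -(pushing_max0 b u) -(pushing_max0 b t) [leRHS]splitr.
apply: (@pushing_dist _ _ _ (d / 2)) => //; rewrite ?le_max ?lexx//.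
- move=> s s0 st; rewrite distrC ltW//; apply: dP; rewrite /= distrC (le_lt_trans st)//.
  by rewrite [ltRHS]splitr ltrDl.
- apply: le_trans (ltW ut); move: (leP 0 u) (leP 0 t) => [u0|u0] [t0|t0].
  + by [].
  + by rewrite subr0 !ger0_norm; lra.
  + by rewrite sub0r normrN ger0_norm// ler0_norm; lra.
  + by rewrite subrr normr0.
Qed.

Lemma continuous_reflected b : continuous b -> continuous (reflected b).
Proof. by move=> cb t; apply: cvgD; [exact: cb|exact: continuous_pushing]. Qed.

End Reflection.

(** * Taylor expansions with Neumann boundary data *)

Section ChainRule.
Context {R : realType}.

Lemma near_finite_forall {T : topologicalType} {I : finType} (x : T) (P : I -> T -> Prop) :
  (forall i, \forall y \near x, P i y) -> \forall y \near x, forall i, P i y.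
Proof. exact: filter_forall. Qed.

Lemma convex_lt (s a b r : R) : 0 <= s <= 1 -> a < r -> b < r -> a + s * (b - a) < r.
Proof. by move=> /andP[s0 s1] ar br; have [ab|ab] := leP a b; nra. Qed.

Lemma convex_dist_lt (s a b c r : R) : 0 <= s <= 1 -> `|a - c| < r -> `|b - c| < r ->
  `|a + s * (b - a) - c| < r.
Proof.
move=> s01; rewrite !ltr_norml => /andP[a1 a2] /andP[b1 b2]; apply/andP; split.
  have h : c - a + s * ((c - b) - (c - a)) < r by apply: convex_lt => //; lra.
  have e : s * ((c - b) - (c - a)) = - (s * (b - a)) by ring.
  by rewrite e in h; lra.
have := @convex_lt s (a - c) (b - c) r s01 a2 b2.
by rewrite (_ : _ + _ = a + s * (b - a) - c)//; ring.
Qed.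

Lemma is_derive_epsP (g : R -> R) (x a : R) :
  is_derive x 1 g a <->
  (forall e, 0 < e -> exists2 d, 0 < d & forall h, `|h| < d ->
     `|g (x + h) - g x - a * h| <= e * `|h|).
Proof.
split.
- move=> [dg ga] e e0.
  have : h^-1 *: (g (h *: 1 + x) - g x) @[h --> 0^'] --> a by rewrite -ga; exact: dg.
  move=> /cvgrPdist_le/(_ _ e0); rewrite near_withinE => -[d /= d0 dP].
  exists d => // h hd; have [->|h0] := eqVneq h 0.
    by rewrite addr0 subrr mulr0 subr0 !normr0 mulr0.
  have := dP h; rewrite /= sub0r normrN => /(_ hd h0).
  rewrite [_ *: 1]mulr1 (addrC h) => H.
  rewrite (_ : _ - a * h = - h * (a - h^-1 *: (g (x + h) - g x))); last first.
    by rewrite -[_ *: _]/(_ * _); field.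
  by rewrite normrM normrN mulrC ler_wpM2r.
- move=> H; have c : h^-1 *: (g (h *: 1 + x) - g x) @[h --> 0^'] --> a.
    apply/cvgrPdist_le => e e0; have [d d0 dP] := H _ e0.
    rewrite near_withinE; exists d => //= h; rewrite /= sub0r normrN => hd h0.
    have := dP h hd; rewrite [_ *: 1]mulr1 (addrC h).
    rewrite (_ : _ - a * h = - h * (a - h^-1 *: (g (x + h) - g x))); last first.
      by rewrite -[_ *: _]/(_ * _); field.
    by rewrite normrM normrN mulrC ler_pM2r// normr_gt0.
  split; first by apply/cvg_ex; exists a.
  by apply: cvg_lim.
Qed.

Lemma is_derive_continuous (g : R -> R) (x a : R) :
  is_derive x 1 g a -> {for x, continuous g}.
Proof. by case=> dg _; apply: differentiable_continuous; apply/derivable1_diffP. Qed.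

Context {n : nat}.
Implicit Types (f : 'rV[R]_n -> R) (x y z : 'rV[R]_n).

Definition norm1_dist x y : R := \sum_i `|y 0 i - x 0 i|.

Definition box x (r : R) : set 'rV[R]_n := [set y | forall i, `|y 0 i - x 0 i| < r].

Lemma nbhs_box x (A : set 'rV[R]_n) : nbhs x A <-> exists2 r : R, 0 < r & box x r `<=` A.
Proof.
split => [/nbhs_ballP[r /= r0 rA]|[r r0 rA]].
  exists r => // y yr; apply: rA; split => // i j; rewrite ord1 /ball/= distrC; exact: yr.
apply/nbhs_ballP; exists r => //= y [_ yr]; apply: rA => i.
by have := yr 0 i; rewrite /ball/= distrC.
Qed.

Lemma is_derive_line f x v (s : R) : derivable f (x + s *: v) v ->
  is_derive s 1 (fun s : R => f (x + s *: v)) ('D_v f (x + s *: v)).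
Proof.
move=> df.
have E : (fun h : R => h^-1 *: ((f (x + (h *: 1 + s) *: v) : R) - f (x + s *: v))) =
   (fun h : R => h^-1 *: (f (h *: v + (x + s *: v)) - f (x + s *: v))).
  by apply/funext => h; rewrite [h *: 1]mulr1 scalerDl addrCA.
split; first by rewrite /derivable /= E.
by rewrite /derive /= E.
Qed.

(* Telescoping along the points that agree with [z] before coordinate [k] and
   with [y] from coordinate [k] on reduces to the mean value theorem. *)
Lemma strict_diff_partial f x :
  (\forall y \near x, forall i, derivable f y 'e_i) ->
  (forall i, {for x, continuous ('D_('e_i) f)}) ->
  forall e, 0 < e -> exists2 r : R, 0 < r & forall y z, box x r y -> box x r z ->
    `|f z - f y - \sum_i 'D_('e_i) f x * (z 0 i - y 0 i)| <= e * norm1_dist y z.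
Proof.
move=> df cf e e0.
have cf' : \forall y \near x, forall i : 'I_n, `|'D_('e_i) f x - 'D_('e_i) f y| <= e.
  by apply: near_finite_forall => i; have /cvgrPdist_le := cf i; apply.
have [r r0 rP] := (nbhs_box _ _).1 (filterI df cf'); exists r => // y z yr zr.
pose w (k : nat) : 'rV[R]_n := \row_i (if (i < k)%N then z 0 i else y 0 i).
have w0 : w 0%N = y by apply/rowP => i; rewrite mxE.
have wn : w n = z by apply/rowP => i; rewrite mxE ltn_ord.
rewrite -{1}w0 -{1}wn -(telescope_sumr (fun k => f (w k)) (leq0n n)) big_mkord.
rewrite -sumrB (le_trans (ler_norm_sum _ _ _))// /norm1_dist mulr_sumr; apply: ler_sum => k _.
have wk : w k.+1 = w k + (z 0 k - y 0 k) *: 'e_k.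
  apply/rowP => i; rewrite !mxE eqxx /= ltnS leq_eqVlt.
  have [->|ik] := eqVneq i k; first by rewrite eqxx /= ltnn mulr1 addrC subrK.
  by rewrite (negbTE (_ : (i : nat) != k)) ?mulr0 ?addr0// -val_eqE.
pose phi (s : R) := f (w k + s *: ((z 0 k - y 0 k) *: 'e_k)).
have inbox (s : R) : 0 <= s <= 1 -> box x r (w k + (s * (z 0 k - y 0 k)) *: 'e_k).
  move=> /andP[s0 s1] i; rewrite !mxE /=.
  have [->|ik] := eqVneq i k; last first.
    by rewrite mulr0 addr0; case: ifP => _; [exact: zr|exact: yr].
  by rewrite ltnn mulr1; apply: convex_dist_lt; [rewrite s0 s1|exact: yr|exact: zr].
have dphi (s : R) : 0 <= s <= 1 -> is_derive s 1 (fun s : R => f (w k + (s * (z 0 k - y 0 k)) *: 'e_k))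
    ('D_('e_k) f (w k + (s * (z 0 k - y 0 k)) *: 'e_k) * (z 0 k - y 0 k)).
  move=> s01.
  have h1 := @is_derive_line f (w k) 'e_k (s * (z 0 k - y 0 k)) ((rP _ (inbox _ s01)).1 k).
  have h2 : is_derive s 1 (fun s : R => s * (z 0 k - y 0 k)) (z 0 k - y 0 k).
    apply/is_derive_epsP => ep ep0; exists 1 => // h _.
    by rewrite mulrDl [s * _ + _]addrC addrK [h * _]mulrC subrr normr0 mulr_ge0// ltW.
  exact: (@is_derive1_comp _ (fun s : R => f (w k + s *: 'e_k)) (fun s : R => s * (z 0 k - y 0 k)) s _ _ h1 h2).
have [] := @MVT R (fun s : R => f (w k + (s * (z 0 k - y 0 k)) *: 'e_k))
  (fun s => 'D_('e_k) f (w k + (s * (z 0 k - y 0 k)) *: 'e_k) * (z 0 k - y 0 k)) 0 1 ltr01.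
- by move=> s; rewrite in_itv/= => /andP[s0 s1]; apply: dphi; rewrite !ltW.
- apply: derivable_within_continuous => s; rewrite in_itv/= => s01; by case: (dphi s s01).
move=> c; rewrite in_itv/= => /andP[c0 c1].
rewrite mul1r mul0r scale0r addr0 subr0 mulr1 wk => ->.
rewrite -mulrBl normrM; apply: ler_wpM2r; first exact: normr_ge0.
by rewrite distrC; apply: ((rP _ (inbox c _)).2 k); rewrite !ltW.
Qed.

(** [C2_on] speaks of partial derivatives only. Their continuity gives the strict expansion of
    [strict_diff_partial], into which the expansion of the curve is substituted. *)
Lemma is_derive_chain f (c : R -> 'rV[R]_n) (dc : 'I_n -> R) (s : R) :
  (\forall y \near c s, forall i, derivable f y 'e_i) ->
  (forall i, {for c s, continuous ('D_('e_i) f)}) ->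
  (forall i, is_derive s 1 (fun s => c s 0 i) (dc i)) ->
  is_derive s 1 (fun s => f (c s)) (\sum_i 'D_('e_i) f (c s) * dc i).
Proof.
move=> df cf dcs; apply/is_derive_epsP => e e0.
(* [M1] bounds the speed of the curve in the 1-norm, its expansion error per coordinate being at
   most |h|, and [M2] bounds the gradient. With these the errors of f and of the curve are each at
   most e/2 times |h|. *)
pose M1 := 1 + \sum_i (`|dc i| + 1); pose M2 := 1 + \sum_i `|'D_('e_i) f (c s)|.
have M10 : 0 < M1 by rewrite ltr_pwDl// sumr_ge0// => i _; rewrite addr_ge0.
have M20 : 0 < M2 by rewrite ltr_pwDl// sumr_ge0.
have e10 : 0 < e / (2 * M1) by rewrite divr_gt0// mulr_gt0.
have [r r0 rP] := strict_diff_partial df cf e10.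
pose e2 := Num.min 1 (e / (2 * M2)).
have e20 : 0 < e2 by rewrite lt_min ltr01 divr_gt0// mulr_gt0.
have : exists2 d, 0 < d & forall h, `|h| < d -> forall i,
   `|c (s + h) 0 i - c s 0 i - dc i * h| <= e2 * `|h| /\ `|c (s + h) 0 i - c s 0 i| < r.
  have : \forall h \near 0, forall i, `|c (s + h) 0 i - c s 0 i - dc i * h| <= e2 * `|h| /\ `|c (s + h) 0 i - c s 0 i| < r.
    apply: near_finite_forall => i.
    have [d1 d10 H1] := (is_derive_epsP _ _ _).1 (dcs i) _ e20.
    have /cvgrPdist_lt/(_ _ r0)[d2 /= d20 H2] := is_derive_continuous (dcs i).
    exists (Num.min d1 d2) => /=; first by rewrite lt_min d10.
    move=> h; rewrite /= sub0r normrN lt_min => /andP[h1 h2]; split; first exact: H1.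
    by rewrite distrC; apply: H2; rewrite /= opprD addrA subrr sub0r normrN.
  by move=> [d /= d0 dP]; exists d => // h hd; apply: dP; rewrite /= sub0r normrN.
move=> [d d0 dP]; exists d => // h hd.
have H := dP h hd.
have H3 : `|f (c (s + h)) - f (c s) - \sum_i 'D_('e_i) f (c s) * (c (s + h) 0 i - c s 0 i)|
    <= e / (2 * M1) * norm1_dist (c s) (c (s + h)).
  by apply: rP => i; [rewrite subrr normr0|exact: (H i).2].
have -> : f (c (s + h)) - f (c s) - (\sum_i 'D_('e_i) f (c s) * dc i) * h =
  (f (c (s + h)) - f (c s) - \sum_i 'D_('e_i) f (c s) * (c (s + h) 0 i - c s 0 i)) +
  \sum_i 'D_('e_i) f (c s) * (c (s + h) 0 i - c s 0 i - dc i * h).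
  have -> : \sum_i 'D_('e_i) f (c s) * (c (s + h) 0 i - c s 0 i - dc i * h) =
      \sum_i 'D_('e_i) f (c s) * (c (s + h) 0 i - c s 0 i) - (\sum_i 'D_('e_i) f (c s) * dc i) * h.
    by rewrite mulr_suml -sumrB; apply: eq_bigr => i _; ring.
  by ring.
have H4 : norm1_dist (c s) (c (s + h)) <= M1 * `|h|.
  apply: (@le_trans _ _ ((\sum_i (`|dc i| + 1)) * `|h|)); last by rewrite ler_wpM2r// lerDr.
  rewrite mulr_suml; apply: ler_sum => i _.
  rewrite -[X in `|X|](subrK (dc i * h)) (le_trans (ler_normD _ _))// mulrDl addrC normrM lerD2l.
  by apply: (le_trans (H i).1); rewrite ler_wpM2r// ge_min lexx.
have H5 : `|\sum_i 'D_('e_i) f (c s) * (c (s + h) 0 i - c s 0 i - dc i * h)| <= M2 * (e2 * `|h|).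
  apply: (le_trans (ler_norm_sum _ _ _)).
  apply: (@le_trans _ _ ((\sum_i `|'D_('e_i) f (c s)|) * (e2 * `|h|))); last first.
    by rewrite ler_wpM2r ?mulr_ge0 ?(ltW e20)// lerDr.
  rewrite mulr_suml; apply: ler_sum => i _; rewrite normrM ler_wpM2l//; exact: (H i).1.
apply: (le_trans (ler_normD _ _)).
have H6 : e / (2 * M1) * (M1 * `|h|) = e / 2 * `|h| by field; rewrite gt_eqF.
have H7 : M2 * (e2 * `|h|) <= e / 2 * `|h|.
  rewrite mulrA ler_wpM2r// (@le_trans _ _ (M2 * (e / (2 * M2))))//.
    by rewrite ler_wpM2l ?(ltW M20)// ge_min lexx orbT.
  by rewrite le_eqVlt; apply/orP; left; apply/eqP; field; rewrite gt_eqF.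
have H8 : e / (2 * M1) * norm1_dist (c s) (c (s + h)) <= e / 2 * `|h|.
  by rewrite -H6 ler_wpM2l// ltW.
by rewrite [leRHS](_ : _ = e / 2 * `|h| + e / 2 * `|h|); [rewrite lerD ?(le_trans H3) ?(le_trans H5)|field].
Qed.

End ChainRule.

(** * Second-order Taylor remainders along segments *)

Section Taylor.
Context {R : realType}.

(** Rolle's theorem for F s = f s + g s (1 - s) + K (1 - s)^2, where K is chosen so that F 0 = F 1;
    a zero of F' at s < 1 gives k s = 2 K. *)
Lemma taylor2_segment (f g k : R -> R) :
  (forall s : R, 0 <= s <= 1 -> is_derive s 1 f (g s)) ->
  (forall s : R, 0 <= s <= 1 -> is_derive s 1 g (k s)) ->
  exists2 s : R, 0 < s < 1 & f 1 = f 0 + g 0 + 2^-1 * k s.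
Proof.
move=> df dg; pose K := f 1 - f 0 - g 0.
pose F s := f s + g s * (1 - s) + K * (1 - s) ^+ 2.
have dF (s : R) : 0 <= s <= 1 -> is_derive s 1 (F : R -> R) (k s * (1 - s) - 2 * K * (1 - s)).
  move=> s01; have := df s s01; have := dg s s01 => dgs dfs.
  pose u (s : R) : R := 1 - s.
  have hu : is_derive s 1 (u : R -> R) (-1).
    apply/is_derive_epsP => e e0; exists 1 => // h _.
    by rewrite /u (_ : _ - _ = 0) ?normr0 ?mulr_ge0 ?(ltW e0)//; ring.
  have h3 := is_deriveD (is_deriveD dfs (is_deriveM dgs hu)) (is_deriveZ K (is_deriveM hu hu)).
  have -> : F = (f : R -> R) + (g : R -> R) * u + K *: (u * u).
    by apply/funext.
  by apply: (is_derive_eq h3); rewrite /GRing.scale /= /u; ring.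
have [] := @MVT R F (fun s => k s * (1 - s) - 2 * K * (1 - s)) 0 1 ltr01.
- by move=> s; rewrite in_itv/= => /andP[s0 s1]; apply: dF; rewrite !ltW.
- apply: derivable_within_continuous => s; rewrite in_itv/= => s01; by case: (dF s s01).
move=> s; rewrite in_itv/= => s01 E; exists s => //.
have F1 : F 1 = f 1 by rewrite /F subrr expr0n /= !mulr0 !addr0.
have F0 : F 0 = f 1 by rewrite /F subr0 expr1n /K; ring.
move: E; rewrite F1 F0 subrr subr0 mulr1 -mulrBl => /esym/eqP; rewrite mulf_eq0 => /orP[/eqP h|/eqP h].
  by move: h; rewrite /K => h; lra.
by move: s01 => /andP[_]; lra.
Qed.

Context {d : nat}.
Implicit Types (G : 'rV[R]_d -> R) (p : 'I_d -> 'rV[R]_d -> R)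
  (q : 'I_d -> 'I_d -> 'rV[R]_d -> R) (x y w h : 'rV[R]_d).

(** Differentiability along lines is enough for Taylor's formula on a segment, and it is what the
    chain rule provides for functions composed with polar coordinates. *)
Definition has_derivatives G p q w := forall h,
  is_derive (0 : R) 1 (fun s : R => G (w + s *: h)) (\sum_i p i w * h 0 i) /\
  forall i, is_derive (0 : R) 1 (fun s : R => p i (w + s *: h)) (\sum_j q i j w * h 0 j).

Definition taylor_rem G p q x y := G y - G x - \sum_i p i x * (y 0 i - x 0 i) -
  2^-1 * \sum_i \sum_j q i j x * (y 0 i - x 0 i) * (y 0 j - x 0 j).

Lemma is_derive_translate (f : R -> R) (s a : R) :
  is_derive (0 : R) 1 (fun u : R => f (s + u)) a -> is_derive s 1 f a.
Proof.
move=> /is_derive_epsP H; apply/is_derive_epsP => e /H[r r0 rP]; exists r => // h /rP.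
by rewrite add0r addr0.
Qed.

Lemma taylor_rem_segment G p q x y :
  (forall s : R, 0 <= s <= 1 -> has_derivatives G p q (x + s *: (y - x))) ->
  exists2 s : R, 0 < s < 1 & taylor_rem G p q x y = 2^-1 * \sum_i \sum_j
    (q i j (x + s *: (y - x)) - q i j x) * (y 0 i - x 0 i) * (y 0 j - x 0 j).
Proof.
move=> H; pose h := y - x; pose c (s : R) := x + s *: h.
have hE i : y 0 i - x 0 i = h 0 i by rewrite !mxE.
have cD s u : c (s + u) = c s + u *: h by rewrite /c scalerDl addrA.
have [||s s01 E] := @taylor2_segment (fun s => G (c s)) (fun s => \sum_i p i (c s) * h 0 i)
    (fun s => \sum_i (\sum_j q i j (c s) * h 0 j) * h 0 i).
- move=> s s01; apply: is_derive_translate.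
  by under eq_fun do rewrite cD; exact: (H s s01 h).1.
- move=> s s01; apply: is_derive_translate.
  under eq_fun do under eq_bigr do rewrite cD.
  have dp i := (H s s01 h).2 i.
  apply/is_derive_epsP => e e0.
  pose M := 1 + \sum_i `|h 0 i|.
  have M0 : 0 < M by rewrite ltr_pwDl// sumr_ge0.
  have eM : 0 < e / M by rewrite divr_gt0.
  have : \forall u \near (0 : R), forall i,
     `|p i (c s + (0 + u) *: h) - p i (c s + 0 *: h) - (\sum_j q i j (c s) * h 0 j) * u| <= e / M * `|u|.
    apply: near_finite_forall => i; have [r r0 rP] := (is_derive_epsP _ _ _).1 (dp i) _ eM.
    by exists r => //= u; rewrite /= sub0r normrN => /rP.
  move=> [r /= r0 rP]; exists r => // u ur.
  rewrite mulr_suml -!sumrB (le_trans (ler_norm_sum _ _ _))//.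
  apply: (@le_trans _ _ ((\sum_i `|h 0 i|) * (e / M * `|u|))).
    rewrite mulr_suml; apply: ler_sum => i _.
    rewrite (_ : _ - _ = h 0 i * (p i (c s + (0 + u) *: h) - p i (c s + 0 *: h) - (\sum_j q i j (c s) * h 0 j) * u)); last by ring.
    rewrite normrM ler_wpM2l//; apply: rP; rewrite /= sub0r normrN//.
  rewrite (@le_trans _ _ (M * (e / M * `|u|)))//.
    by rewrite ler_wpM2r ?lerDr// mulr_ge0// ltW.
  by rewrite mulrA (mulrC M) divfK ?gt_eqF.
exists s => //; rewrite /taylor_rem.
have c1 : c 1 = y by rewrite /c scale1r addrC subrK.
have c0 : c 0 = x by rewrite /c scale0r addr0.
move: E; rewrite c1 c0 => ->.
have -> : \sum_i p i x * (y 0 i - x 0 i) = \sum_i p i x * h 0 i.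
  by apply: eq_bigr => i _; rewrite hE.
have -> : \sum_i \sum_j q i j x * (y 0 i - x 0 i) * (y 0 j - x 0 j) =
    \sum_i \sum_j q i j x * h 0 i * h 0 j.
  by apply: eq_bigr => i _; apply: eq_bigr => j _; rewrite !hE.
have -> : \sum_i \sum_j (q i j (x + s *: (y - x)) - q i j x) * (y 0 i - x 0 i) * (y 0 j - x 0 j) =
    \sum_i \sum_j q i j (c s) * h 0 i * h 0 j - \sum_i \sum_j q i j x * h 0 i * h 0 j.
  rewrite -sumrB; apply: eq_bigr => i _; rewrite -sumrB; apply: eq_bigr => j _.
  by rewrite !hE -/h -/(c s); ring.
have -> : \sum_i (\sum_j q i j (c s) * h 0 j) * h 0 i = \sum_i \sum_j q i j (c s) * h 0 i * h 0 j.
  by apply: eq_bigr => i _; rewrite mulr_suml; apply: eq_bigr => j _; rewrite mulrAC.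
by ring.
Qed.

Lemma norm1_distE x y : (norm1_dist x y) ^+ 2 = \sum_i \sum_j `|y 0 i - x 0 i| * `|y 0 j - x 0 j|.
Proof. by rewrite expr2 /norm1_dist mulr_suml; apply: eq_bigr => i _; rewrite mulr_sumr. Qed.

Lemma taylor_rem_le G p q x y e :
  (forall s : R, 0 <= s <= 1 -> has_derivatives G p q (x + s *: (y - x))) ->
  (forall s : R, 0 < s < 1 -> forall i j, `|q i j (x + s *: (y - x)) - q i j x| <= e) ->
  `|taylor_rem G p q x y| <= e * (norm1_dist x y) ^+ 2.
Proof.
move=> /taylor_rem_segment[s s01 ->] qe; rewrite normrM ger0_norm ?invr_ge0//.
have H : `|\sum_i \sum_j (q i j (x + s *: (y - x)) - q i j x) * (y 0 i - x 0 i) * (y 0 j - x 0 j)|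
    <= e * (norm1_dist x y) ^+ 2.
  rewrite norm1_distE mulr_sumr (le_trans (ler_norm_sum _ _ _))//; apply: ler_sum => i _.
  rewrite mulr_sumr (le_trans (ler_norm_sum _ _ _))//; apply: ler_sum => j _.
  by rewrite !normrM -mulrA ler_wpM2r ?mulr_ge0//; exact: qe.
apply: le_trans H; rewrite ler_piMl//; lra.
Qed.

End Taylor.

(** * Functions on the orthant with vanishing normal derivatives *)

Section NeumannData.
Context {R : realType} {d : nat}.
Implicit Types (x y z w h : 'rV[R]_d).

(* [p] and [q] play the roles of the gradient and of the Hessian of [G]; the
   bounds are only required away from the origin, where [G] may be singular. *)
Record neumann_data (delta C : R) (G : 'rV[R]_d -> R) (p : 'I_d -> 'rV[R]_d -> R)
    (q : 'I_d -> 'I_d -> 'rV[R]_d -> R) : Prop := NeumannData {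
  nd_contG : forall x, orthant x -> x != 0 -> {for x, continuous G};
  nd_contp : forall i x, orthant x -> x != 0 -> {for x, continuous (p i)};
  nd_contq : forall i j x, orthant x -> x != 0 -> {for x, continuous (q i j)};
  nd_face : forall i x, orthant x -> x != 0 -> x 0 i = 0 -> p i x = 0;
  nd_growth : forall x, orthant x -> `|G x| <= C * (1 + (norm1 x) ^+ 2);
  nd_boundp : forall i x, orthant x -> delta <= norm1 x -> `|p i x| <= C;
  nd_boundq : forall i j x, orthant x -> delta <= norm1 x -> `|q i j x| <= C;
  nd_rem : forall x y, orthant x -> orthant y -> delta <= norm1 x ->
    `|taylor_rem G p q x y| <= C * (norm1_dist x y) ^+ 2;
  nd_local : forall x, orthant x -> x != 0 -> forall e, 0 < e ->
    exists2 r : R, 0 < r & forall y z, orthant y -> orthant z -> box x r y -> box x r z ->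
      `|taylor_rem G p q y z| <= e * (norm1_dist y z) ^+ 2 }.

Lemma norm1_ge0 x : 0 <= norm1 x.
Proof. exact: sumr_ge0. Qed.

Lemma norm1_orthant x : orthant x -> norm1 x = \sum_i x 0 i.
Proof. by move=> ox; apply: eq_bigr => i _; rewrite ger0_norm//; exact: ox. Qed.

Lemma norm1_gt0 x : x != 0 -> 0 < norm1 x.
Proof.
move=> x0; rewrite lt_neqAle norm1_ge0 andbT eq_sym; apply: contra x0 => n0.
apply/eqP/rowP => i; rewrite mxE; apply/eqP; rewrite -normr_eq0 eq_le normr_ge0 andbT.
by rewrite -(eqP n0) /norm1 (bigD1 i)//= lerDl sumr_ge0.
Qed.

Lemma norm1_eq0 : norm1 (0 : 'rV[R]_d) = 0.
Proof. by rewrite /norm1 big1// => i _; rewrite mxE normr0. Qed.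

Lemma norm1_gt0P x : (0 < norm1 x) = (x != 0).
Proof.
by apply/idP/idP => [|/norm1_gt0//]; apply: contraTneq => ->; rewrite norm1_eq0 ltxx.
Qed.

Lemma orthant_segment x y (s : R) : orthant x -> orthant y -> 0 <= s <= 1 ->
  orthant (x + s *: (y - x)).
Proof.
move=> ox oy /andP[s0 s1] i; rewrite !mxE; have := ox i; have := oy i; nra.
Qed.

(** On the orthant the 1-norm is a linear form, so a segment between two of its points stays away
    from the origin when its ends do. *)
Lemma norm1_segment x y (s : R) : orthant x -> orthant y -> 0 <= s <= 1 ->
  norm1 (x + s *: (y - x)) = norm1 x + s * (norm1 y - norm1 x).
Proof.
move=> ox oy s01; rewrite !norm1_orthant//; last exact: orthant_segment.
rewrite -sumrB mulr_sumr -big_split/=; apply: eq_bigr => i _.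
by rewrite !mxE.
Qed.

Lemma norm1_dist_ge0 x y : 0 <= norm1_dist x y.
Proof. exact: sumr_ge0. Qed.

Lemma norm1_dist_le x y : orthant x -> orthant y -> `|norm1 y - norm1 x| <= norm1_dist x y.
Proof.
move=> ox oy; rewrite !norm1_orthant// -sumrB; exact: ler_norm_sum.
Qed.

Lemma box_segment x (r : R) y z (s : R) : 0 <= s <= 1 -> box x r y -> box x r z ->
  box x r (y + s *: (z - y)).
Proof.
by move=> s01 yr zr i; rewrite !mxE; apply: convex_dist_lt.
Qed.

Lemma taylor_rem_local (G : 'rV[R]_d -> R) p q x :
  (\forall w \near x, orthant w -> has_derivatives G p q w) ->
  (forall i j, {for x, continuous (q i j)}) ->
  forall e, 0 < e -> exists2 r : R, 0 < r & forall y z, orthant y -> orthant z ->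
    box x r y -> box x r z -> `|taylor_rem G p q y z| <= e * (norm1_dist y z) ^+ 2.
Proof.
move=> dG cq e e0.
have e2 : 0 < e / 2 by rewrite divr_gt0.
have cq' : \forall w \near x, forall ij : 'I_d * 'I_d, `|q ij.1 ij.2 x - q ij.1 ij.2 w| <= e / 2.
  by apply: near_finite_forall => -[i j]; have /cvgrPdist_le := cq i j; apply.
have [r r0 rP] := (nbhs_box _ _).1 (filterI dG cq'); exists r => // y z oy oz yr zr.
apply: taylor_rem_le => s s01.
  by apply: (rP _ _).1; [exact: box_segment|exact: orthant_segment].
move=> i j.
have s01' : 0 <= s <= 1 by move: s01 => /andP[/ltW -> /ltW ->].
have h1 := (rP _ (box_segment s01' yr zr)).2 (i, j).
have h2 := (rP _ yr).2 (i, j).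
rewrite -[X in `|X|](subrKA (q i j x)) [leRHS]splitr (le_trans (ler_normD _ _))// lerD//.
by rewrite distrC.
Qed.

(* Far from [x], the remainder is controlled term by term, since
   [norm1_dist x y] is bounded below. *)
Lemma taylor_rem_global (G : 'rV[R]_d -> R) p q (delta M : R) x y :
  0 < delta -> 0 <= M -> orthant x -> orthant y -> delta <= norm1 x ->
  (forall w, orthant w -> delta / 2 <= norm1 w -> has_derivatives G p q w) ->
  (forall w, orthant w -> delta / 2 <= norm1 w -> forall i, `|p i w| <= M) ->
  (forall w, orthant w -> delta / 2 <= norm1 w -> forall i j, `|q i j w| <= M) ->
  `|G y - G x| <= M * (1 + norm1_dist x y ^+ 2) ->
  `|taylor_rem G p q x y| <= (4 * M / delta ^+ 2 + 4 * M + 2 * M / delta) * (norm1_dist x y) ^+ 2.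
Proof.
move=> d0 M0 ox oy dx dG bp bq gG.
have D0 := norm1_dist_ge0 x y.
have c0 : 0 <= 4 * M / delta ^+ 2 by apply: divr_ge0; [exact: mulr_ge0|exact: sqr_ge0].
have c1 : 0 <= 2 * M / delta by rewrite divr_ge0 ?mulr_ge0// ltW.
have xd2 : delta / 2 <= norm1 x by lra.
have [near|far] := leP (norm1_dist x y) (delta / 2).
  have seg (s : R) : 0 <= s <= 1 -> orthant (x + s *: (y - x)) /\ delta / 2 <= norm1 (x + s *: (y - x)).
    move=> s01; split; first exact: orthant_segment.
    rewrite norm1_segment//; have := norm1_dist_le ox oy; rewrite ler_norml => /andP[a b].
    by move: s01 => /andP[s0 s1]; nra.
  apply: (@le_trans _ _ (2 * M * norm1_dist x y ^+ 2)).
    apply: taylor_rem_le => s s01.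
      by have [] := seg s s01; exact: dG.
    move=> i j; have [a b] : orthant (x + s *: (y - x)) /\ delta / 2 <= norm1 (x + s *: (y - x)).
      by apply: seg; move: s01 => /andP[/ltW -> /ltW ->].
    rewrite (le_trans (ler_normB _ _))// mulr_natl mulr2n lerD//; [exact: bq|exact: bq].
  by apply: ler_wpM2r; [rewrite exprn_ge0|lra].
set D := norm1_dist x y in far D0 gG *.
have h1 : `|\sum_i p i x * (y 0 i - x 0 i)| <= M * D.
  rewrite (le_trans (ler_norm_sum _ _ _))// mulr_sumr; apply: ler_sum => i _.
  by rewrite normrM ler_wpM2r//; exact: bp.
have h2 : `|\sum_i \sum_j q i j x * (y 0 i - x 0 i) * (y 0 j - x 0 j)| <= M * D ^+ 2.
  rewrite norm1_distE mulr_sumr (le_trans (ler_norm_sum _ _ _))//; apply: ler_sum => i _.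
  rewrite mulr_sumr (le_trans (ler_norm_sum _ _ _))//; apply: ler_sum => j _.
  by rewrite !normrM -mulrA ler_wpM2r ?mulr_ge0//; exact: bq.
(* As D > delta / 2, the powers 0 and 1 of D are absorbed into D^2. This is the source of the terms
   4 M / delta^2 and 2 M / delta of the constant. *)
have k1 : 1 <= 4 / delta ^+ 2 * D ^+ 2.
  by rewrite mulrAC ler_pdivlMr ?exprn_gt0//; nra.
have k2 : D <= 2 / delta * D ^+ 2.
  by rewrite mulrAC ler_pdivlMr//; nra.
apply: (@le_trans _ _ (M * (1 + D ^+ 2) + M * D + M * D ^+ 2)).
  rewrite /taylor_rem (le_trans (ler_normB _ _))// lerD ?(le_trans (ler_normB _ _))// ?lerD//.
  by rewrite normrM ger0_norm ?invr_ge0// (le_trans _ h2)// ler_piMl//; lra.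
have l1 := ler_wpM2l M0 k1; have l2 := ler_wpM2l M0 k2.
have l3 : 0 <= M * D ^+ 2 by rewrite mulr_ge0// exprn_ge0.
have -> : (4 * M / delta ^+ 2 + 4 * M + 2 * M / delta) * D ^+ 2 =
    M * (4 / delta ^+ 2 * D ^+ 2) + 4 * (M * D ^+ 2) + M * (2 / delta * D ^+ 2).
  by field; rewrite gt_eqF.
lra.
Qed.

End NeumannData.

Section ContinuityInRows.
Context {R : realType} {n : nat}.

Lemma continuous_coord (i : 'I_n) : continuous (fun x : 'rV[R]_n => x 0 i).
Proof. exact: coord_continuous. Qed.

Lemma continuous_at_rows {X : topologicalType} (f : X -> 'rV[R]_n) (x : X) :
  (forall i, {for x, continuous (fun u => f u 0 i)}) -> {for x, continuous f}.
Proof.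
move=> cf A /nbhs_box[r r0 rA].
have : \forall u \near x, forall i : 'I_n, `|f x 0 i - f u 0 i| < r.
  by apply: near_finite_forall => i; have /cvgrPdist_lt := cf i; apply.
by apply: filterS => u H; apply: rA => i; rewrite distrC.
Qed.

Section ContinuousAt.
Context {X : topologicalType} (x : X).
Implicit Types f g : X -> R.

Lemma continuous_at_cst (c : R) : {for x, continuous (fun _ : X => c)}.
Proof. exact: cvg_cst. Qed.

Lemma continuous_at_add f g : {for x, continuous f} -> {for x, continuous g} ->
  {for x, continuous (fun u => f u + g u)}.
Proof. exact: cvgD. Qed.

Lemma continuous_at_sub f g : {for x, continuous f} -> {for x, continuous g} ->
  {for x, continuous (fun u => f u - g u)}.
Proof. exact: cvgB. Qed.

Lemma continuous_at_mul f g : {for x, continuous f} -> {for x, continuous g} ->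
  {for x, continuous (fun u => f u * g u)}.
Proof. exact: cvgM. Qed.

Lemma continuous_at_inv f : f x != 0 -> {for x, continuous f} ->
  {for x, continuous (fun u => (f u)^-1)}.
Proof. exact: cvgV. Qed.

Lemma continuous_at_ln f : 0 < f x -> {for x, continuous f} ->
  {for x, continuous (fun u => ln (f u))}.
Proof.
by move=> fx cf; apply: (@continuous_comp _ _ _ f (@ln R)) => //; exact: continuous_ln.
Qed.

Lemma continuous_at_sum (I : finType) (f : I -> X -> R) :
  (forall i, {for x, continuous (f i)}) -> {for x, continuous (fun u => \sum_i f i u)}.
Proof.
move=> cf; have H (r : seq I) : \sum_(i <- r) f i u @[u --> x] --> \sum_(i <- r) f i x.
  elim: r => [|i r IH].
    by rewrite big_nil; under eq_fun do rewrite big_nil; exact: cvg_cst.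
  rewrite big_cons; under eq_fun do rewrite big_cons.
  by apply: cvgD; [exact: cf|exact: IH].
exact: H.
Qed.

End ContinuousAt.

End ContinuityInRows.

(** * The regularized logarithm ln (eps + |x|^2), with the Euclidean norm *)

Section LogSquareNorm.
Context {R : realType} {d : nat} (eps : R) (eps0 : 0 < eps).
Implicit Types (w h x y : 'rV[R]_d).

Definition sqnorm w : R := \sum_i w 0 i ^+ 2.

Definition log_sq w : R := ln (eps + sqnorm w).

Definition log_sq_p (i : 'I_d) w : R := 2 * w 0 i / (eps + sqnorm w).

Definition log_sq_q (i j : 'I_d) w : R :=
  2 * (i == j)%:R / (eps + sqnorm w) - 4 * w 0 i * w 0 j / (eps + sqnorm w) ^+ 2.

Lemma sqnorm_ge0 w : 0 <= sqnorm w.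
Proof. by apply: sumr_ge0 => i _; rewrite sqr_ge0. Qed.

Let den_gt0 w : 0 < eps + sqnorm w.
Proof. by rewrite ltr_pwDl// sqnorm_ge0. Qed.

Lemma sqnorm_le_norm1 w : sqnorm w <= norm1 w ^+ 2.
Proof.
rewrite expr2 /norm1 mulr_suml; apply: ler_sum => i _.
rewrite -real_normK ?num_real// expr2 ler_wpM2l// (bigD1 i)//= lerDl sumr_ge0//.
Qed.

Lemma is_derive_affine (a b : R) : is_derive (0 : R) 1 (fun s : R => a + s * b) b.
Proof.
apply/is_derive_epsP => e e0; exists 1 => // h _.
by rewrite (_ : _ - _ = 0) ?normr0 ?mulr_ge0 ?(ltW e0)//; ring.
Qed.

Lemma is_derive_den w h :
  is_derive (0 : R) 1 (fun s : R => eps + sqnorm (w + s *: h)) (2 * \sum_i w 0 i * h 0 i).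
Proof.
apply/is_derive_epsP => e e0.
have c0 := sqnorm_ge0 h.
exists (e / (1 + sqnorm h)) => [|s hs]; first by rewrite divr_gt0// ltr_pwDl.
have E (u : R) : eps + sqnorm (w + u *: h) = eps + sqnorm w + u * (2 * \sum_i w 0 i * h 0 i) + u ^+ 2 * sqnorm h.
  rewrite /sqnorm -!addrA; congr (_ + _); rewrite !mulr_sumr -!big_split /=.
  by apply: eq_bigr => i _; rewrite !mxE; ring.
rewrite !E add0r (_ : _ - _ - _ = s ^+ 2 * sqnorm h); last by ring.
rewrite ltr_pdivlMr ?ltr_pwDl// in hs.
rewrite normrM (ger0_norm c0) normrX; have := normr_ge0 s; nra.
Qed.

Lemma has_derivatives_log_sq w : has_derivatives log_sq log_sq_p log_sq_q w.
Proof.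
move=> h; have w0 : w + 0 *: h = w by rewrite scale0r addr0.
have dz := is_derive_den w h.
split.
  have dl : is_derive (eps + sqnorm (w + 0 *: h)) 1 (@ln R) (eps + sqnorm (w + 0 *: h))^-1.
    by apply: is_derive1_ln; rewrite den_gt0.
  have -> : (fun s : R => log_sq (w + s *: h)) = @ln R \o (fun s : R => eps + sqnorm (w + s *: h)) by [].
  apply: (is_derive_eq (@is_derive1_comp _ (@ln R) (fun s : R => eps + sqnorm (w + s *: h)) 0 _ _ dl dz)); rewrite w0 /log_sq_p mulrA mulr_sumr.
  by apply: eq_bigr => i _; rewrite mulrC; ring.
move=> i.
have dn := is_derive_affine (2 * w 0 i) (2 * h 0 i).
have z0 : eps + sqnorm (w + (0 : R) *: h) != 0 by rewrite gt_eqF.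
have dv := @is_deriveV _ (fun s : R => eps + sqnorm (w + s *: h)) _ _ _ z0 dz.
have -> : (fun s : R => log_sq_p i (w + s *: h)) =
    (fun s : R => 2 * w 0 i + s * (2 * h 0 i) : R) * (fun s : R => (eps + sqnorm (w + s *: h))^-1 : R).
  by apply/funext => s; rewrite /log_sq_p !mxE mulrDr mulrCA.
apply: (is_derive_eq (is_deriveM dn dv)).
rewrite w0 mul0r addr0 /GRing.scale /=.
rewrite [in RHS](eq_bigr (fun j => 2 / (eps + sqnorm w) * ((i == j)%:R * h 0 j)
   - 4 * w 0 i / (eps + sqnorm w) ^+ 2 * (w 0 j * h 0 j))); last first.
  by move=> j _; rewrite /log_sq_q; ring.
have K : \sum_j (i == j)%:R * h 0 j = h 0 i.
  by rewrite (bigD1 i)//= eqxx mul1r big1 ?addr0// => j ji; rewrite eq_sym (negbTE ji) mul0r.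
rewrite sumrB -!mulr_sumr K.
by have := gt_eqF (den_gt0 w) => /negbT z1; field.
Qed.

Let pr_le w (i j : 'I_d) : `|w 0 i * w 0 j| <= sqnorm w.
Proof.
rewrite normrM.
have H k : `|w 0 k| ^+ 2 <= sqnorm w.
  by rewrite real_normK ?num_real// /sqnorm (bigD1 k)//= lerDl sumr_ge0// => l _; rewrite sqr_ge0.
by have := H i; have := H j; have := sqr_ge0 (`|w 0 i| - `|w 0 j|); nra.
Qed.

Lemma log_sq_q_le w i j : `|log_sq_q i j w| <= 6 / eps.
Proof.
have e0 : 0 < eps := eps0; have z := den_gt0 w; have sz := sqnorm_ge0 w.
have -> : 6 / eps = 2 / eps + 4 / eps by ring.
rewrite /log_sq_q (le_trans (ler_normB _ _))// lerD//.
  rewrite normf_div (gtr0_norm z) ger0_norm; last by rewrite mulr_ge0.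
  rewrite ler_pdivrMr// mulrAC ler_pdivlMr//; case: (i == j); rewrite /= ?mulr1 ?mulr0 ?mul0r; nra.
rewrite -[4 * _ * _]mulrA normf_div (gtr0_norm (exprn_gt0 2 z)).
rewrite normrM (ger0_norm (_ : 0 <= 4))// ler_pdivrMr ?exprn_gt0// mulrAC ler_pdivlMr//.
by have := pr_le w i j; nra.
Qed.

Lemma log_sq_p_le w i : `|log_sq_p i w| <= 1 + 1 / eps.
Proof.
have e0 : 0 < eps := eps0; have z := den_gt0 w.
rewrite /log_sq_p normf_div (gtr0_norm z) ler_pdivrMr// normrM ger0_norm//.
have H : `|w 0 i| ^+ 2 <= sqnorm w.
  by rewrite real_normK ?num_real// /sqnorm (bigD1 i)//= lerDl sumr_ge0// => l _; rewrite sqr_ge0.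
have e1 : 1 <= 1 / eps * (eps + sqnorm w).
  by rewrite mulrAC mul1r ler_pdivlMr// mul1r lerDl sqnorm_ge0.
rewrite (mulrDl 1 (1 / eps)) mul1r; move: e1; set a := 1 / eps * _ => e1.
have e2 := sqr_ge0 (`|w 0 i| - 1).
by nra.
Qed.

Lemma continuous_sqnorm w : {for w, continuous sqnorm}.
Proof.
apply: continuous_at_sum => i.
by apply: (@continuous_at_mul _ _ _ (fun v : 'rV[R]_d => v 0 i) (fun v : 'rV[R]_d => v 0 i)); exact: continuous_coord.
Qed.

Let continuous_den w : {for w, continuous (fun v => (eps + sqnorm v)^-1)}.
Proof.
apply: continuous_at_inv; first by rewrite gt_eqF.
by apply: continuous_at_add; [exact: continuous_at_cst|exact: continuous_sqnorm].
Qed.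

Lemma continuous_log_sq w : {for w, continuous log_sq}.
Proof.
apply: continuous_at_ln => //.
by apply: continuous_at_add; [exact: continuous_at_cst|exact: continuous_sqnorm].
Qed.

Lemma continuous_log_sq_p i w : {for w, continuous (log_sq_p i)}.
Proof.
apply: continuous_at_mul; last exact: continuous_den.
by apply: continuous_at_mul; [exact: continuous_at_cst|exact: continuous_coord].
Qed.

Lemma continuous_log_sq_q i j w : {for w, continuous (log_sq_q i j)}.
Proof.
apply: continuous_at_sub.
  by apply: continuous_at_mul; [exact: continuous_at_cst|exact: continuous_den].
apply: continuous_at_mul.
  apply: continuous_at_mul; last exact: continuous_coord.
  by apply: continuous_at_mul; [exact: continuous_at_cst|exact: continuous_coord].
rewrite (_ : (fun v => _) = (fun v => (eps + sqnorm v)^-1 * (eps + sqnorm v)^-1)).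
  by apply: continuous_at_mul; exact: continuous_den.
by apply/funext => v; rewrite expr2 invfM.
Qed.

(** The i-th partial derivative is proportional to w_i, which is the Neumann condition on the face
    w_i = 0. With eps > 0 nothing is singular at the origin. The 12 is twice the bound 6 / eps on
    the Hessian, since the remainder involves a difference of two Hessians. *)
Lemma neumann_data_log_sq (delta : R) :
  exists C, neumann_data delta C log_sq log_sq_p log_sq_q.
Proof.
exists (12 / eps + 1 + `|ln eps| + eps).
have e1 : 0 <= 12 / eps by rewrite divr_ge0// ltW.
have e2 := normr_ge0 (ln eps).
have e0 : 0 < eps := eps0.
have ie0 : 0 < eps^-1 by rewrite invr_gt0.
split.
- by move=> x _ _; exact: continuous_log_sq.
- by move=> i x _ _; exact: continuous_log_sq_p.
- by move=> i j x _ _; exact: continuous_log_sq_q.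
- by move=> i x _ _ xi; rewrite /log_sq_p xi mulr0 mul0r.
- move=> x ox; have l1 := ln_sublinear (den_gt0 x); have sx := sqnorm_le_norm1 x.
  have l2 : - `|ln eps| <= log_sq x.
    apply: (@le_trans _ _ (ln eps)); first by rewrite lerNl -normrN ler_norm.
    by rewrite ler_ln ?posrE// lerDl sqnorm_ge0.
  have sx0 := sqnorm_ge0 x.
  apply: (@le_trans _ _ (`|ln eps| + eps + norm1 x ^+ 2)).
    rewrite ler_norml; apply/andP; split; last by rewrite /log_sq; lra.
    by lra.
  have n0 : 0 <= norm1 x ^+ 2 by rewrite exprn_ge0// norm1_ge0.
  have m1 := mulr_ge0 e1 n0; have m2 := mulr_ge0 e2 n0; have m3 := mulr_ge0 (ltW eps0) n0.
  move: e1 e2 n0 m1 m2 m3; set a := 12 / eps; set n := norm1 x ^+ 2 => *; rewrite !(mulrDl, mulrDr).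
  lra.
- move=> i x _ _; apply: (le_trans (log_sq_p_le x i)).
  by move: ie0 e2; move: (eps^-1) => *; lra.
- move=> i j x _ _; apply: (le_trans (log_sq_q_le x i j)).
  by move: ie0 e2; move: (eps^-1) => *; lra.
- move=> x y _ _ _; apply: (@le_trans _ _ (12 / eps * norm1_dist x y ^+ 2)).
    apply: taylor_rem_le => s _; first exact: has_derivatives_log_sq.
    move=> i j; rewrite (le_trans (ler_normB _ _))//.
    by have := log_sq_q_le (x + s *: (y - x)) i j; have := log_sq_q_le x i j; lra.
  by rewrite ler_wpM2r ?exprn_ge0 ?norm1_dist_ge0//; lra.
- move=> x _ _; apply: taylor_rem_local; last by move=> i j; exact: continuous_log_sq_q.
  by near=> w => _; exact: has_derivatives_log_sq.
Unshelve. all: by end_near. Qed.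

(** The trace is (2 d (eps + |w|^2) - 4 |w|^2) / (eps + |w|^2)^2; this is where the dimension
    enters. *)
Lemma log_sq_laplacian_ge0 w : (2 <= d)%N -> 0 <= \sum_i log_sq_q i i w.
Proof.
move=> d2; have e0 : 0 < eps := eps0; have z := den_gt0 w; have sz := sqnorm_ge0 w.
rewrite /log_sq_q sumrB.
under eq_bigr do rewrite eqxx mulr1.
rewrite sumr_const card_ord.
rewrite (eq_bigr (fun i => 4 / (eps + sqnorm w) ^+ 2 * w 0 i ^+ 2)); last first.
  by move=> i _; rewrite expr2; ring.
rewrite -mulr_sumr -/(sqnorm w) subr_ge0 mulrAC ler_pdivrMr ?exprn_gt0//.
rewrite -(mulr_natr (2 / _)) expr2.
have -> : 2 / (eps + sqnorm w) * d%:R * ((eps + sqnorm w) * (eps + sqnorm w)) = 2 * d%:R * (eps + sqnorm w).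
  by have := gt_eqF z => /negbT z1; field.
have D2 : 2 <= d%:R :> R by rewrite ler_nat.
nra.
Qed.

End LogSquareNorm.

(** * The test function in polar coordinates *)

Section PolarFunction.
Context {R : realType} {d : nat} (f : 'rV[R]_(1 + d) -> R) (fD : classD f).
Implicit Types (w h x y : 'rV[R]_d) (a b : 'I_(1 + d)) (i j : 'I_d).

Definition total w : R := \sum_i w 0 i.

(* On the orthant [total w] is [norm1 w]; unlike [norm1] it is smooth around
   the faces. *)
Definition polar w : 'rV[R]_(1 + d) := polar_point (ln (total w)) ((total w)^-1 *: w).

Definition polar_fun w : R := f (polar w).

(* [total w] times the partial derivatives of [polar]. *)
Definition polar_jac a i w : R :=
  match fintype.split a with
  | inl _ => 1
  | inr k => (k == i)%:R - (total w)^-1 * w 0 k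
  end.

(** Up to the factor -1 / total, the derivative of [polar_jac a i] in direction j: for a simplex
    coordinate [polar_jac a i] is a constant minus the coordinate a of [polar], and for the radial
    one it is constant. *)
Definition polar_jac_tail a j w : R :=
  match fintype.split a with inl _ => 0 | inr _ => polar_jac a j w end.

Definition polar_p i w : R := (total w)^-1 * \sum_a pderiv a f (polar w) * polar_jac a i w.

(** Product rule for [polar_p]: the three sums come from differentiating the gradient of f, the
    factor 1 / total, and the Jacobian. *)
Definition polar_q i j w : R := (total w)^-1 * (total w)^-1 *
  (\sum_a \sum_b pderiv b (pderiv a f) (polar w) * polar_jac b j w * polar_jac a i w -
   \sum_a pderiv a f (polar w) * polar_jac a i w -
   \sum_a pderiv a f (polar w) * polar_jac_tail a j w).

Lemma polarE w a : polar w 0 a =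
  match fintype.split a with inl _ => ln (total w) | inr k => (total w)^-1 * w 0 k end.
Proof. by rewrite mxE; case: fintype.split => k; rewrite !mxE// ord1 eqxx mulr1n. Qed.

Lemma total_line w h (s : R) : total (w + s *: h) = total w + s * total h.
Proof.
by rewrite /total mulr_sumr -big_split/=; apply: eq_bigr => i _; rewrite !mxE.
Qed.

Lemma total_orthant w : orthant w -> total w = norm1 w.
Proof. by move=> ow; rewrite norm1_orthant. Qed.

Lemma total_gt0 w : orthant w -> w != 0 -> 0 < total w.
Proof. by move=> ow w0; rewrite total_orthant// norm1_gt0. Qed.

Lemma polar_RxS w : orthant w -> w != 0 -> RxS (polar w).
Proof.
move=> ow w0; have t0 := total_gt0 ow w0.
have o : orthant ((total w)^-1 *: w).
  by move=> i; rewrite mxE mulr_ge0 ?invr_ge0 ?(ltW t0)//; exact: ow.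
rewrite /RxS /= /polar /polar_point row_mxKr; split => //.
rewrite norm1_orthant//; under eq_bigr do rewrite mxE.
by rewrite -mulr_sumr mulVf// gt_eqF.
Qed.

Lemma is_derive_polar w h a : 0 < total w ->
  is_derive (0 : R) 1 (fun s : R => polar (w + s *: h) 0 a)
    ((total w)^-1 * \sum_j polar_jac a j w * h 0 j).
Proof.
move=> t0; have t0' : total w != 0 by rewrite gt_eqF.
have dt : is_derive (0 : R) 1 (fun s : R => total w + s * total h) (total h) by exact: is_derive_affine.
have e0 : total w + 0 * total h = total w by rewrite mul0r addr0.
under eq_fun do rewrite polarE total_line.
rewrite /polar_jac; case: fintype.split => k.
  have dl : is_derive (total w + 0 * total h) 1 (@ln R) (total w + 0 * total h)^-1.
    by apply: is_derive1_ln; rewrite e0.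
  apply: (is_derive_eq (@is_derive1_comp _ (@ln R) (fun s : R => total w + s * total h) 0 _ _ dl dt)).
  by rewrite e0; congr (_ * _); apply: eq_bigr => j _; rewrite mul1r.
have dn := is_derive_affine (w 0 k) (h 0 k).
have e1 : total w + 0 * total h != 0 by rewrite e0.
have dv := @is_deriveV _ (fun s : R => total w + s * total h) _ _ _ e1 dt.
have -> : (fun s : R => (total w + s * total h)^-1 * (w + s *: h) 0 k) =
   (fun s : R => (total w + s * total h)^-1 : R) * (fun s : R => w 0 k + s * h 0 k : R).
  by apply/funext => s; rewrite !mxE.
apply: (is_derive_eq (is_deriveM dv dn)).
rewrite e0 mul0r addr0 /GRing.scale /=.
under eq_bigr do rewrite mulrBl.
rewrite sumrB -mulr_sumr -/(total h) (bigD1 k)//= eqxx mul1r big1 ?addr0; last first.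
  by move=> j jk; rewrite eq_sym (negbTE jk) mul0r.
by field.
Qed.

Lemma is_derive_polar_jac w h a i : 0 < total w ->
  is_derive (0 : R) 1 (fun s : R => polar_jac a i (w + s *: h))
    (- ((total w)^-1 * \sum_j polar_jac_tail a j w * h 0 j)).
Proof.
move=> t0; have := is_derive_polar h a t0.
rewrite /polar_jac_tail /polar_jac; under eq_fun do rewrite polarE.
case: fintype.split => k dp.
  rewrite [X in is_derive _ _ _ X](_ : _ = 0); first exact: is_derive_cst.
  by rewrite big1 ?mulr0 ?oppr0// => j _; rewrite mul0r.
have dc : is_derive (0 : R) 1 (fun s : R => (k == i)%:R : R) 0 by exact: is_derive_cst.
by apply: (is_derive_eq (is_deriveB dc dp)); rewrite sub0r.
Qed.

Let C2f := fD.1.1.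

Let near_polar w : orthant w -> w != 0 -> forall h,
  \forall y \near polar (w + (0 : R) *: h),
    [/\ {for y, continuous f},
        forall a, derivable f y 'e_a /\ {for y, continuous (pderiv a f)} &
        forall a b, derivable (pderiv b f) y 'e_a /\
                    {for y, continuous (pderiv a (pderiv b f))}].
Proof.
move=> ow w0 h; rewrite scale0r addr0; have [U [oU RU CU]] := C2f.
have : nbhs (polar w) U by apply: open_nbhs_nbhs; split => //; apply: RU; exact: polar_RxS.
by apply: filterS => y; exact: CU.
Qed.

Let is_derive_f w h : orthant w -> w != 0 ->
  is_derive (0 : R) 1 (fun s : R => polar_fun (w + s *: h)) (\sum_a pderiv a f (polar w) *
    ((total w)^-1 * \sum_j polar_jac a j w * h 0 j)).
Proof.
move=> ow w0; have N := near_polar ow w0 h.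
have := @is_derive_chain R _ f (fun s => polar (w + s *: h))
  (fun a => (total w)^-1 * \sum_j polar_jac a j w * h 0 j) 0.
rewrite {3}scale0r addr0; apply.
- by apply: filterS N => y [_ H _] i; exact: (H i).1.
- move=> i; by have [_ H _] := nbhs_singleton N; exact: (H i).2.
- by move=> a; apply: is_derive_polar; exact: total_gt0.
Qed.

Let is_derive_df w h a : orthant w -> w != 0 ->
  is_derive (0 : R) 1 (fun s : R => pderiv a f (polar (w + s *: h)))
   (\sum_b pderiv b (pderiv a f) (polar w) * ((total w)^-1 * \sum_j polar_jac b j w * h 0 j)).
Proof.
move=> ow w0; have N := near_polar ow w0 h.
have := @is_derive_chain R _ (pderiv a f) (fun s => polar (w + s *: h))
  (fun b => (total w)^-1 * \sum_j polar_jac b j w * h 0 j) 0.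
rewrite {3}scale0r addr0; apply.
- by apply: filterS N => y [_ _ H] i; exact: (H i a).1.
- move=> i; by have [_ _ H] := nbhs_singleton N; exact: (H i a).2.
- by move=> b; apply: is_derive_polar; exact: total_gt0.
Qed.

Lemma has_derivatives_polar w : orthant w -> w != 0 ->
  has_derivatives polar_fun polar_p polar_q w.
Proof.
move=> ow w0 h; have t0 := total_gt0 ow w0; split.
  apply: (is_derive_eq (is_derive_f h ow w0)).
  under eq_bigr do rewrite mulrCA mulr_sumr.
  rewrite -mulr_sumr exchange_big mulr_sumr; apply: eq_bigr => i _ /=.
  rewrite /polar_p -mulrA; congr (_ * _); rewrite mulr_suml; apply: eq_bigr => a _.
  by rewrite mulrA.
move=> i.
have e0 : total w + 0 * total h = total w by rewrite mul0r addr0.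
have dt : is_derive (0 : R) 1 (fun s : R => total w + s * total h) (total h) by exact: is_derive_affine.
have e1 : total w + 0 * total h != 0 by rewrite e0 gt_eqF.
have dv := @is_deriveV _ (fun s : R => total w + s * total h) _ _ _ e1 dt.
pose S := fun (a : 'I_(1 + d)) (s : R) => pderiv a f (polar (w + s *: h)) * polar_jac a i (w + s *: h) : R.
have dS a : is_derive (0 : R) 1 (S a : R -> R) (pderiv a f (polar w) * (- ((total w)^-1 * \sum_j polar_jac_tail a j w * h 0 j)) +
    polar_jac a i w * \sum_b pderiv b (pderiv a f) (polar w) * ((total w)^-1 * \sum_j polar_jac b j w * h 0 j)).
  apply: (is_derive_eq (is_deriveM (is_derive_df h a ow w0) (is_derive_polar_jac h a i t0))).
  by rewrite scale0r addr0.
have dSum := is_derive_sum dS.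
have -> : (fun s : R => polar_p i (w + s *: h)) =
   (fun s : R => (total w + s * total h)^-1 : R) * (\sum_a (S a : R -> R)).
  by apply/funext => s; rewrite /polar_p total_line [RHS]/(_ * _) fct_sumE.
apply: (is_derive_eq (is_deriveM dv dSum)).
rewrite e0 fct_sumE /S scale0r addr0 /GRing.scale /= /polar_q.
under [in RHS]eq_bigr do rewrite -!mulrA mulrBl mulrBl.
rewrite -!mulr_sumr !sumrB big_split/=.
have E1 : \sum_j (\sum_a \sum_b pderiv b (pderiv a f) (polar w) * polar_jac b j w * polar_jac a i w) * h 0 j =
   total w * \sum_a polar_jac a i w * \sum_b pderiv b (pderiv a f) (polar w) * ((total w)^-1 * \sum_j polar_jac b j w * h 0 j).
  under eq_bigr do rewrite mulr_suml.
  rewrite exchange_big mulr_sumr; apply: eq_bigr => a _ /=.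
  under eq_bigr do rewrite mulr_suml.
  rewrite exchange_big mulrCA mulr_sumr mulr_sumr; apply: eq_bigr => b _ /=.
  rewrite [X in _ = _ * X]mulrCA [X in _ = _ * (_ * X)]mulrA mulfV ?gt_eqF// mul1r.
  rewrite mulrA mulr_sumr; apply: eq_bigr => j _; ring.
have E2 : \sum_j (\sum_a pderiv a f (polar w) * polar_jac a i w) * h 0 j =
   (\sum_a pderiv a f (polar w) * polar_jac a i w) * total h by rewrite mulr_sumr.
have E3 : \sum_j (\sum_a pderiv a f (polar w) * polar_jac_tail a j w) * h 0 j =
   - (total w * \sum_a pderiv a f (polar w) * - ((total w)^-1 * \sum_j polar_jac_tail a j w * h 0 j)).
  under eq_bigr do rewrite mulr_suml.
  rewrite exchange_big mulr_sumr -sumrN; apply: eq_bigr => a _ /=.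
  rewrite !mulrN opprK mulrCA (mulrA (total w)) mulfV ?gt_eqF// mul1r mulr_sumr.
  by apply: eq_bigr => j _; rewrite mulrA.
rewrite E1 E2 E3; move: (\sum_a _) (\sum_a _) (\sum_a _) (total h) (gt_eqF t0) => u v z l /negbT t1.
by field.
Qed.

(** Collects the two first-order sums of [polar_q] in the Laplacian. The factor -2 cancels their
    minus sign and the 1/2 in front of the Laplacian. *)
Lemma sum_polar_jac a w : orthant w -> w != 0 ->
  \sum_i (polar_jac a i w + polar_jac_tail a i w) = - 2 * drift ((total w)^-1 *: w) a.
Proof.
move=> ow w0; rewrite big_split /polar_jac_tail /polar_jac /drift.
case: fintype.split => k /=; first by rewrite sumr_const card_ord big1// addr0 -mulr_natl; field.
rewrite !sumrB sumr_const card_ord (bigD1 k)//= eqxx big1 ?addr0; last first.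
  by move=> j jk; rewrite eq_sym (negbTE jk).
by rewrite !mxE -mulr_natl (_ : true%:R = 1 :> R)//; ring.
Qed.

(** For standard Brownian motion the diffusion matrix in new coordinates is the Jacobian times its
    transpose. *)
Lemma sum_polar_jac_mul a b w : orthant w -> w != 0 ->
  \sum_i polar_jac b i w * polar_jac a i w = diffusion ((total w)^-1 *: w) b a.
Proof.
move=> ow w0; have t0 := total_gt0 ow w0; rewrite /polar_jac /diffusion.
have one k : \sum_i ((k == i)%:R - (total w)^-1 * w 0 k) = 1 - d%:R * ((total w)^-1 * w 0 k).
  rewrite sumrB sumr_const card_ord (bigD1 k)//= eqxx big1 ?addr0 ?mulr_natl//.
  by move=> j jk; rewrite eq_sym (negbTE jk).
case: (fintype.split b) => k; case: (fintype.split a) => l.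
- by under eq_bigr do rewrite mul1r; rewrite sumr_const card_ord.
- by under eq_bigr do rewrite mul1r; rewrite one mxE.
- by under eq_bigr do rewrite mulr1; rewrite one mxE.
under eq_bigr do rewrite mulrBl.
rewrite sumrB -mulr_sumr one (bigD1 k)//= eqxx mul1r big1 ?addr0; last first.
  by move=> j jk; rewrite eq_sym (negbTE jk) mul0r.
rewrite !mxE eq_sym; case: eqVneq => [->|_] /=; ring.
Qed.

Lemma polar_laplacian w : orthant w -> w != 0 ->
  \sum_i polar_q i i w = 2 * ((total w)^-1 * (total w)^-1) * generator f (polar w).
Proof.
move=> ow w0; rewrite /polar_q -mulr_sumr -[RHS]mulrA [RHS]mulrCA; congr (_ * _).
have rsub : rsubmx (polar w) = (total w)^-1 *: w by exact: row_mxKr.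
rewrite /generator rsub.
rewrite !sumrB.
have -> : \sum_i \sum_a \sum_b pderiv b (pderiv a f) (polar w) * polar_jac b i w * polar_jac a i w =
   \sum_b \sum_a diffusion ((total w)^-1 *: w) b a * pderiv b (pderiv a f) (polar w).
  rewrite exchange_big [RHS]exchange_big; apply: eq_bigr => a _ /=.
  rewrite exchange_big; apply: eq_bigr => b _ /=.
  rewrite -sum_polar_jac_mul// mulr_suml; apply: eq_bigr => i _; ring.
have E : \sum_i \sum_a pderiv a f (polar w) * polar_jac a i w +
   \sum_i \sum_a pderiv a f (polar w) * polar_jac_tail a i w =
   - 2 * \sum_a drift ((total w)^-1 *: w) a * pderiv a f (polar w).
  rewrite -big_split/= mulr_sumr.
  under eq_bigr do rewrite -big_split/=.
  rewrite exchange_big; apply: eq_bigr => a _ /=.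
  by rewrite mulrA -sum_polar_jac// mulr_suml; apply: eq_bigr => i _; ring.
by rewrite -addrA -opprD E; field.
Qed.

(** The vector in the definition of [classD] is the i-th column of [polar_jac]: the term missing
    from its sum is the one with coefficient w_i = 0. *)
Lemma polar_p_face i w : orthant w -> w != 0 -> w 0 i = 0 -> polar_p i w = 0.
Proof.
move=> ow w0 wi; have := fD.2 i w ow w0 wi.
rewrite /polar_p /polar total_orthant// /argv => H.
suff -> : \sum_a pderiv a f (polar_point (ln (norm1 w)) ((norm1 w)^-1 *: w)) * polar_jac a i w = 0.
  by rewrite mulr0.
rewrite -[RHS]H /dot; apply: eq_bigr => a _.
rewrite [grad _ _ _ _]mxE mulrC; congr (_ * _).
rewrite !mxE summxE /polar_jac.
case: (split_ordP a) => k ->.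
  rewrite (ord1 k) eqxx eq_lrshift /= addr0 big1 ?mulr0 ?subr0// => j _.
  by rewrite !mxE eq_lrshift mulr0.
rewrite eq_rlshift eq_rshift /= add0r total_orthant//; congr (_ - _ * _).
have [->|ki] := eqVneq k i.
  rewrite wi big1// => j ji; rewrite !mxE eq_rshift /= [_ == j]eq_sym (negbTE ji) mulr0//.
rewrite (bigD1 k)//= !mxE !eqxx /= mulr1 big1 ?addr0// => j /andP[_ jk].
by rewrite !mxE eq_rshift /= eq_sym (negbTE jk) mulr0.
Qed.

Lemma continuous_polar w : 0 < total w -> {for w, continuous polar}.
Proof.
move=> t0; have ct : {for w, continuous total}.
  by apply: continuous_at_sum => i; exact: continuous_coord.
apply: continuous_at_rows => a.
rewrite (_ : (fun u => _) = (fun u => match fintype.split a with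
   inl _ => ln (total u) | inr k => (total u)^-1 * u 0 k end)); last first.
  by apply/funext => u; rewrite polarE.
case: fintype.split => k; first exact: continuous_at_ln.
apply: continuous_at_mul; last exact: continuous_coord.
by apply: continuous_at_inv => //; rewrite gt_eqF.
Qed.

Let continuous_comp_polar (g : 'rV[R]_(1 + d) -> R) w : orthant w -> w != 0 ->
  {for polar w, continuous g} -> {for w, continuous (fun u => g (polar u))}.
Proof.
move=> ow w0 cg; apply: (@continuous_comp _ _ _ polar g) => //.
by apply: continuous_polar; exact: total_gt0.
Qed.

Let C2_polar w : orthant w -> w != 0 ->
  [/\ {for polar w, continuous f},
      forall a, {for polar w, continuous (pderiv a f)} &
      forall a b, {for polar w, continuous (pderiv b (pderiv a f))}].
Proof.
move=> ow w0; have := nbhs_singleton (near_polar ow w0 0); rewrite scaler0 addr0 => -[h1 h2 h3].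
by split => // [a|a b]; [exact: (h2 a).2|exact: (h3 b a).2].
Qed.

Lemma continuous_total w : {for w, continuous total}.
Proof. by apply: continuous_at_sum => i; exact: continuous_coord. Qed.

Lemma continuous_polar_jac a i w : orthant w -> w != 0 ->
  {for w, continuous (polar_jac a i)} /\ {for w, continuous (polar_jac_tail a i)}.
Proof.
move=> ow w0; have t0 := total_gt0 ow w0.
have H k : {for w, continuous (fun u => (k == i)%:R - (total u)^-1 * u 0 k)}.
  apply: continuous_at_sub; first exact: continuous_at_cst.
  apply: continuous_at_mul; last exact: continuous_coord.
  by apply: continuous_at_inv; [rewrite gt_eqF|exact: continuous_total].
rewrite /polar_jac_tail /polar_jac; case: fintype.split => k.
  by split; exact: continuous_at_cst.
by split; exact: H.
Qed.

Lemma neumann_data_polar (delta : R) : 0 < delta ->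
  exists C, neumann_data delta C polar_fun polar_p polar_q.
Proof.
move=> d0; have [_ [K HK]] := fD.1.
pose K1 := Num.max K 0.
have K10 : 0 <= K1 by rewrite le_max lexx orbT.
have B w : orthant w -> w != 0 -> [/\ `|f (polar w)| <= K1,
   forall a, `|pderiv a f (polar w)| <= K1 & forall a b, `|pderiv b (pderiv a f) (polar w)| <= K1].
  move=> ow w0; have [h1 h2 h3] := HK _ (polar_RxS ow w0).
  have KK : K <= K1 by rewrite le_max lexx.
  split; first exact: le_trans h1 KK.
    by move=> a; exact: le_trans (h2 a) KK.
  by move=> a b; exact: le_trans (h3 b a) KK.
have jac_le a i w : orthant w -> w != 0 -> `|polar_jac a i w| <= 1 /\ `|polar_jac_tail a i w| <= 1.
  move=> ow w0; have t0 := total_gt0 ow w0; rewrite /polar_jac_tail /polar_jac.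
  case: fintype.split => k; first by rewrite normr1 normr0.
  suff : `|(k == i)%:R - (total w)^-1 * w 0 k| <= 1 by [].
  have th0 : 0 <= (total w)^-1 * w 0 k by rewrite mulr_ge0 ?invr_ge0 ?(ltW t0)//; exact: ow.
  have th1 : (total w)^-1 * w 0 k <= 1.
    rewrite mulrC ler_pdivrMr// mul1r /total (bigD1 k)//= lerDl sumr_ge0// => j _; exact: ow.
  by rewrite ler_norml; case: (k == i) => /=; apply/andP; split; lra.
have w_neq0 w (c : R) : 0 < c -> c <= norm1 w -> w != 0.
  by move=> c0 cw; rewrite -norm1_gt0P (lt_le_trans c0).
have inv_le w (c : R) : 0 < c -> orthant w -> c <= norm1 w -> 0 <= (total w)^-1 <= c^-1.
  move=> c0 ow cw; rewrite total_orthant// invr_ge0 norm1_ge0/= lef_pV2 ?posrE//.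
  exact: lt_le_trans cw.
pose n := (1 + d)%:R : R.
have n0 : 0 <= n by rewrite ler0n.
have sum_le (F : 'I_(1 + d) -> R) (c : R) : (forall a, `|F a| <= c) -> `|\sum_a F a| <= n * c.
  move=> Fc; rewrite (le_trans (ler_norm_sum _ _ _))// (le_trans (ler_sum _ (fun a _ => Fc a)))//.
  by rewrite sumr_const card_ord /n mulr_natl.
have bp (c : R) w i : 0 < c -> orthant w -> c <= norm1 w -> `|polar_p i w| <= c^-1 * (n * K1).
  move=> c0 ow cw; have w0 := w_neq0 _ _ c0 cw; have /andP[i0 i1] := inv_le _ _ c0 ow cw.
  rewrite /polar_p normrM (ger0_norm i0) ler_pM//; apply: (sum_le) => a.
  have [_ b2 _] := B w ow w0; have [j1 _] := jac_le a i w ow w0.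
  by rewrite normrM -[leRHS]mulr1 ler_pM.
have bq (c : R) w i j : 0 < c -> orthant w -> c <= norm1 w ->
    `|polar_q i j w| <= c^-1 * c^-1 * (n * (n * K1) + n * K1 + n * K1).
  move=> c0 ow cw; have w0 := w_neq0 _ _ c0 cw; have /andP[i0 i1] := inv_le _ _ c0 ow cw.
  have [_ b2 b3] := B w ow w0.
  rewrite /polar_q normrM ger0_norm ?mulr_ge0// ler_pM ?mulr_ge0//; first by rewrite ler_pM.
  rewrite (le_trans (ler_normB _ _))// lerD ?(le_trans (ler_normB _ _)) ?lerD//; apply: (sum_le) => a.
  - apply: sum_le => b; rewrite !normrM -[leRHS]mulr1 ler_pM ?mulr_ge0//; last exact: (jac_le a i w ow w0).1.
    by rewrite -[leRHS]mulr1 ler_pM//; exact: (jac_le b j w ow w0).1.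
  - by rewrite normrM -[leRHS]mulr1 ler_pM//; exact: (jac_le a i w ow w0).1.
  - by rewrite normrM -[leRHS]mulr1 ler_pM//; exact: (jac_le a j w ow w0).2.
(* At the origin [polar] lands outside R x S, where f is not bounded by K; this single value is
   added to the bound. *)
have bG w : orthant w -> `|polar_fun w| <= K1 + `|polar_fun 0|.
  move=> ow; have [->|w0] := eqVneq w 0; first by rewrite lerDr.
  by rewrite (le_trans (_ : _ <= K1)) ?lerDl//; have [] := B w ow w0.
(* Segments leaving a point of norm at least [delta] are used down to norm [delta / 2], so all
   derivative bounds are taken at that level. *)
pose c := delta / 2; have c0 : 0 < c by rewrite divr_gt0.
pose M1 := c^-1 * (n * K1); pose M2 := c^-1 * c^-1 * (n * (n * K1) + n * K1 + n * K1).
pose M3 := 2 * (K1 + `|polar_fun 0|).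
have M10 : 0 <= M1 by rewrite !mulr_ge0 ?invr_ge0 ?(ltW c0).
have M20 : 0 <= M2 by rewrite !(mulr_ge0, addr_ge0) ?invr_ge0 ?(ltW c0).
have M30 : 0 <= M3 by rewrite mulr_ge0 ?addr_ge0.
pose M := M1 + M2 + M3.
have M0 : 0 <= M by rewrite !addr_ge0.
pose C := 4 * M / delta ^+ 2 + 4 * M + 2 * M / delta.
have MC : M <= C.
  have c1 : 0 <= 4 * M / delta ^+ 2 by apply: divr_ge0; [exact: mulr_ge0|exact: sqr_ge0].
  have c2 : 0 <= 2 * M / delta by apply: divr_ge0; [exact: mulr_ge0|exact: ltW].
  by rewrite /C; lra.
have d2 x : delta <= norm1 x -> c <= norm1 x.
  by move=> dx; apply: le_trans dx; rewrite /c; lra.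
have contq i j x : orthant x -> x != 0 -> {for x, continuous (polar_q i j)}.
  move=> ox x0.
  have ci : {for x, continuous (fun u => (total u)^-1)}.
    by apply: continuous_at_inv; [rewrite gt_eqF// total_gt0|exact: continuous_total].
  have [_ h2 h3] := C2_polar ox x0.
  have g1 a : {for x, continuous (fun u => pderiv a f (polar u))} by exact: continuous_comp_polar.
  have g2 a b : {for x, continuous (fun u => pderiv b (pderiv a f) (polar u))} by exact: continuous_comp_polar.
  have g3 a k := (continuous_polar_jac a k ox x0).1; have g4 a k := (continuous_polar_jac a k ox x0).2.
  apply: continuous_at_mul; first exact: continuous_at_mul.
  apply: continuous_at_sub; first apply: continuous_at_sub.
  - apply: continuous_at_sum => a; apply: continuous_at_sum => b.
    by apply: continuous_at_mul => //; exact: continuous_at_mul.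
  - by apply: continuous_at_sum => a; exact: continuous_at_mul.
  - by apply: continuous_at_sum => a; exact: continuous_at_mul.
exists C; split.
- by move=> x ox x0; apply: continuous_comp_polar => //; have [] := C2_polar ox x0.
- move=> i x ox x0; apply: continuous_at_mul.
    apply: continuous_at_inv; last exact: continuous_total.
    by rewrite gt_eqF// total_gt0.
  apply: continuous_at_sum => a; apply: continuous_at_mul; last exact: (continuous_polar_jac a i ox x0).1.
  by apply: continuous_comp_polar => //; have [_ h _] := C2_polar ox x0; exact: h.
- by move=> i j x ox x0; exact: contq.
- by move=> i x ox x0 xi; exact: polar_p_face.
- move=> x ox; rewrite (le_trans (bG x ox))// (@le_trans _ _ (C * 1))//.
    by rewrite mulr1 (le_trans _ MC)// /M /M3; have := normr_ge0 (polar_fun 0); lra.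
  by rewrite ler_wpM2l ?(le_trans M0 MC)// lerDl exprn_ge0 ?norm1_ge0.
- move=> i x ox dx; rewrite (le_trans (bp c x i c0 ox (d2 x dx)))// (le_trans _ MC)// /M -/M1.
  by lra.
- move=> i j x ox dx; rewrite (le_trans (bq c x i j c0 ox (d2 x dx)))// (le_trans _ MC)// /M -/M2.
  by lra.
- move=> x y ox oy dx; apply: taylor_rem_global => //.
  + by move=> w ow cw; apply: has_derivatives_polar => //; exact: (w_neq0 _ _ c0 cw).
  + by move=> w ow cw i; rewrite (le_trans (bp c w i c0 ow cw))// /M -/M1; lra.
  + by move=> w ow cw i j; rewrite (le_trans (bq c w i j c0 ow cw))// /M -/M2; lra.
  + rewrite (le_trans (ler_normB _ _))// (@le_trans _ _ (M * 1))//.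
      by rewrite mulr1 /M /M3; have := bG x ox; have := bG y oy; lra.
    by rewrite ler_wpM2l// lerDl exprn_ge0 ?norm1_dist_ge0.
- move=> x ox x0; apply: taylor_rem_local.
    have ct : total u @[u --> x] --> total x := @continuous_total x.
    have t0 := total_gt0 ox x0.
    near=> w => ow; apply: has_derivatives_polar => //.
    have : 0 < total w by near: w; exact: cvgr_gt ct _ t0.
    by apply: contraTneq => ->; rewrite /total big1 ?ltxx// => i _; rewrite mxE.
  by move=> i j; exact: contq.
Unshelve. all: by end_near. Qed.

End PolarFunction.
(** Cauchy-Schwarz, read off from the nonnegative double sum of (x_i - x_j)^2. *)
Lemma sqr_sum_le (R : realDomainType) (I : finType) (x : I -> R) :
  (\sum_i x i) ^+ 2 <= #|I|%:R * \sum_i x i ^+ 2.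
Proof.
have h : 0 <= \sum_i \sum_j (x i - x j) ^+ 2.
  by apply: sumr_ge0 => i _; apply: sumr_ge0 => j _; exact: sqr_ge0.
have E : \sum_i \sum_j (x i - x j) ^+ 2 = 2 * (#|I|%:R * \sum_i x i ^+ 2) - 2 * (\sum_i x i) ^+ 2.
  have Ei i : \sum_j (x i - x j) ^+ 2 = #|I|%:R * x i ^+ 2 + \sum_j x j ^+ 2 - 2 * (x i * \sum_j x j).
    have -> : #|I|%:R * x i ^+ 2 = \sum_(j : I) x i ^+ 2 by rewrite sumr_const mulr_natl.
    rewrite mulr_sumr mulr_sumr -big_split/= -sumrB; apply: eq_bigr => j _; ring.
  under eq_bigr do rewrite Ei.
  rewrite sumrB big_split/= -!mulr_sumr -mulr_suml sumr_const -[_ *+ #|_|]mulr_natl cardT -cardE; ring.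
by move: h; rewrite E; lra.
Qed.

(** * Grid expansions along a reflected path *)

Section PathError.
Context {R : realType} {d : nat}.
Variables (delta C : R) (G : 'rV[R]_d -> R) (p : 'I_d -> 'rV[R]_d -> R)
  (q : 'I_d -> 'I_d -> 'rV[R]_d -> R).
Hypotheses (delta0 : 0 < delta) (nd : neumann_data delta C G p q).
Variable b : 'I_d -> R -> R.
Hypotheses (cb : forall i, continuous (b i)).

Definition reflected_path t : 'rV[R]_d := \row_i reflected (b i) t.

Local Notation X := reflected_path.

Lemma orthant_path t : 0 <= t -> orthant (X t).
Proof. by move=> t0 i; rewrite mxE reflected_ge0. Qed.

Lemma continuous_path t : {for t, continuous X}.
Proof.
apply: continuous_at_rows => i; rewrite (_ : (fun u => _) = reflected (b i)); first exact: continuous_reflected.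
by apply/funext => u; rewrite mxE.
Qed.

Lemma continuous_norm1_path t : {for t, continuous (fun u => norm1 (X u))}.
Proof.
apply: continuous_at_sum => i.
rewrite (_ : (fun u => _) = (fun u => `|reflected (b i) u|)); last by apply/funext => u; rewrite mxE.
apply: (@continuous_comp _ _ _ (reflected (b i)) Num.norm); first exact: continuous_reflected.
exact: norm_continuous.
Qed.

Lemma path_box t (r : R) : 0 < r -> exists2 e, 0 < e & forall u, `|u - t| < e -> box (X t) r (X u).
Proof.
move=> r0; have : nbhs (X t) (box (X t) r) by apply/nbhs_box; exists r.
by move=> /continuous_path [e /= e0 eP]; exists e => // u ut; apply: eP; rewrite /= distrC.
Qed.

(** Compactness of [0, N]: a property of pairs that holds around each diagonal point (v, v) holds
    for all pairs closer than a uniform distance. *)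
Lemma lebesgue_number (N : R) (Pr : R -> R -> Prop) :
  (forall v, 0 <= v <= N -> exists2 r, 0 < r & forall u t, 0 <= u <= N -> 0 <= t <= N ->
     `|u - v| < r -> `|t - v| < r -> Pr u t) ->
  exists2 e, 0 < e & forall u t, 0 <= u <= N -> 0 <= t <= N -> `|u - t| < e -> Pr u t.
Proof.
move=> H.
have /compact_near_coveringP := @segment_compact R 0 N.
move=> /(_ R (0^'+) (fun e u => forall t, 0 <= u <= N -> 0 <= t <= N -> `|u - t| < e -> Pr u t) _).
case.
  move=> v; rewrite /= in_itv/= => vN; have [r r0 rP] := H v vN.
  have r2 : 0 < r / 2 by rewrite divr_gt0.
  exists ([set u | `|v - u| < r / 2], [set e | e < r / 2]) => /=.
    split; first by exists (r / 2).
    by exists (r / 2) => //= e; rewrite /= sub0r normrN => er e0; rewrite (le_lt_trans (ler_norm _)).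
  move=> [u e] /= [uv er] t uN tN ut; apply: rP => //; first by rewrite distrC; lra.
  rewrite -(subrKA u) (le_lt_trans (ler_normD _ _))// distrC; rewrite distrC in uv; lra.
move=> e /= e0 eP.
have e2 : 0 < e / 2 by rewrite divr_gt0.
exists (e / 2) => // u t uN tN ut; apply: (eP (e / 2) _ _ u) => //=.
  by rewrite sub0r normrN gtr0_norm// ltr_pdivrMr// ltr_pMr// ltr1n.
Qed.

Lemma mesh_eventually N (e : R) : 0 < e -> exists n0 : nat, forall n, (n0 <= n)%N -> `|N / n.+1%:R| < e.
Proof.
move=> e0; have := cvg_mesh N => /cvgrPdist_lt/(_ _ e0) [n0 _ H]; exists n0 => n nn.
by have := H n nn; rewrite sub0r normrN.
Qed.

(** The last clause is where the Neumann condition acts. If the i-th pushing term increases on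
    [u, t], the path meets the face x_i = 0 at some c in between; p_i vanishes there, so p_i at X_u
    is small by continuity. *)
Lemma path_modulus (N e : R) : 0 < e -> exists2 eta, 0 < eta & forall u t, 0 <= u -> u <= t -> t <= N ->
  t - u < eta ->
  [/\ forall i, `|b i t - b i u| <= e, forall i, pushing (b i) t - pushing (b i) u <= e,
   delta <= norm1 (X u) -> `|taylor_rem G p q (X u) (X t)| <= e * norm1_dist (X u) (X t) ^+ 2 &
   delta <= norm1 (X u) -> forall i, pushing (b i) u < pushing (b i) t -> `|p i (X u)| <= e].
Proof.
move=> e0.
pose Pr u t := [/\ forall i, `|b i t - b i u| <= e, forall i, `|pushing (b i) t - pushing (b i) u| <= e,
   delta <= norm1 (X u) -> `|taylor_rem G p q (X u) (X t)| <= e * norm1_dist (X u) (X t) ^+ 2 &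
   delta <= norm1 (X u) -> forall i, X t 0 i = 0 -> `|p i (X u)| <= e].
have e2 : 0 < e / 2 by rewrite divr_gt0.
have uniform_at (g : R -> R) v : {for v, continuous g} -> exists2 r, 0 < r & forall u t,
    `|u - v| < r -> `|t - v| < r -> `|g t - g u| <= e.
  move=> /cvgrPdist_le/(_ _ e2) [r /= r0 rP]; exists r => // u t uv tv.
  rewrite -(subrKA (g v)) [leRHS]splitr (le_trans (ler_normD _ _))// lerD//.
    by rewrite distrC; apply: rP; rewrite /= distrC.
  by apply: rP; rewrite /= distrC.
have common (I : finType) (Q : I -> R -> Prop) : (forall i, exists2 r, 0 < r & Q i r) ->
    (forall i r r', r' <= r -> Q i r -> Q i r') -> exists2 r : R, 0 < r & forall i, Q i r.
  move=> h mono; have h' i : {r : R | 0 < r & Q i r} by apply: cid2.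
  exists (\big[Num.min/1]_i sval (h' i)).
    by apply/bigmin_gtP; split => // i _; have [] := svalP (h' i).
  move=> i; apply: (mono i (sval (h' i))); first exact: bigmin_le_cond.
  by have [] := svalP (h' i).
have [|eta eta0 H] := @lebesgue_number N Pr; last first.
  exists eta => // u t u0 ut tN utE.
  have uN : 0 <= u <= N by rewrite u0 (le_trans ut).
  have tN' : 0 <= t <= N by rewrite (le_trans u0 ut).
  have utE' : `|u - t| < eta by rewrite distrC ger0_norm// subr_ge0.
  have [h1 h2 h3 _] := H u t uN tN' utE'.
  split => //; first by move=> i; apply: le_trans (h2 i); exact: ler_norm.
  move=> du i pi; have [|_ /(_ pi)[c [/andP[uc ct] c0 _]]] := @pushing_incr _ (b i) u t _ (@cb i).
    by rewrite u0.
  have cN : 0 <= c <= N by rewrite (le_trans u0 uc) (le_trans ct).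
  have uc' : `|u - c| < eta by rewrite distrC ger0_norm ?subr_ge0//; lra.
  by have [_ _ _ h4] := H u c uN cN uc'; apply: h4; rewrite ?mxE.
move=> v /andP[v0 vN].
have [r1 r10 H1] : exists2 r, 0 < r & forall i u t, `|u - v| < r -> `|t - v| < r -> `|b i t - b i u| <= e.
  have [||r r0 rP] := @common 'I_d (fun i r => forall u t, `|u - v| < r -> `|t - v| < r -> `|b i t - b i u| <= e).
  - by move=> i; apply: uniform_at; exact: cb.
  - by move=> i r r' rr K u t uv tv; apply: K; apply: lt_le_trans rr.
  - by exists r.
have [r2 r20 H2] : exists2 r, 0 < r & forall i u t, `|u - v| < r -> `|t - v| < r ->
    `|pushing (b i) t - pushing (b i) u| <= e.
  have [||r r0 rP] := @common 'I_d (fun i r => forall u t, `|u - v| < r -> `|t - v| < r ->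
    `|pushing (b i) t - pushing (b i) u| <= e).
  - by move=> i; apply: uniform_at; exact: continuous_pushing.
  - by move=> i r r' rr K u t uv tv; apply: K; apply: lt_le_trans rr.
  - by exists r.
have oX := orthant_path v0.
have [r3 r30 H3] : exists2 r, 0 < r & forall u t, 0 <= u -> 0 <= t -> `|u - v| < r -> `|t - v| < r ->
    delta <= norm1 (X u) -> `|taylor_rem G p q (X u) (X t)| <= e * norm1_dist (X u) (X t) ^+ 2 /\
    (forall i, X t 0 i = 0 -> `|p i (X u)| <= e).
  (* At the origin nothing is known about p and q, but nearby norms are below [delta] and the claims
     are vacuous. *)
  have [X0|X0] := eqVneq (X v) 0.
    have /cvgrPdist_lt/(_ _ delta0)[r /= r0 rP] := @continuous_norm1_path v.
    exists r => // u t _ _ uv _; rewrite leNgt => /negP[].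
    have uv' : ball_ Num.norm v r u by rewrite /ball_ /= distrC.
    by have := rP u uv'; rewrite /= X0 norm1_eq0 sub0r normrN ger0_norm ?norm1_ge0.
  have [s1 s10 L1] := nd_local nd oX X0 e0.
  have : \forall y \near X v, y != 0 /\ forall i, `|p i (X v) - p i y| <= e / 2.
    have n1 : \forall y \near X v, forall i, `|p i (X v) - p i y| <= e / 2.
      by apply: near_finite_forall => i; have /cvgrPdist_le := nd_contp nd (i := i) oX X0; apply.
    have ct : total y @[y --> X v] --> total (X v) := @continuous_total _ _ (X v).
    near=> y; split; last by near: y.
    have : 0 < total y by near: y; apply: cvgr_gt ct _ _; exact: total_gt0.
    by apply: contraTneq => ->; rewrite /total big1 ?ltxx// => i _; rewrite mxE.
  move=> /nbhs_box[s2 s20 L2].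
  have s0 : 0 < Num.min s1 s2 by rewrite lt_min s10.
  have [r r0 rP] := path_box v s0.
  exists r => // u t u0 t0 uv tv du.
  have bu := rP u uv; have bt := rP t tv.
  have sub s : Num.min s1 s2 <= s -> forall y, box (X v) (Num.min s1 s2) y -> box (X v) s y.
    by move=> ss y yb i; apply: lt_le_trans ss.
  have m1 : Num.min s1 s2 <= s1 by rewrite ge_min lexx.
  have m2 : Num.min s1 s2 <= s2 by rewrite ge_min lexx orbT.
  split; first by apply: L1; [exact: orthant_path|exact: orthant_path|exact: sub bu|exact: sub bt].
  move=> i Xt0; have [Xt pt] := L2 _ (sub _ m2 _ bt); have [_ pu] := L2 _ (sub _ m2 _ bu).
  have pz : p i (X t) = 0 by apply: (nd_face nd) => //; exact: orthant_path.
  have := pt i; rewrite pz subr0 => pv.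
  rewrite -[p i (X u)](subrK (p i (X v))) [leRHS]splitr (le_trans (ler_normD _ _))// lerD//.
  by rewrite distrC.
exists (Num.min r1 (Num.min r2 r3)); first by rewrite !lt_min r10 r20.
move=> u t /andP[u0 _] /andP[t0 _]; rewrite !lt_min => /and3P[u1 u2 u3] /and3P[t1 t2 t3].
by split => [i|i|du|du]; [exact: H1|exact: H2|exact: (H3 u t u0 t0 u3 t3 du).1|exact: (H3 u t u0 t0 u3 t3 du).2].
Unshelve. all: by end_near. Qed.

(** The two terms are the largest excursions of b_i below and above 0 on [0, N]. Their sum dominates
    both |b_i| and the pushing term, and each is a running maximum, so Doob's inequality applies to
    it. *)
Definition path_bound (N : R) : R := \sum_i (pushing (b i) N + pushing (fun s => - b i s) N).

Lemma path_bound_ge0 N : 0 <= path_bound N.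
Proof. by apply: sumr_ge0 => i _; rewrite addr_ge0 ?pushing_ge0. Qed.

Lemma pushing_opp (g : R -> R) N s : continuous g -> 0 <= s <= N -> - pushing g N <= g s.
Proof.
move=> cg /andP[s0 sN]; rewrite /pushing max_r ?(le_trans s0)// opprK ge_min; apply/orP; right.
have [c [cN -> cmin]] := running_inf_attained (le_trans s0 sN) cg.
by apply: cmin; rewrite s0.
Qed.

Lemma path_le_bound N s : 0 <= s <= N -> \sum_i `|b i s| <= path_bound N.
Proof.
move=> sN; apply: ler_sum => i _.
have cn : continuous (fun s => - b i s) by move=> u; apply: cvgN; exact: cb.
have h1 := pushing_opp (@cb i) sN; have h2 := pushing_opp cn sN.
have h3 := pushing_ge0 (b i) N; have h4 := pushing_ge0 (fun s => - b i s) N.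
by rewrite ler_norml; apply/andP; split; lra.
Qed.

Lemma pushing_mono i s t : 0 <= s <= t -> pushing (b i) s <= pushing (b i) t.
Proof. by move=> st; have [] := pushing_incr st (@cb i). Qed.

Lemma pushing_le_bound N s : 0 <= s <= N -> \sum_i pushing (b i) s <= path_bound N.
Proof.
move=> sN; apply: ler_sum => i _; rewrite (le_trans (pushing_mono i sN))// lerDl.
exact: pushing_ge0.
Qed.

Lemma norm1_path_le N s : 0 <= s <= N -> norm1 (X s) <= 2 * path_bound N.
Proof.
move=> sN; have -> : 2 * path_bound N = path_bound N + path_bound N by ring.
rewrite (le_trans _ (lerD (path_le_bound sN) (pushing_le_bound sN)))// -big_split/=.
apply: ler_sum => i _; rewrite mxE /reflected (le_trans (ler_normD _ _))// lerD2l.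
by rewrite ger0_norm ?pushing_ge0.
Qed.

(** The increment of X is D + L with D Brownian and L from pushing. The terms purely in D are kept
    on the left; the first-order term in L costs P l, the mixed and quadratic ones C (be l + l^2),
    and the Taylor remainder the rest. *)
Lemma step_error (u t P rho : R) : 0 <= u <= t -> 0 <= P -> 0 <= rho ->
  delta <= norm1 (X u) ->
  (forall i, pushing (b i) u < pushing (b i) t -> `|p i (X u)| <= P) ->
  `|taylor_rem G p q (X u) (X t)| <= rho * norm1_dist (X u) (X t) ^+ 2 ->
  forall l be, l = \sum_i (pushing (b i) t - pushing (b i) u) ->
  be = \sum_i `|b i t - b i u| ->
  `|G (X t) - G (X u) - \sum_i p i (X u) * (b i t - b i u) -
    2^-1 * \sum_i \sum_j q i j (X u) * (b i t - b i u) * (b j t - b j u)|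
  <= P * l + C * (be * l + l ^+ 2) + rho * (be + l) ^+ 2.
Proof.
move=> ut P0 rho0 du pP remP l be lE beE.
have u0 : 0 <= u by case/andP: ut.
pose L i := pushing (b i) t - pushing (b i) u; pose D i := b i t - b i u.
have L0 i : 0 <= L i by rewrite subr_ge0 pushing_mono.
have XE i : X t 0 i - X u 0 i = D i + L i by rewrite !mxE /reflected /D /L; ring.
have qC i j : `|q i j (X u)| <= C by apply: (nd_boundq nd) => //; exact: orthant_path.
have l0 : 0 <= l by rewrite lE; apply: sumr_ge0 => i _; exact: L0.
have be0 : 0 <= be by rewrite beE; apply: sumr_ge0.
have -> : G (X t) - G (X u) - \sum_i p i (X u) * (b i t - b i u) -
    2^-1 * \sum_i \sum_j q i j (X u) * (b i t - b i u) * (b j t - b j u) =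
  \sum_i p i (X u) * L i +
  2^-1 * (\sum_i \sum_j q i j (X u) * (D i * L j + L i * D j + L i * L j)) +
  taylor_rem G p q (X u) (X t).
  rewrite /taylor_rem.
  have -> : \sum_i p i (X u) * (X t 0 i - X u 0 i) = \sum_i p i (X u) * (b i t - b i u) + \sum_i p i (X u) * L i.
    by rewrite -big_split/=; apply: eq_bigr => i _; rewrite XE mulrDr.
  have -> : \sum_i \sum_j q i j (X u) * (X t 0 i - X u 0 i) * (X t 0 j - X u 0 j) =
     \sum_i \sum_j q i j (X u) * (b i t - b i u) * (b j t - b j u) +
     \sum_i \sum_j q i j (X u) * (D i * L j + L i * D j + L i * L j).
    rewrite -big_split/=; apply: eq_bigr => i _; rewrite -big_split/=; apply: eq_bigr => j _.
    by rewrite !XE -/(D i) -/(D j); ring.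
  by ring.
rewrite (le_trans (ler_normD _ _))// lerD//; last first.
  apply: (le_trans remP); rewrite ler_wpM2l// lerXn2r ?nnegrE ?norm1_dist_ge0 ?addr_ge0//.
  rewrite /norm1_dist lE beE -big_split/=; apply: ler_sum => i _.
  by rewrite XE (le_trans (ler_normD _ _))// lerD2l ger0_norm.
rewrite (le_trans (ler_normD _ _))// lerD//.
  rewrite (le_trans (ler_norm_sum _ _ _))// lE mulr_sumr; apply: ler_sum => i _.
  rewrite normrM (ger0_norm (L0 i)) -/(L i); have := L0 i; rewrite le_eqVlt => /predU1P[<-|Li]; first by rewrite !mulr0.
  by apply: ler_wpM2r; [exact: L0|apply: pP; rewrite -subr_gt0].
have S1 : \sum_i \sum_j (`|D i| * L j + L i * `|D j| + L i * L j) = 2 * (be * l) + l ^+ 2.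
  under eq_bigr do rewrite !big_split/=.
  rewrite !big_split/=.
  have -> : \sum_i \sum_j `|D i| * L j = be * l.
    by rewrite beE mulr_suml; apply: eq_bigr => i _; rewrite lE mulr_sumr.
  have -> : \sum_i \sum_j L i * `|D j| = l * be.
    by rewrite lE mulr_suml; apply: eq_bigr => i _; rewrite beE mulr_sumr.
  have -> : \sum_i \sum_j L i * L j = l * l.
    by rewrite {1}lE mulr_suml; apply: eq_bigr => i _; rewrite lE mulr_sumr.
  by ring.
(* Either an index exists and bounds C below through |q|, or all sums are empty. *)
have C0 : be * l + l ^+ 2 = 0 \/ 0 <= C.
  have [i _|/= d0] := pickP 'I_d; first by right; apply: le_trans (qC i i).
  left; rewrite beE lE !big1 ?mul0r ?expr0n/= ?addr0// => i _; by have := d0 i.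
have S2 : `|\sum_i \sum_j q i j (X u) * (D i * L j + L i * D j + L i * L j)| <= C * (2 * (be * l) + l ^+ 2).
  rewrite -S1 mulr_sumr (le_trans (ler_norm_sum _ _ _))//; apply: ler_sum => i _.
  rewrite mulr_sumr (le_trans (ler_norm_sum _ _ _))//; apply: ler_sum => j _.
  rewrite normrM ler_pM//; rewrite (le_trans (ler_normD _ _))// (ger0_norm (mulr_ge0 _ _))// lerD2r.
  by rewrite (le_trans (ler_normD _ _))// !normrM !(ger0_norm (L0 _)).
rewrite normrM ger0_norm ?invr_ge0//.
have m1 := mulr_ge0 be0 l0; have m2 := sqr_ge0 l.
case: C0 => [z|C0].
  have z1 : be * l = 0 by lra.
  have z2 : l ^+ 2 = 0 by lra.
  by move: S2; rewrite z1 z2; lra.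
have m3 := mulr_ge0 C0 m2; rewrite mulrDr in S2; rewrite mulrDr; lra.
Qed.

Lemma neumann_const_ge0 : 0 <= C.
Proof.
have o0 : orthant (0 : 'rV[R]_d) by move=> i; rewrite mxE.
have := nd_growth nd o0; rewrite norm1_eq0 expr0n/= addr0 mulr1; exact: le_trans.
Qed.

Variables (N a e : R) (z : R -> R).
Hypotheses (N0 : 0 < N) (a0 : 0 <= a) (ae : a <= e) (eN : e <= N).
Hypotheses (zE : forall u, 0 <= u <= N -> z u = (a < u <= e)%R%:R)
  (ze : forall u, a < u <= e -> delta <= norm1 (X u)).

Definition ito_error n := \sum_(k < n.+1) z (k%:R * (N / n.+1%:R)) *
  (G (X (k.+1%:R * (N / n.+1%:R))) - G (X (k%:R * (N / n.+1%:R))) -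
   \sum_i p i (X (k%:R * (N / n.+1%:R))) * (b i (k.+1%:R * (N / n.+1%:R)) - b i (k%:R * (N / n.+1%:R))) -
   2^-1 * \sum_i \sum_j q i j (X (k%:R * (N / n.+1%:R))) *
     (b i (k.+1%:R * (N / n.+1%:R)) - b i (k%:R * (N / n.+1%:R))) *
     (b j (k.+1%:R * (N / n.+1%:R)) - b j (k%:R * (N / n.+1%:R)))).

Definition quad_var n := \sum_(k < n.+1) \sum_i
  (b i (k.+1%:R * (N / n.+1%:R)) - b i (k%:R * (N / n.+1%:R))) ^+ 2.

Lemma quad_var_ge0 n : 0 <= quad_var n.
Proof. by apply: sumr_ge0 => k _; apply: sumr_ge0 => i _; exact: sqr_ge0. Qed.

Lemma sum_pushing_incr n : \sum_(k < n.+1) \sum_i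
  (pushing (b i) (k.+1%:R * (N / n.+1%:R)) - pushing (b i) (k%:R * (N / n.+1%:R))) <= path_bound N.
Proof.
rewrite exchange_big/=; apply: ler_sum => i _.
rewrite -(big_mkord xpredT (fun k => pushing (b i) (k.+1%:R * (N / n.+1%:R)) - pushing (b i) (k%:R * (N / n.+1%:R)))).
rewrite telescope_sumr// mulrC divfK// mul0r.
by have := pushing_ge0 (b i) 0; have := pushing_ge0 (fun s => - b i s) N; lra.
Qed.

(** In every product containing a pushing increment l, one factor l is kept, and these add up to at
    most [path_bound N]; the other factor is bounded by g. The squares of the Brownian increments go
    to the quadratic variation. *)
Lemma ito_error_le n (P rho g : R) : 0 <= P -> 0 <= rho -> 0 <= g ->
  (forall k : 'I_n.+1, let u := k%:R * (N / n.+1%:R) in let t := k.+1%:R * (N / n.+1%:R) in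
    [/\ \sum_i (pushing (b i) t - pushing (b i) u) <= g, \sum_i `|b i t - b i u| <= g &
     delta <= norm1 (X u) ->
      (forall i, pushing (b i) u < pushing (b i) t -> `|p i (X u)| <= P) /\
      `|taylor_rem G p q (X u) (X t)| <= rho * norm1_dist (X u) (X t) ^+ 2]) ->
  `|ito_error n| <= P * path_bound N + C * (2 * g * path_bound N) +
     rho * (2 * d%:R * quad_var n + 2 * g * path_bound N).
Proof.
move=> P0 rho0 g0 H.
have C0 := neumann_const_ge0.
pose t k : R := k%:R * (N / n.+1%:R).
pose l (k : nat) := \sum_i (pushing (b i) (t k.+1) - pushing (b i) (t k)).
pose be (k : nat) := \sum_i `|b i (t k.+1) - b i (t k)|.
pose qv (k : nat) := \sum_i (b i (t k.+1) - b i (t k)) ^+ 2.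
have tt (k : 'I_n.+1) : 0 <= t k <= t k.+1.
  rewrite /t mulr_ge0 ?(ltW (divr_gt0 N0 _))//=.
  by rewrite ler_wpM2r ?ler_nat// ltW// divr_gt0.
have l0 (k : 'I_n.+1) : 0 <= l k by apply: sumr_ge0 => i _; rewrite subr_ge0 pushing_mono.
have be0 (k : 'I_n.+1) : 0 <= be k by exact: sumr_ge0.
have beq (k : 'I_n.+1) : be k ^+ 2 <= d%:R * qv k.
  rewrite (le_trans (sqr_sum_le _))// card_ord ler_wpM2l//.
  by apply: ler_sum => i _; rewrite real_normK ?num_real.
have sl : \sum_(k < n.+1) l k <= path_bound N by exact: sum_pushing_incr.
have step (k : 'I_n.+1) : `|z (t k) * (G (X (t k.+1)) - G (X (t k)) -
     \sum_i p i (X (t k)) * (b i (t k.+1) - b i (t k)) -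
     2^-1 * \sum_i \sum_j q i j (X (t k)) * (b i (t k.+1) - b i (t k)) * (b j (t k.+1) - b j (t k)))|
   <= (P + C * (2 * g) + rho * (2 * g)) * l k + rho * (2 * d%:R) * qv k.
  have [lg bg hk] := H k.
  have Cg : 0 <= C * g by exact: mulr_ge0.
  have rg : 0 <= rho * g by exact: mulr_ge0.
  have rhs0 : 0 <= (P + C * (2 * g) + rho * (2 * g)) * l k + rho * (2 * d%:R) * qv k.
    apply: addr_ge0; first by apply: mulr_ge0 => //; lra.
    by rewrite !mulr_ge0//; apply: sumr_ge0 => i _; exact: sqr_ge0.
  rewrite zE; last by apply: grid_in; [exact: ltW|exact: ltnW].
  have [/ze du|_] := boolP (a < t k <= e); last by rewrite mul0r normr0.
  have [pP rP] := hk du.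
  rewrite mul1r (le_trans (step_error (tt k) P0 rho0 du pP rP erefl erefl))//.
  rewrite -/(t k) -/(t k.+1) -/(l k) -/(be k).
  have h1 : be k * l k <= g * l k by rewrite ler_wpM2r.
  have h2 : l k ^+ 2 <= g * l k by rewrite expr2 ler_wpM2r.
  have h3 : (be k + l k) ^+ 2 <= 2 * (d%:R * qv k) + 2 * (g * l k).
    have := sqr_ge0 (be k - l k); have := beq k; lra.
  have h4 : C * (be k * l k + l k ^+ 2) <= C * (2 * (g * l k)) by rewrite ler_wpM2l//; lra.
  have h5 : rho * (be k + l k) ^+ 2 <= rho * (2 * (d%:R * qv k) + 2 * (g * l k)) by rewrite ler_wpM2l.
  apply: (le_trans (lerD (lerD (lexx _) h4) h5)); by rewrite le_eqVlt; apply/orP; left; apply/eqP; ring.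
have qvE : quad_var n = \sum_(k < n.+1) qv k by [].
rewrite (le_trans (ler_norm_sum _ _ _))// (le_trans (ler_sum _ (fun k _ => step k)))//.
rewrite big_split/= -!mulr_sumr -qvE.
have c0 : 0 <= P + C * (2 * g) + rho * (2 * g).
  by rewrite !addr_ge0// !mulr_ge0.
have := ler_wpM2l c0 sl; move: (path_bound N) => S; lra.
Qed.

Lemma grid_le n (k : 'I_n.+1) : 0 <= k%:R * (N / n.+1%:R) <= k.+1%:R * (N / n.+1%:R) /\
  k.+1%:R * (N / n.+1%:R) <= N.
Proof.
split; last by case/andP: (@grid_in _ N n k.+1 (ltW N0) (ltn_ord k)).
rewrite mulr_ge0 ?(ltW (divr_gt0 N0 _))//=.
by rewrite ler_wpM2r ?ler_nat// ltW// divr_gt0.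
Qed.

Lemma ito_error_bound n :
  `|ito_error n| <= C * (9 + 2 * d%:R) * (1 + path_bound N ^+ 2 + quad_var n).
Proof.
have C0 := neumann_const_ge0; have S0 := path_bound_ge0 N.
have Q0 := quad_var_ge0 n.
have d0 : 0 <= d%:R :> R by [].
have S2 : 0 <= 2 * path_bound N by rewrite mulr_ge0.
(* The crude choice P = rho = C and g = 2 S gives C (S + 8 S^2 + 2 d Q), valid for every mesh; it
   provides the domination. *)
apply: (le_trans (ito_error_le (g := 2 * path_bound N) C0 C0 S2 _)).
  move=> k u t; have [/andP[u0 ut] tN] := grid_le k.
  have uN : 0 <= u <= N by rewrite u0 (le_trans ut).
  have tN' : 0 <= t <= N by rewrite (le_trans u0 ut).
  split.
  - have := pushing_le_bound uN; have := pushing_le_bound tN'; rewrite sumrB.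
    have : 0 <= \sum_i pushing (b i) u by apply: sumr_ge0 => i _; exact: pushing_ge0.
    move: (\sum_i _) (\sum_i _) => x y; lra.
  - have h1 := path_le_bound uN; have h2 := path_le_bound tN'.
    apply: (@le_trans _ _ (\sum_i `|b i t| + \sum_i `|b i u|)); last by lra.
    by rewrite -big_split/=; apply: ler_sum => i _; exact: ler_normB.
  - move=> du; split.
      by move=> i _; apply: (nd_boundp nd) => //; exact: orthant_path.
    by apply: (nd_rem nd) => //; apply: orthant_path => //; exact: le_trans ut.
move: (path_bound N) (quad_var n) S0 Q0 {S2} => S Q S0 Q0.
have dQ : 0 <= d%:R * (1 + S ^+ 2) by rewrite mulr_ge0// addr_ge0// sqr_ge0.
have h : S + 8 * S ^+ 2 + 2 * (d%:R * Q) <= (9 + 2 * d%:R) * (1 + S ^+ 2 + Q).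
  have := sqr_ge0 (S - 1); nra.
have := ler_wpM2l C0 h; lra.
Qed.

Lemma ito_error_small (r : R) : 0 < r -> exists n0, forall n, (n0 <= n)%N ->
  `|ito_error n| <= r * (1 + path_bound N ^+ 2 + quad_var n).
Proof.
move=> r0.
have C0 := neumann_const_ge0; have S0 := path_bound_ge0 N.
have d0 : 0 <= d%:R :> R by [].
(* [K] adds up the coefficients of the bound with P = rho = c and g = d c, once S and Q are bounded
   by 1 + S^2 + Q and c by 1. *)
pose K := 1 + 2 * C * d%:R + 4 * d%:R : R.
have K0 : 0 < K by rewrite /K -addrA ltr_pwDl// addr_ge0// !mulr_ge0.
pose c := Num.min 1 (r / K).
have c0 : 0 < c by rewrite lt_min ltr01 divr_gt0.
have c1 : c <= 1 by rewrite ge_min lexx.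
have cr : c * K <= r by rewrite -ler_pdivlMr// ge_min lexx orbT.
have [eta eta0 etaP] := path_modulus N c0.
have [n0 n0P] := mesh_eventually N eta0.
exists n0 => n /n0P hn.
have Q0 := quad_var_ge0 n.
have g0 : 0 <= d%:R * c by rewrite mulr_ge0 ?(ltW c0).
have h0 : 0 < N / n.+1%:R by rewrite divr_gt0.
apply: (le_trans (ito_error_le (g := d%:R * c) (ltW c0) (ltW c0) g0 _)).
  move=> k u t; have [/andP[u0 ut] tN] := grid_le k.
  have utE : t - u < eta.
    rewrite (le_lt_trans _ hn)// gtr0_norm// /t /u -natr1 mulrDl mul1r.
    by rewrite addrC addKr.
  have [h1 h2 h3 h4] := etaP u t u0 ut tN utE.
  have sc : \sum_(i < d) c = d%:R * c by rewrite sumr_const card_ord mulr_natl.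
  split; first by rewrite -sc; apply: ler_sum => i _; exact: h2.
    by rewrite -sc; apply: ler_sum => i _; exact: h1.
  by move=> du; split; [exact: h4|exact: h3].
apply: (@le_trans _ _ (c * K * (1 + path_bound N ^+ 2 + quad_var n))); last first.
  by rewrite ler_wpM2r// !addr_ge0// sqr_ge0.
move: (path_bound N) (quad_var n) S0 Q0 => S Q S0 Q0.
have h1 : S <= 1 + S ^+ 2 + Q by have := sqr_ge0 (S - 1); nra.
have h2 : Q <= 1 + S ^+ 2 + Q by have := sqr_ge0 S; lra.
have cd : 0 <= c * d%:R by rewrite mulr_ge0// ltW.
have m1 : 0 <= 2 * C * (c * d%:R) by apply: mulr_ge0 => //; apply: mulr_ge0.
have m2 : c * (d%:R * c) <= c * d%:R by rewrite mulrA ler_piMr.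
set W := 1 + S ^+ 2 + Q in h1 h2 *.
have k1 : c * S <= c * W by rewrite ler_wpM2l// ltW.
have k2 : 2 * C * (c * d%:R) * S <= 2 * C * (c * d%:R) * W by rewrite ler_wpM2l.
have k3 : c * d%:R * Q <= c * d%:R * W by rewrite ler_wpM2l.
have k4 : c * (d%:R * c) * S <= c * d%:R * W.
  apply: (@le_trans _ _ (c * d%:R * S)); first by rewrite ler_wpM2r.
  by rewrite ler_wpM2l.
rewrite /K; lra.
Qed.

(** The part of [ito_error] with a pathwise limit: the first-order Brownian terms are removed and
    each product of increments is replaced by its mean, h on the diagonal and 0 off it. *)
Definition ito_sum n := \sum_(k < n.+1) z (k%:R * (N / n.+1%:R)) *
  (G (X (k.+1%:R * (N / n.+1%:R))) - G (X (k%:R * (N / n.+1%:R))) -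
   2^-1 * \sum_i q i i (X (k%:R * (N / n.+1%:R))) * (N / n.+1%:R)).

Lemma stopped_indicator u : 0 <= u <= N -> z u = (u <= e)%R%:R - (u <= a)%R%:R.
Proof.
move=> uN; rewrite zE//; have [ua|ua] := leP u a; last by rewrite /= subr0.
by rewrite (le_trans ua ae)/= subrr.
Qed.

Lemma path_growth s : 0 <= s <= N -> `|G (X s)| <= C * (1 + 4 * path_bound N ^+ 2).
Proof.
move=> sN; have s0 : 0 <= s by case/andP: sN.
apply: (le_trans (nd_growth nd (orthant_path s0))).
rewrite ler_wpM2l ?neumann_const_ge0// lerD2l.
have -> : 4 * path_bound N ^+ 2 = (2 * path_bound N) ^+ 2 by ring.
by rewrite lerXn2r ?nnegrE ?norm1_ge0 ?mulr_ge0 ?path_bound_ge0 ?norm1_path_le.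
Qed.

Lemma laplacian_bound u : 0 <= u <= N -> `|z u * \sum_i q i i (X u)| <= d%:R * C.
Proof.
move=> uN; rewrite zE//; have [/ze du|_] := boolP (a < u <= e); last first.
  by rewrite mul0r normr0 mulr_ge0 ?neumann_const_ge0.
rewrite mul1r (le_trans (ler_norm_sum _ _ _))//.
have -> : d%:R * C = \sum_(i < d) C by rewrite sumr_const card_ord mulr_natl.
apply: ler_sum => i _; apply: (nd_boundq nd) => //; apply: orthant_path.
by case/andP: uN.
Qed.

(** The indicator of ]a, e] is the difference of two stopped indicators, so the increments of G
    telescope: they converge without any regularity of G in between, and are bounded by four values
    of G for every mesh. *)
Lemma ito_sumE n : ito_sum n =
  \sum_(k < n.+1) (k%:R * (N / n.+1%:R) <= e)%R%:R *
    (G (X (k.+1%:R * (N / n.+1%:R))) - G (X (k%:R * (N / n.+1%:R)))) -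
  \sum_(k < n.+1) (k%:R * (N / n.+1%:R) <= a)%R%:R *
    (G (X (k.+1%:R * (N / n.+1%:R))) - G (X (k%:R * (N / n.+1%:R)))) -
  2^-1 * \sum_(k < n.+1) (z ((k + false)%:R * (N / n.+1%:R)) *
     \sum_i q i i (X ((k + false)%:R * (N / n.+1%:R)))) * (N / n.+1%:R).
Proof.
rewrite /ito_sum mulr_sumr -!sumrB; apply: eq_bigr => k _; rewrite addn0.
rewrite -mulr_suml mulrBr {1}stopped_indicator; last by apply: grid_in; [exact: ltW|exact: ltnW].
by ring.
Qed.

Lemma ito_sum_bound n :
  `|ito_sum n| <= 4 * (C * (1 + 4 * path_bound N ^+ 2)) + d%:R * C * N.
Proof.
have h0 : 0 < N / n.+1%:R by rewrite divr_gt0.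
have NE : n.+1%:R * (N / n.+1%:R) = N by rewrite mulrC divfK.
have tel c : `|\sum_(k < n.+1) (k%:R * (N / n.+1%:R) <= c)%R%:R *
    (G (X (k.+1%:R * (N / n.+1%:R))) - G (X (k%:R * (N / n.+1%:R))))| <=
    2 * (C * (1 + 4 * path_bound N ^+ 2)).
  have [j [jn -> _ _]] := @telescope_stopped _ (fun u => G (X u)) (N / n.+1%:R) c n.+1 h0.
  rewrite (le_trans (ler_normB _ _))//.
  have := path_growth (@grid_in _ N n j (ltW N0) jn).
  have := path_growth (@grid_in _ N n 0 (ltW N0) isT); rewrite mul0r; lra.
have rie : `|\sum_(k < n.+1) (z ((k + false)%:R * (N / n.+1%:R)) *
     \sum_i q i i (X ((k + false)%:R * (N / n.+1%:R)))) * (N / n.+1%:R)| <= d%:R * C * N.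
  rewrite (le_trans (ler_norm_sum _ _ _))//.
  have -> : d%:R * C * N = \sum_(k < n.+1) d%:R * C * (N / n.+1%:R).
    by rewrite sumr_const card_ord -[RHS]mulr_natl mulrCA NE.
  apply: ler_sum => k _; rewrite normrM (gtr0_norm h0) ler_wpM2r ?(ltW h0)//.
  by apply: laplacian_bound; rewrite addn0; apply: grid_in; [exact: ltW|exact: ltnW].
rewrite ito_sumE.
have te := tel e; have ta := tel a.
rewrite (le_trans (ler_normB _ _))// normrM ger0_norm ?invr_ge0//.
have := ler_normB (\sum_(k < n.+1) (k%:R * (N / n.+1%:R) <= e)%R%:R *
    (G (X (k.+1%:R * (N / n.+1%:R))) - G (X (k%:R * (N / n.+1%:R))))) (\sum_(k < n.+1) (k%:R * (N / n.+1%:R) <= a)%R%:R *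
    (G (X (k.+1%:R * (N / n.+1%:R))) - G (X (k%:R * (N / n.+1%:R))))).
have : 0 <= d%:R * C * N by rewrite mulr_ge0 ?(ltW N0)// mulr_ge0 ?neumann_const_ge0.
move: rie te ta; lra.
Qed.

(** When a < e, the bound |X| >= delta extends to the excluded end a by continuity, so G is
    continuous along the path at both ends. When a = e the window is empty and X a may be anything,
    hence the separate case. *)
Lemma cvg_ito_sum_lt : a < e ->
  ito_sum n @[n --> \oo] --> G (X e) - G (X a) -
    2^-1 * \int[lebesgue_measure]_(s in `[0, N]) (z s * \sum_i q i i (X s)).
Proof.
move=> ltae.
have e0 : 0 <= e := le_trans a0 ae.
have aN : a <= N := le_trans ae eN.
have nz u : 0 <= u -> delta <= norm1 (X u) -> {for u, continuous (fun s => G (X s))}.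
  move=> u0 du; have X0 : X u != 0 by rewrite -norm1_gt0P (lt_le_trans delta0 du).
  apply: (@continuous_comp _ _ _ X G); first exact: continuous_path.
  exact: (nd_contG nd (orthant_path u0) X0).
have da : delta <= norm1 (X a).
  rewrite leNgt; apply/negP => lt.
  have /cvgrPdist_lt/(_ (delta - norm1 (X a))) := @continuous_norm1_path a.
  rewrite subr_gt0 => /(_ lt)[r /= r0 rP].
  pose u := Num.min e (a + r / 2).
  have au : a < u by rewrite lt_min ltae ltrDl divr_gt0.
  have ue : u <= e by rewrite ge_min lexx.
  have ur : u <= a + r / 2 by rewrite ge_min lexx orbT.
  have uball : ball_ Num.norm a r u by rewrite /ball_ /= distrC gtr0_norm ?subr_gt0//; lra.
  have := rP u uball; rewrite /= distrC => h.
  have : delta <= norm1 (X u) by apply: ze; rewrite au.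
  by have := ler_norm (norm1 (X u) - norm1 (X a)); lra.
have de : delta <= norm1 (X e) by apply: ze; rewrite ltae lexx.
rewrite (_ : G (X e) - G (X a) = (G (X e) - G (X 0)) - (G (X a) - G (X 0))); last by ring.
under eq_fun do rewrite ito_sumE.
apply: cvgB; first apply: cvgB.
- by apply: (@cvg_telescope_stopped _ (fun u => G (X u))); rewrite ?e0//; exact: nz.
- by apply: (@cvg_telescope_stopped _ (fun u => G (X u))); rewrite ?a0//; exact: nz.
(* The indicator of ]a, e] is left-continuous, which suits tags at the left ends of the cells; those
   tags are also what makes the coefficients adapted. *)
apply: cvgMr; apply: (@cvg_riemann_sum _ false _ _ (d%:R * C)) => //.
  by move=> s sN; exact: laplacian_bound.
move=> s; rewrite in_itv/= => /andP[s0 sN] c c0.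
have zero u : 0 <= u <= N -> ~~ (a < u <= e) -> z u * \sum_i q i i (X u) = 0.
  by move=> uN nu; rewrite zE// (negbTE nu) mul0r.
have uin u : u < s -> `|u - s| < s -> 0 <= u <= N.
  by move=> us; rewrite distrC gtr0_norm ?subr_gt0// => h; apply/andP; split; lra.
have [sa|sa] := leP s a.
  exists s => // u us uss; rewrite !zero ?subrr ?normr0 ?(ltW c0) ?(ltW s0)//.
  - by rewrite negb_and -leNgt sa.
  - exact: uin.
  - by rewrite negb_and -leNgt (le_trans (ltW us) sa).
have [se|se] := ltP e s.
  exists (Num.min s (s - e)); first by rewrite lt_min s0 subr_gt0.
  move=> u us; rewrite lt_min => /andP[us1 us2].
  have eu : e < u by move: us2; rewrite distrC gtr0_norm ?subr_gt0//; lra.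
  rewrite !zero ?subrr ?normr0 ?(ltW c0)//.
  - by rewrite (ltW s0).
  - by rewrite negb_and -ltNge se orbT.
  - exact: uin.
  - by rewrite negb_and -!ltNge eu orbT.
have ds : delta <= norm1 (X s) by apply: ze; rewrite sa.
have Xs0 : X s != 0 by rewrite -norm1_gt0P (lt_le_trans delta0 ds).
have cq : {for s, continuous (fun u => \sum_i q i i (X u))}.
  apply: continuous_at_sum => i.
  apply: (@continuous_comp _ _ _ X (q i i)); first exact: continuous_path.
  exact: (nd_contq nd (orthant_path (ltW s0)) Xs0).
move: cq => /cvgrPdist_le/(_ _ c0)[r /= r0 rP].
exists (Num.min s (Num.min r (s - a))); first by rewrite !lt_min s0 r0 subr_gt0.
move=> u us; rewrite !lt_min => /and3P[u1 u2 u3].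
have au : a < u by move: u3; rewrite distrC gtr0_norm ?subr_gt0//; lra.
rewrite !zE ?(ltW s0)//; last exact: uin.
rewrite au sa se (le_trans (ltW us) se)/= !mul1r distrC; apply: rP.
by rewrite /ball_ /= distrC.
Qed.

Lemma cvg_ito_sum :
  ito_sum n @[n --> \oo] --> G (X e) - G (X a) -
    2^-1 * \int[lebesgue_measure]_(s in `[0, N]) (z s * \sum_i q i i (X s)).
Proof.
move: (ae); rewrite le_eqVlt => /predU1P[eae|]; last exact: cvg_ito_sum_lt.
have z0 u : 0 <= u <= N -> z u = 0.
  by move=> uN; rewrite zE// -eae; case: ltgtP.
have -> : ito_sum = cst 0.
  apply/funext => n; rewrite /ito_sum big1// => k _; rewrite z0 ?mul0r//.
  by apply: grid_in; [exact: ltW|exact: ltnW].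
rewrite eae subrr sub0r (@eq_Rintegral _ _ _ _ _ (cst 0)); last first.
  by move=> s; rewrite inE/= in_itv/= => sN; rewrite z0 ?mul0r.
rewrite Rintegral_cst// mul0r mulr0 oppr0; exact: cvg_cst.
Qed.

End PathError.

(** * Brownian increments and maxima *)

Section MeasurablePaths.
Context {R : realType} {dU : measure_display} {U : measurableType dU}.

Lemma measurable_forall_fin (I : finType) (A : I -> set U) :
  (forall i, measurable (A i)) -> measurable [set w | forall i, A i w].
Proof.
move=> mA; rewrite (_ : [set w | _] = \bigcap_(i in [set: I]) A i).
  by apply: fin_bigcap_measurable => //; exact: finite_finset.
by apply/seteqP; split => w /= h; [move=> i _|move=> i]; exact: h.
Qed.

Lemma measurable_fun_countable (K : countType) (k : U -> K) (h : K -> R) :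
  (forall m, measurable (k @^-1` [set m])) -> measurable_fun [set: U] (h \o k).
Proof.
move=> mk _ Y mY; rewrite setTI.
rewrite (_ : _ @^-1` _ = \bigcup_(m in [set m | Y (h m)]) (k @^-1` [set m])).
  rewrite bigcup_mkcond; apply: countable_bigcupT_measurable => // m.
  by case: ifP => // _; exact: mk.
apply/seteqP; split => [w /= Yw|w [m /= Ym ->]]//; by exists (k w).
Qed.

(** g may be discontinuous at the origin. The point x w is rounded to a lattice of mesh 1 / (n + 1),
    the origin being kept apart as [None]: the rounded map takes countably many values on measurable
    sets, and g of it converges by continuity. *)
Lemma measurable_orthant_fun d (x : U -> 'rV[R]_d) (g : 'rV[R]_d -> R) :
  (forall i, measurable_fun [set: U] (fun w => x w 0 i)) ->
  (forall w, orthant (x w)) ->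
  (forall y, orthant y -> y != 0 -> {for y, continuous g}) ->
  measurable_fun [set: U] (fun w => g (x w)).
Proof.
move=> mx ox cg.
pose k n w : option 'rV[int]_d := if x w == 0 then None else
  Some (\row_i Num.floor (n.+1%:R * x w 0 i)).
pose h n (m : option 'rV[int]_d) : R := if m is Some m then g (\row_i ((m 0 i)%:~R / n.+1%:R)) else g 0.
have mz : measurable [set w | forall i, x w 0 i = 0].
  apply: measurable_forall_fin => i; have := mx i measurableT [set 0] (measurable_set1 0).
  by rewrite setTI.
have zE : [set w | forall i, x w 0 i = 0] = [set w | x w = 0].
  apply/seteqP; split => w /=; first by move=> xw; apply/rowP => i; rewrite mxE.
  by move=> -> i; rewrite mxE.
rewrite zE in mz.
apply: (measurable_fun_cvg (h := fun n => h n \o k n)) => //; last first.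
  move=> w _; rewrite /=.
  have [xw|xw] := eqVneq (x w) 0.
    rewrite (_ : (fun n => _) = cst (g (x w))); first exact: cvg_cst.
    by apply/funext => n /=; rewrite /k xw eqxx.
  rewrite (_ : (fun n => _) = (fun n => g (\row_i ((Num.floor (n.+1%:R * x w 0 i))%:~R / n.+1%:R)))); last first.
    by apply/funext => n /=; rewrite /k (negbTE xw)/=; congr g; apply/rowP => i; rewrite !mxE.
  have cgx := cg _ (ox w) xw.
  apply: (@cvg_comp _ _ _ (fun n => \row_i ((Num.floor (n.+1%:R * x w 0 i))%:~R / n.+1%:R)) g \oo (nbhs (x w))); last exact: cgx.
  move=> A /nbhs_box[r r0 rA].
  have := cvg_mesh (1 : R) => /cvgrPdist_lt/(_ _ r0); apply: filterS => n nr.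
  apply: rA => i; rewrite mxE; move: nr; rewrite sub0r normrN => nr.
  apply: le_lt_trans nr; rewrite div1r [leRHS]ger0_norm ?invr_ge0//.
  have n0 : 0 < n.+1%:R :> R by [].
  have f1 := ge_floor (n.+1%:R * x w 0 i); have f2 := floorD1_gt (n.+1%:R * x w 0 i).
  rewrite intrD rmorph1 in f2.
  move: f1 f2; set m := (Num.floor _)%:~R; move: (x w 0 i) => y f1 f2.
  have -> : m / n.+1%:R - y = (m - n.+1%:R * y) / n.+1%:R by rewrite mulrBl mulrAC divff ?mul1r// lt0r_neq0.
  rewrite normrM [X in _ * X]ger0_norm ?invr_ge0// ler_piMl ?invr_ge0//.
  by rewrite distrC ger0_norm ?subr_ge0//; lra.
move=> n; apply: measurable_fun_countable => -[m|]; last first.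
  rewrite (_ : _ @^-1` _ = [set w | x w = 0])//; apply/seteqP; split => w /=; rewrite /k.
    by case: eqP.
  by move=> ->; rewrite eqxx.
rewrite (_ : _ @^-1` _ = ~` [set w | x w = 0] `&` [set w | forall i, Num.floor (n.+1%:R * x w 0 i) = m 0 i]).
  apply: measurableI; first exact: measurableC.
  apply: measurable_forall_fin => i.
  rewrite (_ : (fun w => _) = (fun w => n.+1%:R * x w 0 i) @^-1` `[(m 0 i)%:~R, (m 0 i + 1)%:~R[).
    have := measurable_funM (measurable_cst (n.+1%:R : R)) (mx i).
    by move=> /(_ measurableT _ (measurable_itv `[(m 0 i)%:~R, (m 0 i + 1)%:~R[)); rewrite setTI.
  apply/seteqP; split => w /=; rewrite in_itv/= => h'.
    by rewrite -h' ge_floor floorD1_gt.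
  exact: floor_def.
apply/seteqP; split => w /=; rewrite /k.
  case: eqP => // xw [<-]; split => // i; by rewrite mxE.
move=> [/eqP/negbTE -> xm]; congr Some; apply/rowP => i; by rewrite mxE xm.
Qed.

Variables (u : R) (beta : R -> U -> R).
Hypotheses (u0 : 0 <= u)
  (mb : forall v, 0 <= v <= u -> measurable_fun [set: U] (beta v))
  (cb : forall w, continuous (beta ^~ w)).

Lemma measurable_bigmin (n : nat) (a : U -> R) (g : nat -> U -> R) : measurable_fun [set: U] a ->
  (forall k, (k < n)%N -> measurable_fun [set: U] (g k)) ->
  measurable_fun [set: U] (fun w => \big[Num.min/a w]_(k < n) g k w).
Proof.
elim: n g => [|n IH] g ma mg.
  by rewrite (_ : (fun w => _) = a)//; apply/funext => w; rewrite big_ord0.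
rewrite (_ : (fun w => _) = (fun w => Num.min (g 0%N w) (\big[Num.min/a w]_(k < n) g k.+1 w))); last first.
  by apply/funext => w; rewrite big_ord_recl.
apply: measurable_minr; first exact: mg.
by apply: (IH (fun k => g k.+1)) => // k kn; exact: mg.
Qed.

Lemma measurable_running_inf : measurable_fun [set: U] (fun w => running_inf (beta ^~ w) u).
Proof.
apply: (measurable_fun_cvg (h := fun n w => \big[Num.min/beta 0 w]_(k < n.+1) beta (k.+1%:R * (u / n.+1%:R)) w)) => //.
  move=> n; apply: (measurable_bigmin (g := fun k => beta (k.+1%:R * (u / n.+1%:R)))).
    by apply: mb; rewrite lexx.
  by move=> k kn; apply: mb; exact: grid_in.
by move=> w _; exact: cvg_grid_min.
Qed.

Lemma measurable_pushing : measurable_fun [set: U] (fun w => pushing (beta ^~ w) u).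
Proof.
rewrite /pushing max_r//; apply: measurableT_comp => //.
by apply: measurable_minr => //; exact: measurable_running_inf.
Qed.

Lemma measurable_reflected : measurable_fun [set: U] (fun w => reflected (beta ^~ w) u).
Proof.
by apply: measurable_funD; [apply: mb; rewrite u0 lexx|exact: measurable_pushing].
Qed.

End MeasurablePaths.

Section SigmaAlgebraFacts.
Context {T : pointedType}.

Lemma sigma_setI (G : set (set T)) A B : <<s G >> A -> <<s G >> B -> <<s G >> (A `&` B).
Proof. exact: (@measurableI _ (g_sigma_algebraType G)). Qed.

Lemma sigma_setT (G : set (set T)) : <<s G >> [set: T].
Proof. exact: (@measurableT _ (g_sigma_algebraType G)). Qed.

Lemma sigma_subset (G H : set (set T)) : G `<=` <<s H >> -> <<s G >> `<=` <<s H >>.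
Proof. by move=> GH; apply: smallest_sub => //; exact: smallest_sigma_algebra. Qed.

End SigmaAlgebraFacts.

Section Centered.
Context {R : realType} {disp : measure_display} {T : measurableType disp}.
Variable P : probability T R.

Definition centered (Y : T -> R) :=
  P.-integrable [set: T] (EFin \o Y) /\ \int[P]_w Y w = 0.

Lemma centered0 : centered (fun=> 0).
Proof.
by split; [exact: finite_measure_integrable_cst|rewrite Rintegral_cst// mul0r].
Qed.

Lemma centeredD Y Z : centered Y -> centered Z -> centered (fun w => Y w + Z w).
Proof.
move=> [iY Y0] [iZ Z0]; split; first exact: (integrableD measurableT iY iZ).
by rewrite RintegralD// Y0 Z0 addr0.
Qed.

Lemma centeredZ c Y : centered Y -> centered (fun w => c * Y w).
Proof.
move=> [iY Y0]; split; first exact: (integrableZl measurableT c iY).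
by rewrite RintegralZl// Y0 mulr0.
Qed.

Lemma centered_sum (I : finType) (Y : I -> T -> R) : (forall i, centered (Y i)) ->
  centered (fun w => \sum_i Y i w).
Proof.
move=> cY; elim: (index_enum I) => [|i s IH].
  by rewrite (_ : (fun w => _) = (fun=> 0)); [exact: centered0|apply/funext => w; rewrite big_nil].
rewrite (_ : (fun w => _) = (fun w => Y i w + \sum_(j <- s) Y j w)); first exact: centeredD.
by apply/funext => w; rewrite big_cons.
Qed.

Definition mean_le (Y : T -> R) C :=
  P.-integrable [set: T] (EFin \o Y) /\ \int[P]_w Y w <= C.

Lemma mean_leD Y Z C D : mean_le Y C -> mean_le Z D -> mean_le (fun w => Y w + Z w) (C + D).
Proof.
move=> [iY YC] [iZ ZD]; split; first exact: (integrableD measurableT iY iZ).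
by rewrite RintegralD// lerD.
Qed.

Lemma mean_leZ c Y C : 0 <= c -> mean_le Y C -> mean_le (fun w => c * Y w) (c * C).
Proof.
move=> c0 [iY YC]; split; first exact: (integrableZl measurableT c iY).
by rewrite RintegralZl// ler_wpM2l.
Qed.

Lemma mean_le_cst c : mean_le (fun=> c) c.
Proof.
split; first exact: finite_measure_integrable_cst.
rewrite Rintegral_cst//; set x := fine _.
have -> : x = 1 by exact: (congr1 fine (probability_setT P)).
by rewrite mulr1.
Qed.

Lemma mean_le_sum (I : finType) (Y : I -> T -> R) (C : I -> R) :
  (forall i, mean_le (Y i) (C i)) -> mean_le (fun w => \sum_i Y i w) (\sum_i C i).
Proof.
move=> mY; elim: (index_enum I) => [|i s IH].
  rewrite big_nil (_ : (fun w => _) = (fun=> 0)); first exact: mean_le_cst.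
  by apply/funext => w; rewrite big_nil.
rewrite big_cons (_ : (fun w => _) = (fun w => Y i w + \sum_(j <- s) Y j w)); first exact: mean_leD.
by apply/funext => w; rewrite big_cons.
Qed.

Lemma mean_le_dominated (Y Z : T -> R) C : measurable_fun [set: T] Y -> (forall w, 0 <= Y w) ->
  (forall w, Y w <= Z w) -> mean_le Z C -> mean_le Y C.
Proof.
move=> mY Y0 YZ [iZ ZC]; have iY : P.-integrable [set: T] (EFin \o Y).
  by apply: (integrable_le mY _ iZ) => w; rewrite ger0_norm.
by split => //; apply: le_trans ZC; exact: le_Rintegral_setT.
Qed.

End Centered.

Lemma normal_law_integral {R : realType} {disp : measure_display} {T : measurableType disp}
    (P : probability T R) (s : R) (phi : T -> R) (f : R -> \bar R) :
  measurable_fun [set: T] phi ->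
  (forall A : set R, measurable A -> P (phi @^-1` A) = normal_prob 0 s A) ->
  measurable_fun [set: R] f -> (normal_prob 0 s).-integrable [set: R] f ->
  P.-integrable [set: T] (f \o phi) /\
  (\int[normal_prob 0 s]_x f x)%E = (\int[P]_x f (phi x))%E.
Proof.
move=> mD h mf ig.
pose phi' : {mfun T >-> measurableTypeR R} := HB.pack (phi : T -> measurableTypeR R) (isMeasurableFun.Build _ _ T (measurableTypeR R) phi mD).
have lawE (f' : R -> \bar R) : (\int[normal_prob 0 s]_x f' x = \int[distribution P phi']_x f' x)%E.
  by apply: eq_measure_integral => A mA _; exact: esym (h A mA).
have iP : P.-integrable [set: T] (f \o phi).
  apply/integrableP; split; first exact: measurableT_comp.
  have /integrableP[_] := ig.
  rewrite lawE.
  have mg : measurable_fun [set: R] (abse \o f) by exact: measurableT_comp.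
  by rewrite (@ge0_integral_distribution _ _ _ _ _ P phi' (abse \o f) mg (fun y => abse_ge0 _)).
split => //.
rewrite lawE.
by rewrite (@integral_distribution _ _ _ _ _ P phi' f).
Qed.

(** * Independence and moments of Brownian increments *)

Section BrownianFamily.
Context {R : realType} {d : nat} {disp : measure_display} {T : measurableType disp}.
Variables (P : probability T R) (r : 'rV[R]_d) (B : 'I_d -> R -> T -> R).
Hypotheses (hB : forall i, brownian_motion P (r 0 i) (B i))
  (hBind : independent_processes P B).

Definition bm_events (K : 'I_d -> set R) : set_system T :=
  [set A | exists j v (Y : set R), [/\ 0 <= v, K j v, measurable Y & A = B j v @^-1` Y]].

Definition bm_sigma u := <<s bm_events (fun=> [set v | v <= u]) >>.

(** Component i up to time u, and all other components at all times. An increment of B_i after u is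
    still independent of this, so increments of other components can be treated as known
    coefficients. *)
Definition bm_sigma_but (i : 'I_d) u :=
  <<s bm_events (fun j => if j == i then [set v | v <= u] else [set: R]) >>.

Lemma bm_sigma_mono u v : u <= v -> bm_sigma u `<=` bm_sigma v.
Proof.
move=> uv; apply: sigma_subset => A [j [s [Y [s0 su mY ->]]]].
by apply: sub_sigma_algebra; exists j, s, Y; split => //=; exact: le_trans uv.
Qed.

Lemma bm_sigma_sub_but i u : bm_sigma u `<=` bm_sigma_but i u.
Proof.
apply: sigma_subset => A [j [s [Y [s0 su mY ->]]]].
by apply: sub_sigma_algebra; exists j, s, Y; split => //=; case: ifP.
Qed.

Lemma bm_sigma_measurable K : <<s bm_events K >> `<=` measurable.
Proof.
apply: smallest_sub; first exact: sigma_algebra_measurable.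
move=> A [j [s [Y [s0 _ mY ->]]]]; rewrite -[X in measurable X]setTI.
exact: (bm_measurable (hB j)).
Qed.

Lemma process_sigma_measurable J j A : process_sigma J (B j) A -> measurable A.
Proof.
move=> sA; apply: (@bm_sigma_measurable (fun=> [set: R])); move: sA; apply: sigma_subset.
move=> C [u [Y [u0 _ mY ->]]]; apply: sub_sigma_algebra.
by exists j, u, Y.
Qed.

Lemma measurable_incr i s t : 0 <= s -> 0 <= t -> measurable_fun [set: T] (B i t \- B i s).
Proof. by move=> s0 t0; apply: measurable_funB; apply: (bm_measurable (hB i)). Qed.

Lemma process_sigma_incr i s t Y : 0 <= s -> 0 <= t -> measurable Y ->
  process_sigma setT (B i) ((B i t \- B i s) @^-1` Y).
Proof.
move=> s0 t0 mY.
have mB u : 0 <= u -> measurable_fun [set: g_sigma_algebraType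
    [set A | exists u (Y : set R), [/\ 0 <= u, [set: R] u, measurable Y & A = B i u @^-1` Y]]] (B i u).
  by move=> u0 _ Z mZ; rewrite setTI; apply: sub_sigma_algebra; exists u, Z.
have := measurable_funB (mB _ t0) (mB _ s0).
by move=> /(_ measurableT _ mY); rewrite setTI.
Qed.

(** Two finite measures, P restricted to the increment event and P scaled by its probability, agree
    on intersections of one event per component, by independence of the components and of the
    increments of B_i. Such intersections form a pi-system generating the sigma-algebra. *)
Lemma incr_independent i s t A Y : 0 <= s -> s < t -> bm_sigma_but i s A -> measurable Y ->
  P (A `&` (B i t \- B i s) @^-1` Y) = (P A * P ((B i t \- B i s)%R @^-1` Y))%E.
Proof.
move=> s0 st sA mY; have t0 : 0 <= t by rewrite (le_trans s0)// ltW.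
set D := (_ \- _) @^-1` Y.
pose K j : set R := if j == i then [set v | v <= s] else [set: R].
pose G : set (set T) := [set A | exists Aj : 'I_d -> set T,
  (forall j, process_sigma (K j) (B j) (Aj j)) /\ A = \bigcap_j Aj j].
have psK j C : process_sigma (K j) (B j) C -> process_sigma setT (B j) C.
  apply: sigma_subset => E [u [Z [u0 _ mZ ->]]]; apply: sub_sigma_algebra; by exists u, Z.
have mD : measurable D by apply: (@process_sigma_measurable setT i); exact: process_sigma_incr.
have GT : G setT.
  by exists (fun=> setT); split; [move=> j; exact: sigma_setT|rewrite bigcapT].
have mG : G `<=` measurable.
  move=> _ [Aj [sAj ->]]; apply: fin_bigcap_measurable; first exact: finite_finset.
  by move=> j _; exact: process_sigma_measurable (sAj j).
have GI : setI_closed G.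
  move=> _ _ [Aj [sAj ->]] [Cj [sCj ->]]; exists (fun j => Aj j `&` Cj j); split.
    by move=> j; apply: sigma_setI; [exact: sAj|exact: sCj].
  by rewrite bigcapI.
have PD0 : 0 <= fine (P D) by exact: fine_ge0.
pose m1 := mrestr P mD; pose m2 := mscale (NngNum PD0) P.
have PDE : (fine (P D))%:E = P D by rewrite fineK// fin_num_measure.
have m12 C : G C -> m1 C = m2 C.
  move=> [Aj [sAj ->]]; rewrite /m1 /m2 /mrestr /mscale/= PDE.
  pose A' j := if j == i then Aj j `&` D else Aj j.
  have -> : \bigcap_j Aj j `&` D = \bigcap_j A' j.
    apply/seteqP; split => [w [Aw Dw] j _|w Aw].
      by rewrite /A'; case: ifP => _; [split => //|]; exact: Aw.
    have := Aw i I; rewrite /A' eqxx => -[Ai Dw]; split => // j _.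
    by have := Aw j I; rewrite /A'; case: ifP => // _ [].
  rewrite hBind; last first.
    move=> j; rewrite /A'; case: eqP => [->|_]; last exact: psK.
    by apply: sigma_setI; [exact: psK|exact: process_sigma_incr].
  rewrite [in RHS]hBind; last by move=> j; exact: psK.
  rewrite -PDE -EFinM; congr EFin.
  rewrite (bigD1 i)//= [in RHS](bigD1 i)//= /A' eqxx mulrA; congr (_ * _); last first.
    by apply: eq_bigr => j /negbTE ->.
  have := bm_independent (hB i) s0 st _ mY; rewrite -/D => ->.
    by rewrite fineM ?fin_num_measure// 1?mulrC//; exact: process_sigma_measurable (sAj i).
  by have := sAj i; rewrite /K eqxx.
have := @g_sigma_algebra_measure_unique _ _ _ G mG (fun=> setT) (fun=> GT) _ m1 m2 GI m12.
rewrite bigcup_const// => /(_ erefl) h.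
have m1T : (m1 [set: T] < +oo)%E by rewrite /m1 /mrestr/= ltey_eq fin_num_measure// setTI.
suff sGA : <<s G >> A.
  transitivity (m2 A); last by rewrite /m2 /mscale/= PDE muleC.
  exact: (h (fun=> m1T) _ sGA).
move: sA; apply: sigma_subset => C [j [u [Z [u0 Ku mZ ->]]]].
apply: sub_sigma_algebra; exists (fun k => if k == j then B j u @^-1` Z else setT); split.
  move=> k; case: eqP => [->|_]; last exact: sigma_setT.
  by apply: sub_sigma_algebra; exists u, Z.
apply/seteqP; split => [w Zw k _|w h']; first by case: eqP.
by have := h' j I; rewrite eqxx.
Qed.

Lemma incr_expectation i s t (g : R -> R) : 0 <= s -> s < t ->
  (normal_prob 0 (Num.sqrt (t - s))).-integrable [set: R] (EFin \o g) -> measurable_fun [set: R] g ->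
  P.-integrable [set: T] (EFin \o (fun w => g (B i t w - B i s w))) /\
  \int[P]_w g (B i t w - B i s w) = \int[normal_prob 0 (Num.sqrt (t - s))]_x g x.
Proof.
move=> s0 st ig mg; have t0 : 0 <= t by rewrite (le_trans s0)// ltW.
have [||||j1 E] := @normal_law_integral _ _ _ P (Num.sqrt (t - s)) (B i t \- B i s) (EFin \o g) => //.
- exact: measurable_incr.
- exact: (bm_gaussian (hB i)).
- exact/measurable_EFinP.
- by split; [exact: j1|rewrite /Rintegral E].
Qed.

Lemma sqrt_neq0 (s t : R) : s < t -> Num.sqrt (t - s) != 0.
Proof. by rewrite -subr_gt0 => h; rewrite lt0r_neq0// sqrtr_gt0. Qed.

Lemma incr_centered i s t : 0 <= s -> s < t -> centered P (fun w => B i t w - B i s w).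
Proof.
move=> s0 st; have [i1 m1] := normal_moment1 (sqrt_neq0 st).
by have [|j1 E] := @incr_expectation i s t id s0 st i1; last (split => //; rewrite E).
Qed.

Lemma incr_moment2 i s t : 0 <= s -> s < t ->
  P.-integrable [set: T] (EFin \o (fun w => (B i t w - B i s w) ^+ 2)) /\
  \int[P]_w ((B i t w - B i s w) ^+ 2) = t - s.
Proof.
move=> s0 st; have [i1 m1] := normal_moment2 (sqrt_neq0 st).
have [|j1 E] := @incr_expectation i s t (fun x => x ^+ 2) s0 st i1; first exact: measurable_funX.
by split => //; rewrite E m1 sqr_sqrtr// subr_ge0 ltW.
Qed.

Lemma incr_moment4 i s t : 0 <= s -> s < t ->
  P.-integrable [set: T] (EFin \o (fun w => (B i t w - B i s w) ^+ 4)) /\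
  \int[P]_w ((B i t w - B i s w) ^+ 4) <= 3 * (t - s) ^+ 2.
Proof.
move=> s0 st; have [i1 m1] := normal_moment4 (sqrt_neq0 st).
have [|j1 E] := @incr_expectation i s t (fun x => x ^+ 4) s0 st i1; first exact: measurable_funX.
split => //; rewrite E (le_trans m1)// -[4%N]/(2 * 2)%N exprM sqr_sqrtr// subr_ge0 ltW//.
Qed.

Lemma centered_mul_incr i s t (X : T -> R) (g : R -> R) : 0 <= s -> s < t ->
  measurable_fun [set: R] g -> centered P (fun w => g (B i t w - B i s w)) ->
  P.-integrable [set: T] (EFin \o X) ->
  (forall A, measurable A -> bm_sigma_but i s (X @^-1` A)) ->
  centered P (fun w => X w * g (B i t w - B i s w)).
Proof.
move=> s0 st mg [ig g0] iX sX.
have indep A C : measurable A -> measurable C ->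
    P (X @^-1` A `&` (fun w => g (B i t w - B i s w)) @^-1` C) =
    (P (X @^-1` A) * P ((fun w => g (B i t w - B i s w)%R) @^-1` C))%E.
  move=> mA mC.
  have mgC : measurable (g @^-1` C) by have := mg measurableT _ mC; rewrite setTI.
  exact: (@incr_independent i s t _ _ s0 st (sX _ mA) mgC).
have [I1 E] := expectation_mul_indep iX ig indep.
by split => //; rewrite E g0 mulr0.
Qed.

End BrownianFamily.

(** * Running maxima on a grid *)

Section RunningMaximum.
Context {R : realType}.
Implicit Types (y : nat -> R) (b : R -> R).

Fixpoint run_max y k := if k is k'.+1 then Num.max (run_max y k') (y k) else Num.max 0 (y 0%N).

Lemma run_max_ge0 y k : 0 <= run_max y k.
Proof. by elim: k => [|k IH] /=; rewrite le_max ?lexx ?IH. Qed.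

Lemma run_max_ge y j k : (j <= k)%N -> y j <= run_max y k.
Proof.
elim: k => [|k IH] /=; first by rewrite leqn0 => /eqP ->; rewrite le_max lexx orbT.
by rewrite leq_eqVlt => /predU1P[->|/IH h]; rewrite le_max ?lexx ?orbT// h.
Qed.

Lemma run_max_le y k M : 0 <= M -> (forall j, (j <= k)%N -> y j <= M) -> run_max y k <= M.
Proof.
move=> M0; elim: k => [|k IH] h /=; rewrite ge_max; first by rewrite M0 h.
by rewrite IH ?h// => j jk; apply: h; exact: leqW.
Qed.

(* Pathwise form of Doob's L2 inequality: the sum is a discrete stochastic
   integral, so its expectation vanishes when [y] is a martingale. *)
Lemma run_max_sqr y n :
  run_max y n ^+ 2 <= 4 * y n ^+ 2 - 4 * \sum_(k < n) run_max y k * (y k.+1 - y k).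
Proof.
have h : \sum_(k < n) run_max y k * (y k.+1 - y k) <= run_max y n * y n - 2^-1 * run_max y n ^+ 2.
  elim: n => [|n IH].
    by rewrite big_ord0 /= /Num.max; case: ltP => h; nra.
  rewrite big_ord_recr/=.
  move: IH; set s := \sum_(k < n) _ => IH; have m0 := run_max_ge0 y n.
  move: IH m0; move: (run_max y n) (y n) (y n.+1) => m a c IH m0.
  rewrite /Num.max; case: ltP => h; last by nra.
  by have := sqr_ge0 (c - m); nra.
have := sqr_ge0 (run_max y n - 2 * y n); nra.
Qed.

Lemma cvg_run_max b N : 0 < N -> continuous b ->
  run_max (fun k => - b (k%:R * (N / n.+1%:R))) n.+1 @[n --> \oo] --> pushing b N.
Proof.
move=> N0 cb; rewrite /pushing max_r ?ltW//.
rewrite (_ : (fun n => _) = (fun n => - Num.min 0 (\big[Num.min/b 0]_(k < n.+1) b (k.+1%:R * (N / n.+1%:R))))).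
  have mE (x : R) : Num.min 0 x = (x - `|x|) / 2.
    by rewrite /Num.min; case: ltP => x0; [rewrite gtr0_norm|rewrite ler0_norm]; lra.
  under eq_fun do rewrite mE.
  rewrite mE; apply: cvgN; apply: cvgMl.
  by apply: cvgB; [|apply: cvg_norm]; exact: (cvg_grid_min (ltW N0) cb).
apply/funext => n; set m := \big[_/_]_(k < _) _.
apply/eqP; rewrite eq_le; apply/andP; split.
  apply: run_max_le; first by rewrite oppr_ge0 ge_min lexx.
  move=> [|j] jn; rewrite lerN2 ge_min; apply/orP; right.
    by rewrite mul0r; exact: bigmin_le_id.
  exact: (@bigmin_le_cond _ _ 'I_n.+1 (b 0) (Ordinal jn) xpredT (fun k => b (k.+1%:R * (N / n.+1%:R)))).
rewrite lerNl le_min oppr_le0 run_max_ge0; apply/bigmin_geP; split.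
  rewrite lerNl; have := @run_max_ge (fun k => - b (k%:R * (N / n.+1%:R))) 0%N n.+1 isT.
  by rewrite mul0r.
by move=> k _; rewrite lerNl; apply: (@run_max_ge (fun k => - b (k%:R * (N / n.+1%:R))) k.+1); exact: ltn_ord.
Qed.

End RunningMaximum.

Section BrownianPaths.
Context {R : realType} {d : nat} {disp : measure_display} {T : measurableType disp}.
Variables (P : probability T R) (r : 'rV[R]_d) (B : 'I_d -> R -> T -> R).
Hypotheses (hB : forall i, brownian_motion P (r 0 i) (B i))
  (hBind : independent_processes P B).

(* Paths are extended to negative times by their initial value, so that they
   are continuous on the whole line. *)
Definition bm_path w i v : R := B i (Num.max 0 v) w.

Lemma continuous_bm_path w i : continuous (bm_path w i).
Proof.
move=> t; apply/cvgrPdist_lt => e e0.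
have m0 : `[0, +oo[%classic (Num.max 0 t) by rewrite /= in_itv/= le_max lexx.
have := (subspace_continuousP _ _).1 (bm_continuous (hB i) (w := w)) _ m0.
move=> /cvgrPdist_lt/(_ _ e0).
rewrite /within/= => -[s /= s0 sP]; exists s => // u /= tu.
apply: sP => /=; last by rewrite in_itv/= le_max lexx.
apply: le_lt_trans tu.
move: (leP 0 t) (leP 0 u) => [t0|t0] [u0|u0] //.
- by rewrite !ger0_norm; lra.
- by rewrite !ler0_norm; lra.
- by rewrite subrr normr0.
Qed.

Local Notation X w := (reflected_path (bm_path w)).
Local Notation sT K := (g_sigma_algebraType (bm_events B K)).

Lemma measurable_bm_sigma dZ (Z : measurableType dZ) K (f : T -> Z) :
  measurable_fun [set: sT K] f -> measurable_fun [set: T] f.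
Proof.
move=> mf _ Y mY; rewrite setTI; apply: (bm_sigma_measurable hB (K := K)).
by have := mf measurableT _ mY; rewrite setTI.
Qed.

Lemma measurable_bm K j u : 0 <= u -> K j u -> measurable_fun [set: sT K] (B j u).
Proof.
move=> u0 Ku _ Y mY; rewrite setTI; apply: sub_sigma_algebra.
by exists j, u, Y.
Qed.

Lemma measurable_bm_path K j u : (forall v, 0 <= v <= Num.max 0 u -> K j v) ->
  measurable_fun [set: sT K] (fun w => bm_path w j u).
Proof.
move=> Ku; apply: measurable_bm; first by rewrite le_max lexx.
by apply: Ku; rewrite le_max !lexx.
Qed.

Lemma measurable_path_coord u i : 0 <= u ->
  measurable_fun [set: sT (fun=> [set v | v <= u])] (fun w => X w u 0 i).
Proof.
move=> u0.
rewrite (_ : (fun w => _) = (fun w => reflected (fun v => bm_path w i v) u)); last first.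
  by apply/funext => w; rewrite mxE.
apply: (@measurable_reflected R _ (sT (fun=> [set v | v <= u])) u (fun v w => bm_path w i v)) => //.
  move=> v /andP[v0 vu]; apply: measurable_bm_path => s /andP[_].
  by rewrite max_r//= => /le_trans; exact.
by move=> w; exact: continuous_bm_path.
Qed.

Lemma measurable_path_fun u (g : 'rV[R]_d -> R) : 0 <= u ->
  (forall y, orthant y -> y != 0 -> {for y, continuous g}) ->
  measurable_fun [set: sT (fun=> [set v | v <= u])] (fun w => g (X w u)).
Proof.
move=> u0 cg; apply: (@measurable_orthant_fun _ _ (sT _)) => //.
  by move=> i; exact: measurable_path_coord.
by move=> w; apply: orthant_path => // i; exact: continuous_bm_path.
Qed.

Lemma measurable_path_pushing (c u : R) i : 0 <= u ->
  measurable_fun [set: sT (fun=> [set v | v <= u])] (fun w => pushing (fun s => c * bm_path w i s) u).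
Proof.
move=> u0.
apply: (@measurable_pushing R _ (sT (fun=> [set v | v <= u])) u (fun v w => c * bm_path w i v)) => //.
  move=> v /andP[v0 vu]; apply: measurable_funM => //; apply: measurable_bm_path => s /andP[_].
  by rewrite max_r//= => /le_trans; exact.
by move=> w s; apply: cvgMr; exact: continuous_bm_path.
Qed.

Lemma bm_path_pos w i u : 0 <= u -> bm_path w i u = B i u w.
Proof. by move=> u0; rewrite /bm_path max_r. Qed.

Lemma bm_path_moment2 i u : 0 <= u ->
  mean_le P (fun w => bm_path w i u ^+ 2) (2 * (r 0 i ^+ 2 + u)).
Proof.
move=> u0.
rewrite (_ : (fun w => _) = (fun w => B i u w ^+ 2)); last by apply/funext => w; rewrite bm_path_pos.
have r2 := sqr_ge0 (r 0 i).
have mB : measurable_fun [set: T] (fun w => B i u w ^+ 2).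
  by apply: measurable_funX; exact: (bm_measurable (hB i)).
have mc := mean_le_cst P (2 * r 0 i ^+ 2).
move: (u0); rewrite le_eqVlt => /predU1P[E|ugt0].
  rewrite (_ : 2 * _ = 2 * r 0 i ^+ 2); last by rewrite -E addr0.
  apply: mean_le_dominated mc => // w; first exact: sqr_ge0.
  by rewrite -E (bm_start (hB i)); lra.
have [i2 m2] := incr_moment2 hB i (lexx 0) ugt0.
have mi : mean_le P (fun w => (B i u w - B i 0 w) ^+ 2) u by split; rewrite ?m2 ?subr0.
have := mean_leD mc (mean_leZ (ler0n _ 2) mi); rewrite -mulrDr; apply: mean_le_dominated => // w.
  exact: sqr_ge0.
rewrite (bm_start (hB i)); have := sqr_ge0 (B i u w - 2 * r 0 i); lra.
Qed.

Lemma bm_path_integrable i u : 0 <= u -> P.-integrable [set: T] (EFin \o (fun w => bm_path w i u)).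
Proof.
move=> u0; apply: (integrable_le (g := fun w => 1 + bm_path w i u ^+ 2)).
- apply: (@measurable_bm_sigma _ _ (fun=> [set: R])); exact: measurable_bm_path.
- move=> w; rewrite -(real_normK (num_real (bm_path w i u))).
  by have := sqr_ge0 (`|bm_path w i u| - 1); have := normr_ge0 (bm_path w i u); nra.
apply: (@integrableD _ _ _ P _ _ (EFin \o cst 1) (EFin \o (fun w => bm_path w i u ^+ 2))) => //.
  exact: finite_measure_integrable_cst.
exact: (bm_path_moment2 i u0).1.
Qed.

Lemma integrable_run_max (y : nat -> T -> R) k : (forall j, (j <= k)%N -> P.-integrable [set: T] (EFin \o y j)) ->
  P.-integrable [set: T] (EFin \o (fun w => run_max (y ^~ w) k)).
Proof.
have mx (f g : T -> R) : P.-integrable [set: T] (EFin \o f) -> P.-integrable [set: T] (EFin \o g) ->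
    P.-integrable [set: T] (EFin \o (fun w => Num.max (f w) (g w))).
  move=> iF ig; apply: (integrable_le (g := fun w => `|f w| + `|g w|)).
  - by apply: measurable_maxr; apply/measurable_EFinP; [exact: measurable_int iF|exact: measurable_int ig].
  - move=> w; rewrite /Num.max; case: ifP => _; [by rewrite lerDr|by rewrite lerDl].
  - exact: (integrableD measurableT (integrable_abse iF) (integrable_abse ig)).
elim: k => [|k IH] iy /=.
  by apply: (mx (cst 0) (y 0%N)); [exact: finite_measure_integrable_cst|exact: iy].
apply: (mx (fun w => run_max (y ^~ w) k)); last exact: iy.
by apply: IH => j jk; apply: iy; exact: leqW.
Qed.

Lemma measurable_run_max dU (U : measurableType dU) (y : nat -> U -> R) k :
  (forall j, (j <= k)%N -> measurable_fun [set: U] (y j)) ->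
  measurable_fun [set: U] (fun w => run_max (y ^~ w) k).
Proof.
elim: k => [|k IH] my /=; first by apply: measurable_maxr => //; exact: my.
apply: measurable_maxr; last exact: my.
by apply: IH => j jk; apply: my; exact: leqW.
Qed.

(** Doob's L2 inequality for c b with c = 1 or -1: the discrete stochastic integral in [run_max_sqr]
    is centered, and Fatou's lemma passes from the grids to [0, N]. The 8 is Doob's 4 times the 2 of
    [bm_path_moment2]. *)
Lemma pushing_moment2 (c : R) i N : c ^+ 2 = 1 -> 0 < N ->
  mean_le P (fun w => pushing (fun s => c * bm_path w i s) N ^+ 2) (8 * (r 0 i ^+ 2 + N)).
Proof.
move=> c2 N0.
pose h n := N / n.+1%:R : R.
have h0 n : 0 < h n by rewrite divr_gt0.
have kh0 n k : 0 <= k%:R * h n by rewrite mulr_ge0// ltW.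
have khlt n k : k%:R * h n < k.+1%:R * h n by rewrite ltr_pM2r// ltr_nat.
pose y n k w := - (c * bm_path w i (k%:R * h n)).
have iy n k : P.-integrable [set: T] (EFin \o y n k).
  rewrite (_ : EFin \o _ = EFin \o (fun w => (- c) * bm_path w i (k%:R * h n))).
    exact: (integrableZl measurableT (- c) (bm_path_integrable i (kh0 n k))).
  by apply/funext => w; rewrite /y /= mulNr.
have cent n k : centered P (fun w => run_max (y n ^~ w) k * (y n k.+1 w - y n k w)).
  have E w : y n k.+1 w - y n k w = - c * (B i (k.+1%:R * h n) w - B i (k%:R * h n) w).
    by rewrite /y !bm_path_pos//; ring.
  under eq_fun do rewrite E.
  apply: (centered_mul_incr hB hBind (i := i) (s := k%:R * h n) (t := k.+1%:R * h n) (g := fun x => - c * x)) => //.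
  - exact: measurable_funM.
  - by apply: centeredZ; exact: (incr_centered hB i (kh0 n k) (khlt n k)).
  - by apply: integrable_run_max => j _; exact: iy.
  - move=> A mA; apply: bm_sigma_sub_but.
    have : measurable_fun [set: sT (fun=> [set v | v <= k%:R * h n])] (fun w => run_max (y n ^~ w) k).
      apply: (@measurable_run_max _ (sT _)) => j jk; apply: measurableT_comp => //; apply: measurable_funM => //.
      apply: measurable_bm_path => v /andP[_]; rewrite max_r//= => /le_trans; apply.
      by rewrite ler_pM2r// ler_nat.
    by move=> /(_ measurableT _ mA); rewrite setTI.
pose Y n w := 4 * bm_path w i N ^+ 2 + (- 4) * \sum_(k < n.+1) run_max (y n ^~ w) k * (y n k.+1 w - y n k w).
have [iN mN] := bm_path_moment2 i (ltW N0).
have csum n := centeredZ (-4) (centered_sum (fun k : 'I_n.+1 => cent n k)).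
have iY n : P.-integrable [set: T] (EFin \o Y n).
  exact: (integrableD measurableT (integrableZl measurableT 4 iN) (csum n).1).
have EY n : \int[P]_w Y n w <= 8 * (r 0 i ^+ 2 + N).
  rewrite /Y RintegralD//; [|exact: (integrableZl measurableT 4 iN)|exact: (csum n).1].
  by rewrite (csum n).2 addr0 RintegralZl//; move: mN; lra.
have le n w : run_max (y n ^~ w) n.+1 ^+ 2 <= Y n w.
  apply: (le_trans (run_max_sqr _ _)).
  have -> : y n n.+1 w ^+ 2 = bm_path w i N ^+ 2.
    by rewrite /y sqrrN exprMn c2 mul1r /h mulrC divfK.
  by rewrite /Y mulNr.
have irm n : P.-integrable [set: T] (EFin \o (fun w => run_max (y n ^~ w) n.+1 ^+ 2)).
  apply: (integrable_le _ _ (iY n)).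
    apply: measurable_funX; apply: measurable_run_max => j _.
    by apply/measurable_EFinP; exact: measurable_int (iy n j).
  by move=> w; rewrite ger0_norm ?sqr_ge0.
apply: (fatou_Rintegral (f_ := fun n w => run_max (y n ^~ w) n.+1 ^+ 2)) => //.
- by move=> n w; exact: sqr_ge0.
- move=> w; apply: (@continuous_cvg _ _ _ \oo _ (fun n => run_max (y n ^~ w) n.+1) (fun x : R => x ^+ 2)); first exact: exprn_continuous.
  apply: (@cvg_run_max _ (fun s => c * bm_path w i s)) => //.
  by move=> s; apply: cvgMr; exact: continuous_bm_path.
- by move=> n; apply: le_trans (EY n); exact: le_Rintegral_setT.
Qed.

(** Cauchy-Schwarz over the d components and (x + y)^2 <= 2 x^2 + 2 y^2 for the two signs turn two
    bounds with factor 8 into 32 d. *)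
Lemma path_bound_moment2 N : 0 < N ->
  mean_le P (fun w => path_bound (bm_path w) N ^+ 2) (32 * d%:R * \sum_i (r 0 i ^+ 2 + N)).
Proof.
move=> N0.
pose L (c : R) i w := pushing (fun s => c * bm_path w i s) N.
have SE w : path_bound (bm_path w) N = \sum_i (L 1 i w + L (-1) i w).
  apply: eq_bigr => i _; congr (_ + _); congr (pushing _ N); apply/funext => s.
    by rewrite mul1r.
  by rewrite mulN1r.
have m1 i : mean_le P (fun w => L 1 i w ^+ 2) (8 * (r 0 i ^+ 2 + N)).
  by apply: (@pushing_moment2 1 i N) => //; rewrite expr1n.
have m2 i : mean_le P (fun w => L (-1) i w ^+ 2) (8 * (r 0 i ^+ 2 + N)).
  by apply: (@pushing_moment2 (-1) i N) => //; rewrite sqrrN expr1n.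
have m3 := mean_leZ (c := d%:R * 2) _ (mean_le_sum (fun i => mean_leD (m1 i) (m2 i))).
have mL c i : measurable_fun [set: T] (L c i).
  apply: (@measurable_bm_sigma _ _ (fun=> [set v | v <= N])).
  by apply: measurable_path_pushing; exact: ltW.
suff : mean_le P (fun w => path_bound (bm_path w) N ^+ 2)
   (d%:R * 2 * (\sum_i (8 * (r 0 i ^+ 2 + N) + 8 * (r 0 i ^+ 2 + N)))).
  rewrite (_ : _ * _ * _ = 32 * d%:R * \sum_i (r 0 i ^+ 2 + N))//.
  rewrite big_split/= -mulr_sumr; ring.
apply: mean_le_dominated (m3 _) => //.
- under eq_fun do rewrite SE.
  by apply: measurable_funX; apply: measurable_sum => i; apply: measurable_funD.
- by move=> w; exact: sqr_ge0.
- move=> w; rewrite SE (le_trans (sqr_sum_le _))// card_ord -mulrA ler_wpM2l// mulr_sumr.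
  apply: ler_sum => i _; have := sqr_ge0 (L 1 i w - L (-1) i w); lra.
Qed.

End BrownianPaths.

(** * Dynkin's formula *)

Section Dynkin.
Context {R : realType} {d : nat} {disp : measure_display} {T : measurableType disp}.
Variables (P : probability T R) (r : 'rV[R]_d) (B : 'I_d -> R -> T -> R).
Hypotheses (hB : forall i, brownian_motion P (r 0 i) (B i))
  (hBind : independent_processes P B).
Variables (delta C : R) (G : 'rV[R]_d -> R) (p : 'I_d -> 'rV[R]_d -> R)
  (q : 'I_d -> 'I_d -> 'rV[R]_d -> R).
Hypotheses (delta0 : 0 < delta) (nd : neumann_data delta C G p q).

Local Notation b := (bm_path B).
Local Notation X w := (reflected_path (bm_path B w)).
Local Notation sT K := (g_sigma_algebraType (bm_events B K)).

Variables (N : R) (J : R -> set T) (a e : T -> R).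
Hypotheses (N0 : 0 < N) (sJ : forall u, 0 <= u <= N -> bm_sigma B u (J u))
  (ae : forall w, 0 <= a w <= e w /\ e w <= N)
  (JP : forall u w, 0 <= u <= N -> J u w <-> a w < u <= e w)
  (aeX : forall u w, a w < u <= e w -> delta <= norm1 (X w u)).

Let z w u : R := \1_(J u) w.
Let h n : R := N / n.+1%:R.

Let zE w u : 0 <= u <= N -> z w u = (a w < u <= e w)%R%:R.
Proof.
move=> uN; rewrite /z indicE; have [du|du] := boolP (a w < u <= e w).
  by rewrite mem_set//; apply/(JP w uN).
by rewrite memNset// => /(JP w uN); apply/negP.
Qed.

Let cb w i : continuous (b w i). Proof. exact: continuous_bm_path. Qed.

Let h0 n : 0 < h n. Proof. by rewrite divr_gt0. Qed.

Let kh0 n k : 0 <= k%:R * h n. Proof. by rewrite mulr_ge0// ltW. Qed.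

Let khlt n k : k%:R * h n < k.+1%:R * h n.
Proof. by rewrite ltr_pM2r// ltr_nat. Qed.

Let khN n (k : 'I_n.+1) : 0 <= k%:R * h n <= N.
Proof. by apply: grid_in; [exact: ltW|exact: ltnW]. Qed.

Let mz u : 0 <= u <= N -> measurable_fun [set: sT (fun=> [set v | v <= u])] (fun w => z w u).
Proof. by move=> uN; apply: (@measurable_indic _ (sT (fun=> [set v | v <= u]))); exact: sJ. Qed.

Let msT K f : measurable_fun [set: sT K] f -> measurable_fun [set: T] (f : T -> R) :=
  @measurable_bm_sigma _ _ _ _ _ _ _ hB _ _ K f.

(** The indicator confines the path to |X| >= delta, where the derivatives are at most C, and it is
    known at time u; so it yields bounded coefficients that are independent of the next
    increment. *)
Lemma stopped_bounded u (g : 'rV[R]_d -> R) : 0 <= u <= N ->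
  (forall x, orthant x -> delta <= norm1 x -> `|g x| <= C) ->
  (forall y, orthant y -> y != 0 -> {for y, continuous g}) ->
  [/\ P.-integrable [set: T] (EFin \o (fun w => z w u * g (X w u))),
   measurable_fun [set: sT (fun=> [set v | v <= u])] (fun w => z w u * g (X w u)) &
   forall w, `|z w u * g (X w u)| <= C].
Proof.
move=> uN gC cg; have u0 : 0 <= u by case/andP: uN.
have m : measurable_fun [set: sT (fun=> [set v | v <= u])] (fun w => z w u * g (X w u)).
  by apply: measurable_funM; [exact: mz|exact: (measurable_path_fun hB)].
have le w : `|z w u * g (X w u)| <= C.
  rewrite zE//; have [du|_] := boolP (a w < u <= e w); last first.
    by rewrite mul0r normr0; exact: (neumann_const_ge0 nd).
  rewrite mul1r; apply: gC; last exact: aeX.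
  by apply: orthant_path => // i; exact: cb.
split => //; apply: (integrable_le (msT m) le).
exact: finite_measure_integrable_cst.
Qed.

Let dB n k i w := B i (k.+1%:R * h n) w - B i (k%:R * h n) w.

Let dBE n k i w : b w i (k.+1%:R * h n) - b w i (k%:R * h n) = dB n k i w.
Proof. by rewrite !bm_path_pos. Qed.

Lemma stopped_incr_centered n (k : 'I_n.+1) i :
  centered P (fun w => z w (k%:R * h n) * p i (X w (k%:R * h n)) * dB n k i w).
Proof.
have [iz mz' _] := stopped_bounded (khN k) ((nd_boundp nd) i) ((nd_contp nd) i).
apply: (centered_mul_incr hB hBind (g := id)) => //; first exact: incr_centered.
move=> A mA; apply: bm_sigma_sub_but.
by have := mz' measurableT _ mA; rewrite setTI.
Qed.

(** On the diagonal the squared increment has mean h. Off the diagonal the increment of B_j joins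
    the coefficient, as it is known to [bm_sigma_but i], and the increment of B_i integrates to
    0. *)
Lemma stopped_quad_centered n (k : 'I_n.+1) i j :
  centered P (fun w => z w (k%:R * h n) * q i j (X w (k%:R * h n)) *
    (dB n k i w * dB n k j w - (i == j)%:R * h n)).
Proof.
have [iz mz' zC] := stopped_bounded (khN k) ((nd_boundq nd) i j) ((nd_contq nd) i j).
have tE : k.+1%:R * h n - k%:R * h n = h n by rewrite -natr1 mulrDl mul1r addrAC subrr add0r.
have mA' A : measurable A -> bm_sigma B (k%:R * h n) ((fun w => z w (k%:R * h n) * q i j (X w (k%:R * h n))) @^-1` A).
  by move=> mA; have := mz' measurableT _ mA; rewrite setTI.
have [ij|ij] := eqVneq i j.
  rewrite -ij in zC mA' iz *.
  have [i2 m2] := incr_moment2 hB i (kh0 n k) (khlt n k).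
  under eq_fun do rewrite mul1r.
  apply: (centered_mul_incr hB hBind (g := fun x => x ^+ 2 - h n) (kh0 n k) (khlt n k)) => //.
  - by apply: measurable_funB => //; exact: measurable_funX.
  - split.
      exact: (integrableB measurableT i2 (mean_le_cst P (h n)).1).
    rewrite RintegralB//; last exact: finite_measure_integrable_cst.
    rewrite [Y in Y - _]m2 tE.
    have [_ E] := (mean_le_cst P (h n)).
    rewrite Rintegral_cst//; set x := fine _.
    have -> : x = 1 by exact: (congr1 fine (probability_setT P)).
    by rewrite mulr1 subrr.
  - by move=> A /mA'; exact: bm_sigma_sub_but.
under eq_fun do rewrite mul0r subr0 mulrCA mulrC -mulrA -/(dB _ _ _ _).
rewrite (_ : (fun w => _) = (fun w => z w (k%:R * h n) * q i j (X w (k%:R * h n)) * dB n k j w * dB n k i w)); last first.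
  by apply/funext => w; ring.
apply: (centered_mul_incr hB hBind (g := id) (kh0 n k) (khlt n k)) => //; first exact: incr_centered.
  have [id _] := incr_centered hB j (kh0 n k) (khlt n k).
  apply: (integrable_le (g := fun w => C * `|dB n k j w|)).
  - by apply: measurable_funM; [exact: msT mz'|exact: (measurable_incr hB)].
  - by move=> w; rewrite normrM ler_wpM2r.
  - exact: (integrableZl measurableT C (integrable_abse id)).
move=> A mA.
pose K l : set R := if l == i then [set v | v <= k%:R * h n] else [set: R].
have : measurable_fun [set: sT K] (fun w => z w (k%:R * h n) * q i j (X w (k%:R * h n)) * dB n k j w).
  apply: measurable_funM.
    move=> _ Y mY; rewrite setTI; apply: bm_sigma_sub_but; exact: mA'.
  apply: (@measurable_funB _ (sT K)); apply: measurable_bm => //; by rewrite /K eq_sym (negbTE ij).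
by move=> /(_ measurableT _ mA); rewrite setTI.
Qed.

Lemma ito_error_split n w : ito_error G p q (b w) N (z w) n =
  ito_sum G q (b w) N (z w) n +
  ((-1) * \sum_(k < n.+1) \sum_i z w (k%:R * h n) * p i (X w (k%:R * h n)) * dB n k i w +
  (- 2^-1) * \sum_(k < n.+1) \sum_i \sum_j z w (k%:R * h n) * q i j (X w (k%:R * h n)) *
    (dB n k i w * dB n k j w - (i == j)%:R * h n)).
Proof.
rewrite /ito_error /ito_sum -/(h n) !mulr_sumr -!big_split/=; apply: eq_bigr => k _.
have E1 : \sum_i z w (k%:R * h n) * p i (X w (k%:R * h n)) * dB n k i w =
    z w (k%:R * h n) * \sum_i p i (X w (k%:R * h n)) * (b w i (k.+1%:R * h n) - b w i (k%:R * h n)).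
  by rewrite mulr_sumr; apply: eq_bigr => i _; rewrite dBE mulrA.
have E2 : \sum_i \sum_j z w (k%:R * h n) * q i j (X w (k%:R * h n)) *
    (dB n k i w * dB n k j w - (i == j)%:R * h n) =
   z w (k%:R * h n) * \sum_i \sum_j q i j (X w (k%:R * h n)) *
     (b w i (k.+1%:R * h n) - b w i (k%:R * h n)) * (b w j (k.+1%:R * h n) - b w j (k%:R * h n)) -
   z w (k%:R * h n) * \sum_i q i i (X w (k%:R * h n)) * h n.
  rewrite -mulrBr -sumrB mulr_sumr; apply: eq_bigr => i _.
  have -> : q i i (X w (k%:R * h n)) * h n = \sum_j q i j (X w (k%:R * h n)) * ((i == j)%:R * h n).
    rewrite (bigD1 i)//= eqxx mul1r big1 ?addr0// => j /negbTE; rewrite eq_sym => ->.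
    by rewrite mul0r mulr0.
  rewrite -sumrB mulr_sumr; apply: eq_bigr => j _; rewrite !dBE; ring.
by rewrite E1 E2; ring.
Qed.

(** Cauchy-Schwarz over the (n + 1) d increments, whose fourth moments are at most 3 h^2. Since (n +
    1) h = N, the bound does not depend on n. *)
Lemma quad_var_moment2 n :
  mean_le P (fun w => quad_var (b w) N n ^+ 2) (3 * (d%:R * N) ^+ 2).
Proof.
have m4 (k : 'I_n.+1) i : mean_le P (fun w => dB n k i w ^+ 4) (3 * h n ^+ 2).
  have tE : k.+1%:R * h n - k%:R * h n = h n by rewrite -natr1 mulrDl mul1r addrAC subrr add0r.
  by have := incr_moment4 hB i (kh0 n k) (khlt n k); rewrite tE.
have mQ := mean_leZ (c := n.+1%:R * d%:R) _ (mean_le_sum (fun k => mean_le_sum (fun i => m4 k i))).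
rewrite (_ : 3 * _ = n.+1%:R * d%:R * \sum_(k < n.+1) \sum_(i < d) (3 * h n ^+ 2)); last first.
  have -> : \sum_(k < n.+1) \sum_(i < d) (3 * h n ^+ 2) = n.+1%:R * (d%:R * (3 * h n ^+ 2)).
    by rewrite !sumr_const !card_ord !mulr_natl.
  have -> : N = n.+1%:R * h n by rewrite mulrC divfK.
  by move: (h n) (n.+1%:R) (d%:R) => x y t; ring.
apply: mean_le_dominated (mQ _) => //.
- apply: measurable_funX; apply: measurable_sum => k; apply: measurable_sum => i.
  by apply: measurable_funX; under eq_fun do rewrite dBE; exact: (measurable_incr hB).
- by move=> w; exact: sqr_ge0.
- move=> w; rewrite (le_trans (sqr_sum_le _))// card_ord -mulrA ler_wpM2l// mulr_sumr.
  apply: ler_sum => k _; rewrite (le_trans (sqr_sum_le _))// card_ord ler_wpM2l//.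
  by apply: ler_sum => i _; rewrite -exprM dBE.
Qed.

Lemma measurable_ito_sum n : measurable_fun [set: T] (fun w => ito_sum G q (b w) N (z w) n).
Proof.
apply: measurable_sum => k.
have [k1 /andP[k2 k3]] : 0 <= k%:R * h n /\ 0 <= k.+1%:R * h n <= N.
  by rewrite kh0; split => //; exact: (@grid_in _ N n k.+1 (ltW N0) (ltn_ord k)).
apply: measurable_funM; first exact: msT (mz (khN k)).
apply: measurable_funB.
  by apply: measurable_funB; apply: msT; apply: (measurable_path_fun hB) => //; exact: (nd_contG nd).
apply: measurable_funM => //; apply: measurable_sum => i; apply: measurable_funM => //.
by apply: msT; apply: (measurable_path_fun hB) => //; exact: (nd_contq nd).
Qed.

Let mart n w := (-1) * (\sum_(k < n.+1) \sum_i z w (k%:R * h n) * p i (X w (k%:R * h n)) * dB n k i w) +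
  (- 2^-1) * \sum_(k < n.+1) \sum_i \sum_j z w (k%:R * h n) * q i j (X w (k%:R * h n)) *
    (dB n k i w * dB n k j w - (i == j)%:R * h n).

Let mart_centered n : centered P (mart n).
Proof.
apply: centeredD; apply: centeredZ; apply: centered_sum => k; apply: centered_sum => i.
  exact: stopped_incr_centered.
by apply: centered_sum => j; exact: stopped_quad_centered.
Qed.

Let S w := path_bound (b w) N.
Let Q n w := quad_var (b w) N n.
Let err n w := ito_error G p q (b w) N (z w) n.
Let W_gt0 n w : 0 < 1 + S w ^+ 2 + Q n w.
Proof.
have := sqr_ge0 (S w); have : 0 <= Q n w by exact: quad_var_ge0.
by lra.
Qed.

Let mS : mean_le P (fun w => S w ^+ 2) (32 * d%:R * \sum_i (r 0 i ^+ 2 + N)).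
Proof. exact: (path_bound_moment2 hB hBind). Qed.

Let measurable_err n : measurable_fun [set: T] (err n).
Proof.
rewrite /err; under eq_fun do rewrite ito_error_split.
apply: measurable_funD; first exact: measurable_ito_sum.
by apply/measurable_EFinP; exact: measurable_int (mart_centered n).1.
Qed.

Let Q2 n := quad_var_moment2 n.

Let iQ n : mean_le P (Q n) (1 + 3 * (d%:R * N) ^+ 2).
Proof.
apply: mean_le_dominated (mean_leD (mean_le_cst P 1) (Q2 n)).
- apply: measurable_sum => k; apply: measurable_sum => i.
  by apply: measurable_funX; under eq_fun do rewrite dBE; exact: (measurable_incr hB).
- by move=> w; exact: quad_var_ge0.
- by move=> w; rewrite -/(Q n w); have := sqr_ge0 (Q n w - 2^-1); lra.
Qed.

Let K := C * (9 + 2 * d%:R).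

Let err_bound n w : `|err n w| <= K * (1 + S w ^+ 2 + Q n w).
Proof. by apply: (ito_error_bound nd (@cb w) N0 (@zE w)) => u; exact: aeX. Qed.

Let K0 : 0 <= K.
Proof. by rewrite mulr_ge0 ?(neumann_const_ge0 nd)// addr_ge0. Qed.

(* On the exceptional event the quadratic variation is not dominated, and is
   split off by [K Q <= (K^2 / l + l Q^2) / 2]. *)
Lemma ito_error_mean (l : R) : 0 < l -> exists M : R, forall rho, 0 < rho ->
  \forall n \near \oo, \int[P]_w `|err n w| <= rho * M + rho + l * (3 * (d%:R * N) ^+ 2).
Proof.
move=> l0.
have := mS; set KS := 32 * d%:R * _ => mS'.
exists (1 + KS + (1 + 3 * (d%:R * N) ^+ 2)) => rho rho0.
(* On each path this event fails for all large n by [ito_error_small]. So the part [U] of the bound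
   that is free of Q tends to 0 in mean by dominated convergence. *)
pose A n : set T := [set w | rho * (1 + S w ^+ 2 + Q n w) < `|err n w|].
have mSQ n : measurable_fun [set: T] (fun w => 1 + S w ^+ 2 + Q n w).
  apply: measurable_funD; last by apply/measurable_EFinP; exact: measurable_int (iQ n).1.
  by apply: measurable_funD => //; apply/measurable_EFinP; exact: measurable_int mS'.1.
have mabs n : measurable_fun [set: T] (fun w => `|err n w|) by apply: measurableT_comp.
have mA n : measurable (A n).
  rewrite -[A n]setTI.
  by apply: (measurable_fun_ltr (measurable_funM (measurable_cst rho) (mSQ n)) (mabs n) measurableT (Y := [set true])).
pose U n w := (K * (1 + S w ^+ 2) + K ^+ 2 / l) * \1_(A n) w.
have iU0 : P.-integrable [set: T] (EFin \o (fun w => K * (1 + S w ^+ 2) + K ^+ 2 / l)).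
  exact: (mean_leD (mean_leZ K0 (mean_leD (mean_le_cst P 1) mS')) (mean_le_cst P (K ^+ 2 / l))).1.
have U0 w : 0 <= K * (1 + S w ^+ 2) + K ^+ 2 / l.
  by rewrite addr_ge0 ?divr_ge0 ?sqr_ge0 ?(ltW l0)// mulr_ge0// addr_ge0// sqr_ge0.
have mU n : measurable_fun [set: T] (U n).
  apply: measurable_funM; last exact: measurable_indic.
  by apply/measurable_EFinP; exact: measurable_int iU0.
have UC n w : `|U n w| <= K * (1 + S w ^+ 2) + K ^+ 2 / l.
  rewrite normrM (ger0_norm (U0 w)) indicE; case: (_ \in _); last by rewrite normr0 mulr0.
  by rewrite normr1 mulr1.
have cU w : U n w @[n --> \oo] --> (0 : R).
  have [n0 n0P] := ito_error_small delta0 nd (@cb w) N0 (@zE w) (fun u => @aeX u w) rho0.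
  apply: cvg_near_cst; exists n0 => // n /= /n0P le.
  by rewrite /U indicE memNset ?mulr0//= /A/=; apply/negP; rewrite -leNgt.
have [_] := cvg_Rintegral mU cU UC iU0.
rewrite Rintegral_cst// mul0r => /cvgrPdist_lt/(_ _ rho0); apply: filterS => n.
rewrite sub0r normrN => Un.
have m1 := mean_leZ (ltW rho0) (mean_leD (mean_leD (mean_le_cst P 1) mS') (iQ n)).
have iU : mean_le P (U n) rho.
  by split; [exact: (integrable_le (mU n) (UC n) iU0)|exact: le_trans (ler_norm _) (ltW Un)].
have m2 := mean_leD (mean_leD m1 iU) (mean_leZ (ltW l0) (Q2 n)).
suff : mean_le P (fun w => `|err n w|) (rho * (1 + KS + (1 + 3 * (d%:R * N) ^+ 2)) + rho + l * (3 * (d%:R * N) ^+ 2)) by case.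
apply: mean_le_dominated m2 => // w; rewrite /U indicE.
have Q0 : 0 <= Q n w by exact: quad_var_ge0.
have [Aw|] := boolP (w \in A n); last first.
  rewrite notin_setE /A/= => /negP; rewrite -leNgt mulr0 addr0 => /le_trans; apply.
  by rewrite lerDl mulr_ge0 ?sqr_ge0 ?ltW.
rewrite mulr1 (le_trans (err_bound n w))//.
have p1 : 0 <= rho * (1 + S w ^+ 2 + Q n w) by exact: mulr_ge0 (ltW rho0) (ltW (W_gt0 n w)).
suff p2 : K * Q n w <= K ^+ 2 / l + l * Q n w ^+ 2 by move: p1 p2; rewrite -/(Q n w); lra.
have -> : K ^+ 2 / l = l * (K / l) ^+ 2 by field; exact: lt0r_neq0.
have -> : K * Q n w = l * ((K / l) * Q n w) by field; exact: lt0r_neq0.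
rewrite -mulrDr ler_wpM2l ?(ltW l0)//.
have := sqr_ge0 (K / l - Q n w); have := sqr_ge0 (K / l + Q n w); lra.
Qed.

Lemma ito_error_cvg0 : \int[P]_w `|err n w| @[n --> \oo] --> (0 : R).
Proof.
apply/cvgrPdist_le => c c0.
pose D := 3 * (d%:R * N) ^+ 2.
have D0 : 0 <= D by rewrite mulr_ge0 ?sqr_ge0.
(* The weight l is fixed first, to make the Q^2 term at most c / 2; M depends on it, and only then
   is rho chosen. *)
have l0 : 0 < c / 2 / (1 + D) by rewrite !divr_gt0// ltr_wpDr.
have [M MP] := ito_error_mean l0.
have r0 : 0 < c / 2 / (1 + `|M|) by rewrite !divr_gt0// ltr_wpDr.
have := MP _ r0; apply: filterS => n; rewrite -/D => le.
rewrite sub0r normrN ger0_norm; last by apply: Rintegral_ge0.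
apply: (le_trans le).
have e1 : c / 2 / (1 + D) * D <= c / 2.
  rewrite -mulrA; apply: ler_piMr; first by rewrite divr_ge0 ?(ltW c0).
  by rewrite mulrC ler_pdivrMr ?mul1r; lra.
have e2 : c / 2 / (1 + `|M|) * M + c / 2 / (1 + `|M|) <= c / 2.
  rewrite -[Y in _ + Y]mulr1 -mulrDr -mulrA; apply: ler_piMr; first by rewrite divr_ge0 ?(ltW c0).
  have := ler_norm M; have := normr_ge0 M => M0 MM.
  by rewrite mulrC ler_pdivrMr ?mul1r; lra.
lra.
Qed.

(** [ito_sum] converges on every path and is dominated through S^2, so its means converge. They also
    tend to 0: [ito_sum] differs from [ito_error] by a centered variable, and the mean of
    |[ito_error]| vanishes in the limit. *)
Lemma dynkin_formula :
  P.-integrable [set: T] (EFin \o (fun w => G (X w (e w)) - G (X w (a w)) -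
    2^-1 * \int[lebesgue_measure]_(s in `[0, N]) (\1_(J s) w * \sum_i q i i (X w s)))) /\
  \int[P]_w (G (X w (e w)) - G (X w (a w)) -
    2^-1 * \int[lebesgue_measure]_(s in `[0, N]) (\1_(J s) w * \sum_i q i i (X w s))) = 0.
Proof.
have [||||iL cL] := @cvg_Rintegral _ _ _ P (fun n w => ito_sum G q (b w) N (z w) n)
  (fun w => G (X w (e w)) - G (X w (a w)) -
    2^-1 * \int[lebesgue_measure]_(s in `[0, N]) (\1_(J s) w * \sum_i q i i (X w s)))
  (fun w => 4 * (C * (1 + 4 * S w ^+ 2)) + d%:R * C * N).
- exact: measurable_ito_sum.
- move=> w; have [/andP[a0 aew] eN] := ae w.
  apply: (cvg_ito_sum delta0 nd (@cb w) N0 a0 aew eN (@zE w)) => u; exact: aeX.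
- move=> n w; have [/andP[a0 aew] eN] := ae w.
  by apply: (ito_sum_bound nd (@cb w) N0 aew (@zE w)) => u; exact: aeX.
- have m1 := mean_leD (mean_le_cst P 1) (mean_leZ (ler0n _ 4) mS).
  have m2 := mean_leZ (ler0n _ 4) (mean_leZ (neumann_const_ge0 nd) m1).
  exact: (mean_leD m2 (mean_le_cst P (d%:R * C * N))).1.
split => //; apply: (cvg_unique _ cL) => //.
apply: norm_cvg0; apply: (squeeze_cvgr _ (cvg_cst 0) ito_error_cvg0).
apply: nearW => n; rewrite normr_ge0/=.
have ierr : P.-integrable [set: T] (EFin \o err n).
  apply: (integrable_le (measurable_err n) (err_bound n)).
  exact: (mean_leZ K0 (mean_leD (mean_leD (mean_le_cst P 1) mS) (iQ n))).1.
have is_ : P.-integrable [set: T] (EFin \o (fun w => ito_sum G q (b w) N (z w) n)).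
  have [im _] := mart_centered n.
  rewrite (_ : (fun w => _) = (fun w => err n w - mart n w)); first exact: (integrableB measurableT ierr im).
  by apply/funext => w; rewrite /err ito_error_split addrK.
have -> : \int[P]_w ito_sum G q (b w) N (z w) n = \int[P]_w err n w.
  rewrite /err; under [RHS]eq_Rintegral do rewrite ito_error_split.
  by rewrite RintegralD// ?(mart_centered n).2 ?addr0//; exact: (mart_centered n).1.
exact: le_normr_Rintegral.
Qed.

End Dynkin.

(** * The time change of a path *)

Section IntegralClock.
Context {R : realType}.
Variables (k : R -> R) (C : R).
Hypotheses (ck : continuous k) (k0 : forall u, 0 < k u) (kC : forall u, k u <= C).

Definition iclock u : R := \int[lebesgue_measure]_(s in `[0, u]) k s.

Lemma continuous_integrable_itv a b :
  lebesgue_measure.-integrable `[a, b] (EFin \o k).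
Proof.
apply: continuous_compact_integrable; first exact: segment_compact.
by apply: continuous_subspaceT => x; exact: ck.
Qed.

Lemma iclock_le0 u : u <= 0 -> iclock u = 0.
Proof.
rewrite le_eqVlt => /predU1P[->|u0]; first by rewrite /iclock set_itv1 Rintegral_set1.
by rewrite /iclock set_itv_ge ?Rintegral_set0// bnd_simp -ltNge.
Qed.

Lemma iclock0 : iclock 0 = 0. Proof. exact: iclock_le0. Qed.

Lemma iclockB u v : 0 <= u -> u <= v -> iclock v - iclock u = \int[lebesgue_measure]_(s in `[u, v]) k s.
Proof.
move=> u0 uv.
rewrite /iclock (@Rintegral_itvB _ k (BLeft 0) (BRight v) u)//.
- rewrite Rintegral_itv_obnd_cbnd//; apply: integrableS (continuous_integrable_itv u v) => //.
  by move=> x; rewrite /= !in_itv/= => /andP[/ltW -> ->].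
- exact: continuous_integrable_itv.
Qed.

Lemma Rintegral_itv_cst (c u v : R) : u <= v -> \int[lebesgue_measure]_(s in `[u, v]) c = c * (v - u).
Proof.
move=> uv; rewrite Rintegral_cst//= lebesgue_measure_itv/= lte_fin.
by move: uv; rewrite le_eqVlt => /predU1P[->|->//]; rewrite ltxx subrr mulr0.
Qed.

Lemma integrable_itv_cst (c u v : R) : lebesgue_measure.-integrable `[u, v] (EFin \o (fun=> c)).
Proof.
apply: continuous_compact_integrable; first exact: segment_compact.
by apply: continuous_subspaceT => x; exact: cvg_cst.
Qed.

Lemma iclock_incr u v : 0 <= u -> u <= v -> 0 <= iclock v - iclock u <= C * (v - u).
Proof.
move=> u0 uv; rewrite iclockB//; apply/andP; split.
  by apply: Rintegral_ge0 => s _; exact: ltW.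
rewrite -Rintegral_itv_cst//; apply: le_Rintegral => //; first exact: continuous_integrable_itv.
exact: integrable_itv_cst.
Qed.

Lemma iclock_lt u v : 0 <= u -> u < v -> iclock u < iclock v.
Proof.
move=> u0 uv; rewrite -subr_gt0 (iclockB u0 (ltW uv)).
have [c cuv cmin] := EVT_min (ltW uv) (continuous_subspaceT ck).
apply: (@lt_le_trans _ _ (k c * (v - u))); first by rewrite mulr_gt0// subr_gt0.
rewrite -(Rintegral_itv_cst _ (ltW uv)); apply: le_Rintegral => //.
- exact: integrable_itv_cst.
- exact: continuous_integrable_itv.
Qed.

Lemma iclock_le u v : 0 <= u -> u <= v -> iclock u <= iclock v.
Proof. by move=> u0 uv; have := iclock_incr u0 uv; rewrite subr_ge0 => /andP[]. Qed.

Lemma iclock_inj u v : 0 <= u -> 0 <= v -> iclock u = iclock v -> u = v.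
Proof.
move=> u0 v0 E; apply/eqP; rewrite eq_le; apply/andP; split; rewrite leNgt; apply/negP => h.
  by have := iclock_lt v0 h; rewrite E ltxx.
by have := iclock_lt u0 h; rewrite E ltxx.
Qed.

Lemma iclock_max0 u : iclock (Num.max 0 u) = iclock u.
Proof. by case: (leP 0 u) => // u0; rewrite iclock0 iclock_le0// ltW. Qed.

Lemma continuous_iclock : continuous iclock.
Proof.
move=> u; apply/cvgrPdist_le => e e0.
have C0 : 0 < C by apply: lt_le_trans (kC 0).
exists (e / C) => /=; first by rewrite divr_gt0.
move=> v /= uv; rewrite -(iclock_max0 u) -(iclock_max0 v).
have : `|Num.max 0 u - Num.max 0 v| <= e / C.
  apply: (le_trans _ (ltW uv)).
  move: (leP 0 u) (leP 0 v) => [u0|u0] [v0|v0] //.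
  - by rewrite !ger0_norm; lra.
  - by rewrite !ler0_norm; lra.
  - by rewrite subrr normr0.
have p : 0 <= Num.max 0 u by rewrite le_max lexx.
have q : 0 <= Num.max 0 v by rewrite le_max lexx.
move: (Num.max 0 u) (Num.max 0 v) p q => x y x0 y0.
rewrite ler_pdivlMr// mulrC => le; apply: le_trans le.
have [xy|/ltW yx] := leP x y.
  by have /andP[h1 h2] := iclock_incr x0 xy; rewrite distrC (distrC x) !ger0_norm// subr_ge0.
by have /andP[h1 h2] := iclock_incr y0 yx; rewrite !ger0_norm// subr_ge0.
Qed.

Lemma iclock_deriv (u : R) : 0 < u -> is_derive u 1 iclock (k u).
Proof.
move=> u0.
have [||h1 h2] := @continuous_FTC1_closed R k 0 u (u + 1) _ _ u0 (@ck u).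
- by rewrite ltrDl.
- exact: continuous_integrable_itv.
rewrite derive1E in h2.
by apply: DeriveDef.
Qed.

(** At a = 0 the clock has a corner, being constant on negative times; so its derivative is used
    inside the interval and through one-sided limits at the ends. *)
Lemma iclock_subst (G : R -> R) (a b : R) : 0 <= a -> a <= b -> {within `[iclock a, iclock b], continuous G} ->
  \int[lebesgue_measure]_(x in `[iclock a, iclock b]) G x =
  \int[lebesgue_measure]_(u in `[a, b]) (G (iclock u) * k u).
Proof.
move=> a0; rewrite le_eqVlt => /predU1P[->|ab] cG; first by rewrite !set_itv1 !Rintegral_set1.
have dE u : 0 < u -> derive1 iclock u = k u.
  by move=> u0; rewrite derive1E; have h := iclock_deriv u0; rewrite (@derive_val _ _ _ _ _ _ _ h).
have cut (u : R) : 0 < u -> \forall x \near u, derive1 iclock x = k x.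
  by move=> u0; near=> x; apply: dE; near: x; exact: lt_nbhsr.
rewrite /Rintegral (@integration_by_substitution_increasing _ iclock G a b (ltW ab))//.
- have mG : measurable_fun `]a, b[ (fun u => (G (iclock u) * k u)%:E).
    apply/measurable_EFinP; apply: measurable_funM.
      apply: (@measurable_comp _ _ _ _ _ _ `[iclock a, iclock b]%classic) => //.
      - move=> _ [u /= + <-]; rewrite !in_itv/= => /andP[au ub].
        by rewrite !iclock_le ?(ltW au) ?(ltW ub)// (le_trans a0)// ltW.
      - exact: subspace_continuous_measurable_fun.
      - by apply: measurable_funTS; exact: continuous_measurable_fun continuous_iclock.
    by apply: measurable_funTS; exact: continuous_measurable_fun ck.
  rewrite (integral_itv_bndoo _ _ mG) integral_itv_bndoo; last first.
    apply: eq_measurable_fun mG => u; rewrite inE/= in_itv/= => /andP[au _].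
    have -> : ((G \o iclock) * derive1 iclock) u = G (iclock u) * derive1 iclock u by [].
    by rewrite dE// (le_lt_trans a0).
  congr fine; apply: eq_integral => u; rewrite inE/= in_itv/= => /andP[au _].
  have -> : ((G \o iclock) * derive1 iclock) u = G (iclock u) * derive1 iclock u by [].
    by rewrite dE// (le_lt_trans a0).
- move=> x y; rewrite !in_itv/= => /andP[ax _] _; apply: iclock_lt; exact: le_trans ax.
- move=> u; rewrite in_itv/= => /andP[au _]; have u0 := le_lt_trans a0 au.
  apply/cvgrPdist_le => e e0; have /cvgrPdist_le/(_ _ e0) := @ck u.
  by rewrite dE//; apply: filterS2 (cut u u0) => x ->.
- apply/cvg_ex; exists (k a); apply/cvgrPdist_le => e e0.
  have /cvgrPdist_le/(_ _ e0) := cvg_at_right_filter (@ck a).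
  by apply: filterS2 (nbhs_right_gt a) => x ax; rewrite dE// (le_lt_trans a0).
- apply/cvg_ex; exists (k b); apply/cvgrPdist_le => e e0.
  have /cvgrPdist_le/(_ _ e0) := cvg_at_left_filter (@ck b).
  by apply: filterS2 (nbhs_left_gt (le_lt_trans a0 ab)) => x x0; rewrite dE.
- split.
  + move=> u; rewrite in_itv/= => /andP[au _].
    by have h := iclock_deriv (le_lt_trans a0 au); case: h.
  + exact: cvg_at_right_filter (@continuous_iclock a).
  + exact: cvg_at_left_filter (@continuous_iclock b).
Unshelve. all: by end_near. Qed.

End IntegralClock.

Section LastTime.
Context {R : realType}.

Definition above (phi : R -> R) (c u : R) := forall v, 0 <= v <= u -> c <= phi v.

Lemma above_le phi c u v : v <= u -> above phi c u -> above phi c v.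
Proof. by move=> vu h s /andP[s0 sv]; apply: h; rewrite s0 (le_trans sv). Qed.

Lemma above_mono phi c c' u : c' <= c -> above phi c u -> above phi c' u.
Proof. by move=> cc h s su; apply: le_trans cc _; exact: h. Qed.

(** e is the supremum of the times up to which phi has stayed above c. The equivalence shows that u
    <= e depends on the path up to u alone, which is all the adaptedness that the windows need. *)
Lemma last_time (phi : R -> R) c N : 0 <= N -> continuous phi -> c <= phi 0 ->
  exists e, [/\ 0 <= e <= N, forall u, 0 <= u <= N -> above phi c u <-> u <= e & e = N \/ phi e = c].
Proof.
move=> N0 cphi phi0.
pose A := [set u | 0 <= u <= N /\ above phi c u].
have A0 : A 0 by split; [rewrite lexx|move=> v; rewrite -eq_le => /eqP <-].
have ubA : has_ubound A by exists N => u [/andP[]].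
have supA : has_sup A by split => //; exists 0.
pose e := sup A.
have e0 : 0 <= e by apply: ub_le_sup.
have eN : e <= N by apply: sup_le_ub; [exists 0|move=> u [/andP[]]].
have lt_e v : 0 <= v -> v < e -> c <= phi v.
  move=> v0 ve; have ev : 0 < e - v by rewrite subr_gt0.
  have [u [_ uA]] := sup_adherent ev supA; rewrite -/e opprB addrCA subrr addr0 => vu.
  by apply: uA; rewrite v0 ltW.
have phie : c <= phi e.
  move: (e0); rewrite le_eqVlt => /predU1P[<-//|egt0]; rewrite leNgt; apply/negP => lt.
  have /cvgrPdist_lt/(_ (c - phi e)) := cphi e; rewrite subr_gt0 => /(_ lt)[s /= s0 sP].
  pose v := Num.max 0 (e - s / 2).
  have v0 : 0 <= v by rewrite le_max lexx.
  have ve : v < e by rewrite gt_max egt0 gtrBl divr_gt0.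
  have vs : e - s / 2 <= v by rewrite le_max lexx orbT.
  have := lt_e v v0 ve; have := sP v; rewrite /ball_ /= gtr0_norm ?subr_gt0//.
  have es : e - v < s by lra.
  by move=> /(_ es); have := ler_norm (phi v - phi e); rewrite distrC; lra.
have Pe u : 0 <= u <= N -> above phi c u <-> u <= e.
  move=> uN; split=> [h|ue]; first by apply: ub_le_sup.
  by move=> v /andP[v0 /le_trans/(_ ue)]; rewrite le_eqVlt => /predU1P[->|/(lt_e _ v0)].
exists e; split => //; first by rewrite e0.
have [lt|] := ltP e N; last by move=> Ne; left; apply/eqP; rewrite eq_le eN.
right; apply/eqP; rewrite eq_le phie andbT leNgt; apply/negP => gt.
have /cvgrPdist_lt/(_ (phi e - c)) := cphi e; rewrite subr_gt0 => /(_ gt)[s /= s0 sP].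
pose u := Num.min N (e + s / 2).
have eu : e < u by rewrite lt_min lt ltrDl divr_gt0.
have uN : 0 <= u <= N by rewrite (le_trans e0 (ltW eu)) ge_min lexx.
have us : u <= e + s / 2 by rewrite ge_min lexx orbT.
suff /(Pe _ uN) : above phi c u by rewrite leNgt eu.
move=> v /andP[v0 vu]; have [ve|ev] := leP v e.
  by apply: (Pe e _).2; rewrite ?e0 ?lexx// v0.
have := sP v; rewrite /ball_ /= distrC gtr0_norm ?subr_gt0// => /(_ _).
have vs : v - e < s by lra.
move=> /(_ vs); have := ler_norm (phi e - phi v); lra.
Qed.

Lemma above_running_inf phi c u : 0 <= u -> continuous phi ->
  above phi c u <-> c <= running_inf phi u.
Proof.
move=> u0 cphi; have [m [mu -> mmin]] := running_inf_attained u0 cphi.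
split=> [|h v vu]; first exact.
by apply: le_trans h _; exact: mmin.
Qed.

End LastTime.

(** * The clock of a single path and its lifetime *)

Section PathClock.
Context {R : realType} {d : nat}.
Variable y : R -> 'rV[R]_d.
Hypotheses (cy : forall t, {for t, continuous y}) (oy : forall t, 0 <= t -> orthant (y t))
  (y0 : y 0 != 0).

Local Notation g := (fun u => norm1 (y u)).

(* The integrand of [clock], cut off so as to be bounded and continuous: on
   [above g delta u] it is the true one up to time [u]. *)
Definition rate delta u : R := (Num.max (g u) delta ^+ 2)^-1.

Definition pclock delta := iclock (rate delta).

Lemma continuous_norm1_comp : continuous g.
Proof.
move=> t; apply: continuous_at_sum => i.
rewrite (_ : (fun u => _) = (Num.norm \o (fun v : 'rV[R]_d => v 0 i) \o y))//.
apply: (@continuous_comp _ _ _ y (Num.norm \o (fun v : 'rV[R]_d => v 0 i))); first exact: cy.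
apply: (@continuous_comp _ _ _ (fun v : 'rV[R]_d => v 0 i) Num.norm); first exact: continuous_coord.
exact: norm_continuous.
Qed.

Lemma rate_gt0 delta u : 0 < delta -> 0 < rate delta u.
Proof. by move=> d0; rewrite invr_gt0 exprn_gt0// lt_max d0 orbT. Qed.

Lemma rate_le delta u : 0 < delta -> rate delta u <= (delta ^+ 2)^-1.
Proof.
move=> d0; rewrite /rate lef_pV2 ?posrE ?exprn_gt0// ?lt_max ?d0 ?orbT//.
by rewrite lerXn2r ?nnegrE ?le_max ?lexx ?(ltW d0) ?orbT.
Qed.

Lemma continuous_rate delta : 0 < delta -> continuous (rate delta).
Proof.
move=> d0 u.
have cm : {for u, continuous (fun u => Num.max (g u) delta)}.
  have mE (x : R) : Num.max x delta = (x + delta + `|x - delta|) / 2.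
    by rewrite /Num.max; case: ltP => xd; [rewrite ltr0_norm|rewrite ger0_norm]; lra.
  rewrite (_ : (fun u => _) = (fun u => (g u + delta + `|g u - delta|) / 2)); last by apply/funext => v.
  apply: cvgMl; apply: cvgD; first by apply: cvgD; [exact: continuous_norm1_comp|exact: cvg_cst].
  by apply: cvg_norm; apply: cvgB; [exact: continuous_norm1_comp|exact: cvg_cst].
have m0 : Num.max (g u) delta ^+ 2 != 0 by rewrite expf_neq0// gt_eqF// lt_max d0 orbT.
by apply: cvgV => //; apply: (@continuous_comp _ _ _ (fun u => Num.max (g u) delta) (fun x : R => x ^+ 2)) => //; exact: exprn_continuous.
Qed.

Section Delta.
Variable delta : R.
Hypothesis d0 : 0 < delta.

Lemma pclock_lt u v : 0 <= u -> u < v -> pclock delta u < pclock delta v.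
Proof. by apply: iclock_lt; [exact: continuous_rate|move=> s; exact: rate_gt0]. Qed.

Lemma pclock_le u v : 0 <= u -> u <= v -> pclock delta u <= pclock delta v.
Proof.
by move=> u0; rewrite le_eqVlt => /predU1P[->//|uv]; apply/ltW/pclock_lt.
Qed.

Lemma continuous_pclock : continuous (pclock delta).
Proof.
by apply: (@continuous_iclock _ _ (delta ^+ 2)^-1); [exact: continuous_rate|move=> s; exact: rate_gt0|move=> s; exact: rate_le].
Qed.

Lemma pclock0 : pclock delta 0 = 0. Proof. exact: iclock0. Qed.

Lemma pclock_inj u v : 0 <= u -> 0 <= v -> pclock delta u = pclock delta v -> u = v.
Proof. by apply: iclock_inj; [exact: continuous_rate|move=> s; exact: rate_gt0]. Qed.

Lemma pclock_ivt u t : 0 <= u -> 0 <= t <= pclock delta u -> exists2 v, 0 <= v <= u & pclock delta v = t.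
Proof.
move=> u0 tu; have [|v vu <-] := @IVT _ (pclock delta) 0 u t u0 (continuous_subspaceT continuous_pclock).
  by have /andP[t0 /(le_trans t0) c0] := tu; rewrite pclock0 min_l ?max_r.
by exists v.
Qed.

End Delta.

Lemma pclockE delta delta' u : 0 < delta -> 0 < delta' -> above g delta u -> above g delta' u ->
  pclock delta u = pclock delta' u.
Proof.
move=> d0 d0' a a'; apply: eq_Rintegral => s; rewrite inE/= in_itv/= => su.
by rewrite /rate !max_l//; [exact: a'|exact: a].
Qed.

(** At real time u the clock reads t. The level [delta] certifies that the path stays off the origin
    up to u, and the reading is the same for all such levels. *)
Definition clock_at u t := 0 <= u /\ exists2 delta, 0 < delta & above g delta u /\ pclock delta u = t.

Lemma clock_atP u t delta : 0 < delta -> above g delta u -> clock_at u t -> pclock delta u = t.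
Proof. by move=> d0 a [u0 [d' d'0 [a' <-]]]; exact: pclockE. Qed.

Lemma clock_at_inj u v t : clock_at u t -> clock_at v t -> u = v.
Proof.
wlog uv : u v / u <= v.
  by move=> H cu cv; have [/H|/ltW /H] := leP u v; [exact|move=> h; exact/esym/h].
move=> cu [v0 [d' d'0 [a' E]]]; have u0 := cu.1.
apply: (pclock_inj d'0) => //; rewrite E; apply: (clock_atP d'0) => //.
exact: above_le a'.
Qed.

Lemma clock_at_le u t s : clock_at u t -> 0 <= s <= t -> exists2 v, 0 <= v <= u & clock_at v s.
Proof.
move=> [u0 [delta d0 [a <-]]] st; have [v /andP[v0 vu] E] := pclock_ivt d0 u0 st.
exists v; first by rewrite v0.
by split => //; exists delta => //; split => //; exact: above_le a.
Qed.

(** By continuity the path stays above half the level a little beyond u. This room gives the strict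
    inequalities in the lifetime and in the infimum defining the time change. *)
Lemma clock_at_right u t e : clock_at u t -> 0 < e -> exists delta v, [/\ 0 < delta, u < v,
   v < u + e, above g delta v & pclock delta u = t].
Proof.
move=> [u0 [delta d0 [a E]]] e0.
have d2 : 0 < delta / 2 by rewrite divr_gt0.
have /cvgrPdist_lt/(_ _ d2)[s /= s0 sP] := @continuous_norm1_comp u.
pose v := u + Num.min e s / 2.
have m0 : 0 < Num.min e s by rewrite lt_min e0.
have me : Num.min e s <= e by rewrite ge_min lexx.
have ms : Num.min e s <= s by rewrite ge_min lexx orbT.
have uv : u < v by rewrite ltrDl divr_gt0.
have gu : delta <= g u by apply: a; rewrite u0 lexx.
have av : above g (delta / 2) v.
  move=> x /andP[x0 xv]; have [xu|ux] := leP x u.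
    by apply: (@le_trans _ _ delta); [lra|apply: a; rewrite x0].
  have := sP x; rewrite /ball_ /= distrC gtr0_norm ?subr_gt0// => /(_ _).
  have xs : x - u < s by move: xv; rewrite /v; lra.
  by move=> /(_ xs); have := ler_norm (g u - g x); lra.
exists (delta / 2), v; split => //; first by rewrite /v; lra.
rewrite -E; apply: pclockE => //; apply: above_le av; exact: ltW.
Qed.

Lemma above_lt_hitting delta u : 0 <= u -> 0 < delta -> above g delta u ->
  (u%:E < hitting_time0 y)%E.
Proof.
move=> u0 d0 a.
have cu : clock_at u (pclock delta u) by split => //; exists delta.
have [d' [v [d'0 uv _ av _]]] := clock_at_right cu ltr01.
apply: (@lt_le_trans _ _ v%:E); first by rewrite lte_fin.
apply: le_ereal_inf_tmp => _ [t [t0 yt] <-]; rewrite lee_fin leNgt; apply/negP => tv.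
have := av t; rewrite (ltW t0) (ltW tv) yt norm1_eq0 => /(_ isT).
by rewrite leNgt d'0.
Qed.

Lemma lt_hitting_neq0 u : 0 <= u -> (u%:E < hitting_time0 y)%E -> y u != 0.
Proof.
rewrite le_eqVlt => /predU1P[<-//|u0] uH; apply: contraTneq uH => yu.
by rewrite -leNgt; apply: ereal_inf_lbound; exists u.
Qed.

Lemma lt_hitting_above u : 0 <= u -> (u%:E < hitting_time0 y)%E ->
  exists2 delta, 0 < delta & above g delta u.
Proof.
move=> u0 uH.
have [c cu cmin] := EVT_min u0 (continuous_subspaceT continuous_norm1_comp).
exists (g c) => [|v vu]; last by apply: cmin; rewrite in_itv.
move: cu; rewrite in_itv/= => /andP[c0 cu].
by apply: norm1_gt0; apply: lt_hitting_neq0 => //; apply: le_lt_trans uH; rewrite lee_fin.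
Qed.

Lemma hitting_absorb0 : hitting_time0 (absorb0 y) = hitting_time0 y.
Proof.
apply/eqP; rewrite eq_le; apply/andP; split.
  apply: ereal_inf_le_tmp => _ [t [t0 yt] <-]; exists t => //; split => //.
  by rewrite /absorb0; case: ifP.
apply: le_ereal_inf_tmp => _ [t [t0 yt] <-]; rewrite leNgt; apply/negP => tH.
by move: yt; rewrite /absorb0 tH; apply/eqP/lt_hitting_neq0 => //; exact: ltW.
Qed.

Lemma absorb0_before u : 0 <= u -> (u%:E < hitting_time0 y)%E -> absorb0 y u = y u.
Proof. by move=> u0 uH; rewrite /absorb0 uH. Qed.

Let speed r : \bar R := (((norm1 (absorb0 y r) ^+ 2)%:E)^-1)%E.

Lemma speedE delta r : 0 <= r -> 0 < delta -> above g delta r -> speed r = (rate delta r)%:E.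
Proof.
move=> r0 d0 a; rewrite /speed absorb0_before//; last exact: above_lt_hitting a.
have gr : delta <= g r by apply: a; rewrite r0 lexx.
by rewrite /rate max_l// inver gt_eqF// exprn_gt0// (lt_le_trans d0).
Qed.

Lemma clock_above delta u : 0 <= u -> 0 < delta -> above g delta u ->
  clock (absorb0 y) u = (pclock delta u)%:E.
Proof.
move=> u0 d0 a; rewrite /clock /pclock /iclock /Rintegral fineK.
  apply: eq_integral => r; rewrite inE/= in_itv/= => /andP[r0 ru].
  by rewrite -/(speed r) (@speedE delta)//; exact: above_le a.
apply: integrable_fin_num => //.
by apply: continuous_integrable_itv; exact: continuous_rate.
Qed.

(** Exhausts the times before absorption by compact intervals on which the speed is continuous; its
    measurability and, by monotone convergence, the lifetime are obtained from these. *)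
Let F n := [set r : R | 0 <= r <= n%:R /\ above g n.+1%:R^-1 r].
Let D := [set r : R | 0 <= r /\ (r%:E < hitting_time0 (absorb0 y))%E].

Let FE n : F n = set0 \/ exists2 e, 0 <= e /\ above g n.+1%:R^-1 e & F n = `[0, e]%classic.
Proof.
have [gn|gn] := leP n.+1%:R^-1 (g 0); last first.
  left; apply/seteqP; split => // r [/andP[r0 _] a].
  by have := a 0; rewrite lexx r0 leNgt gn => /(_ isT).
right; have [e [/andP[e0 en] eP _]] := last_time (ler0n _ n) continuous_norm1_comp gn.
exists e; first by split => //; apply: (eP e _).2; rewrite ?e0.
apply/seteqP; split => r /=; rewrite in_itv/=.
  by move=> [rn /(eP r rn).1 ->]; case/andP: rn => ->.
move=> /andP[r0 re]; have rn : 0 <= r <= n%:R by rewrite r0 (le_trans re).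
by split => //; exact: (eP r rn).2.
Qed.

Let mF n : measurable (F n).
Proof. by have [->//|[e _ ->]] := FE n. Qed.

Let DE : \bigcup_n F n = D.
Proof.
apply/seteqP; split => [r [n _ [/andP[r0 _] a]]|r [r0 rH]].
  by split => //; rewrite hitting_absorb0; apply: above_lt_hitting a.
rewrite hitting_absorb0 in rH.
have [delta d0 a] := lt_hitting_above r0 rH.
pose n := maxn (Num.truncn r).+1 (Num.truncn delta^-1).+1.
have n1 : r <= n%:R.
  by apply/ltW/(lt_le_trans (truncnS_gt _)); rewrite ler_nat leq_maxl.
have n2 : n.+1%:R^-1 <= delta.
  rewrite invf_ple ?posrE//; apply/ltW/(lt_le_trans (truncnS_gt _)).
  by rewrite ler_nat ltnW// ltnS leq_maxr.
by exists n => //; split; [rewrite r0|exact: above_mono a].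
Qed.

Let ndF : {homo F : n m / (n <= m)%N >-> (n <= m)%O}.
Proof.
move=> n m nm; apply/subsetPset => r [/andP[r0 rn] a]; split.
  by rewrite r0 (le_trans rn)// ler_nat.
by apply: above_mono a; rewrite lef_pV2 ?posrE// ler_nat ltnS.
Qed.

Let mspeedF n : measurable_fun (F n) speed.
Proof.
have [->|[e [e0 a] ->]] := FE n; first exact: measurable_fun_set0.
apply: (eq_measurable_fun (EFin \o rate n.+1%:R^-1)).
  by move=> r; rewrite inE/= in_itv/= => /andP[r0 re]; rewrite (@speedE n.+1%:R^-1)//; exact: above_le a.
apply/measurable_EFinP; apply: measurable_funTS; apply: continuous_measurable_fun.
exact: continuous_rate.
Qed.

Let mspeed : measurable_fun D speed.
Proof. by rewrite -DE; apply/measurable_fun_bigcup. Qed.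

Let mD : measurable D.
Proof. by rewrite -DE; exact: bigcupT_measurable. Qed.

Let speed_ge0 r : (0 <= speed r)%E.
Proof. by rewrite inve_ge0 lee_fin sqr_ge0. Qed.

Lemma clock_at_lifetime u t : clock_at u t -> (t%:E < map_lifetime (absorb0 y))%E.
Proof.
move=> cu; have u0 := cu.1; have [delta [v [d0 uv _ a E]]] := clock_at_right cu ltr01.
have v0 : 0 <= v by rewrite (le_trans u0)// ltW.
apply: (@lt_le_trans _ _ (pclock delta v)%:E); first by rewrite lte_fin -E pclock_lt.
rewrite -clock_above//; apply: ge0_subset_integral => //; first by move=> r _; exact: speed_ge0.
move=> r; rewrite /= in_itv/= => /andP[r0 rv]; split => //.
by rewrite hitting_absorb0; apply: above_lt_hitting r0 d0 _; exact: above_le a.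
Qed.

(** If the clock never read t, it would stay at most t on every [F n] by the intermediate value
    theorem, and so would its limit, the lifetime. *)
Lemma lifetime_clock_at t : 0 <= t -> (t%:E < map_lifetime (absorb0 y))%E -> exists u, clock_at u t.
Proof.
move=> t0 tL; apply: contrapT => no.
have le n : (\int[lebesgue_measure]_(r in F n) speed r <= t%:E)%E.
  have [->|[e [e0 a] FnE]] := FE n; first by rewrite integral_set0 lee_fin.
  rewrite FnE -[leLHS]/(clock (absorb0 y) e) (clock_above e0 _ a)// lee_fin leNgt.
  apply/negP => lt; apply: no.
  have n0 : 0 < n.+1%:R^-1 :> R by [].
  have tp : 0 <= t <= pclock n.+1%:R^-1 e by rewrite t0 ltW.
  have [u /andP[u0 ue] E] := pclock_ivt n0 e0 tp.
  by exists u; split => //; exists n.+1%:R^-1 => //; split => //; exact: above_le a.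
have := @ge0_nondecreasing_set_cvg_integral _ (measurableTypeR R) R F speed lebesgue_measure ndF mF mspeedF (fun n r _ => speed_ge0 r).
rewrite DE => cL; move: tL; rewrite ltNge => /negP; apply.
rewrite /map_lifetime -[leLHS](cvg_lim _ cL)//; apply: lime_le; first by apply/cvg_ex; eexists; exact: cL.
exact: nearW.
Qed.

Lemma time_change_clock_at u t : 0 <= t -> clock_at u t -> time_change (absorb0 y) t = u.
Proof.
move=> t0 cu; have u0 := cu.1.
pose A := [set s : R | 0 < s /\ (t%:E < clock (absorb0 y) s)%E].
have lbA : lbound A u.
  move=> s [s0 ts]; rewrite leNgt; apply/negP => su; move: ts.
  have [_ [delta d0 [a E]]] := cu.
  rewrite (@clock_above delta)//; [|exact: ltW|exact: above_le (ltW su) a].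
  by rewrite lte_fin -E ltNge pclock_le ?ltW.
have inA e : 0 < e -> exists2 s, A s & s < u + e.
  move=> e0; have [delta [v [d0 uv ve a E]]] := clock_at_right cu e0.
  exists v => //; split; first exact: le_lt_trans uv.
  have v0 : 0 <= v by rewrite (le_trans u0)// ltW.
  by rewrite (@clock_above delta)// lte_fin -E pclock_lt.
have [s0 As0 _] := inA 1 ltr01.
apply/eqP; rewrite eq_le; apply/andP; split; last by apply: lb_le_inf => //; exists s0.
apply/ler_addgt0Pr => e e0; have [s As /ltW] := inA e e0; apply: le_trans.
by apply: ge_inf => //; exists u.
Qed.

Lemma underlying_map_alive u t : 0 <= t -> clock_at u t ->
  underlying_map (absorb0 y) t = Some (polar (y u)).
Proof.
move=> t0 cu; have u0 := cu.1; rewrite /underlying_map (clock_at_lifetime cu).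
rewrite (time_change_clock_at t0 cu) absorb0_before//; last first.
  by have [_ [delta d0 [a _]]] := cu; exact: above_lt_hitting a.
by rewrite /polar total_orthant//; exact: oy.
Qed.

Lemma underlying_map_dead t : 0 <= t -> (forall u, ~ clock_at u t) ->
  underlying_map (absorb0 y) t = None.
Proof.
move=> t0 no; rewrite /underlying_map; case: ifP => // /(lifetime_clock_at t0)[u cu].
by have := no u cu.
Qed.

End PathClock.

(** * The time-changed path as a function of MAP time *)

Section PathState.
Context {R : realType} {d : nat}.

(** Inverse of [polar], with the cemetery sent to the origin: the killed MAP becomes a process in
    the orthant. *)
Definition cartesian (p : option 'rV[R]_(1 + d)) : 'rV[R]_d :=
  oapp (fun v : 'rV[R]_(1 + d) => expR (v 0 (lshift d 0)) *: rsubmx v) 0 p.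

Lemma cartesian_polar w : orthant w -> w != 0 -> cartesian (Some (polar w)) = w.
Proof.
move=> ow w0; have t0 := total_gt0 ow w0.
rewrite /cartesian /= polarE /polar row_mxKr.
rewrite (_ : fintype.split _ = inl 0) ?lnK ?posrE//; last exact: (unsplitK (inl 0)).
by rewrite scalerA divff ?scale1r// gt_eqF.
Qed.

Variable y : R -> 'rV[R]_d.
Hypotheses (cy : forall t, {for t, continuous y}) (oy : forall t, 0 <= t -> orthant (y t))
  (y0 : y 0 != 0).

Local Notation g := (fun u => norm1 (y u)).

Definition state t := cartesian (underlying_map (absorb0 y) t).

Lemma above_neq0 delta u : 0 <= u -> 0 < delta -> above g delta u -> y u != 0.
Proof.
move=> u0 d0 a; rewrite -norm1_gt0P; apply: lt_le_trans d0 _; apply: a.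
by rewrite u0 lexx.
Qed.

Lemma clock_at_neq0 u t : clock_at y u t -> y u != 0.
Proof. by move=> [u0 [delta d0 [a _]]]; exact: above_neq0 a. Qed.

Lemma state_alive u t : 0 <= t -> clock_at y u t -> state t = y u.
Proof.
move=> t0 cu; have u0 := cu.1; rewrite /state (underlying_map_alive cy oy y0 t0 cu).
by rewrite cartesian_polar//; [exact: oy|exact: clock_at_neq0 cu].
Qed.

Lemma state_dead t : 0 <= t -> (forall u, ~ clock_at y u t) -> state t = 0.
Proof. by move=> t0 no; rewrite /state underlying_map_dead. Qed.

Lemma state_cases t : 0 <= t -> (exists2 u, clock_at y u t & state t = y u) \/
  ((forall u, ~ clock_at y u t) /\ state t = 0).
Proof.
move=> t0; have [[u cu]|no] := pselect (exists u, clock_at y u t).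
  by left; exists u => //; exact: state_alive.
have no' u : ~ clock_at y u t by move=> cu; apply: no; exists u.
by right; split => //; exact: state_dead.
Qed.

Lemma orthant_state t : 0 <= t -> orthant (state t).
Proof.
move=> /state_cases[[u [u0 _] ->]|[_ ->]]; first exact: oy.
by move=> i; rewrite mxE.
Qed.

Variable h : 'rV[R]_d -> R.
Hypothesis ch : forall x, orthant x -> x != 0 -> {for x, continuous h}.

(** The inverse of a continuous, strictly increasing clock is continuous: readings close to t are
    taken at real times close to u. *)
Lemma state_continuous u t e : 0 <= t -> clock_at y u t -> 0 < e ->
  exists2 s, 0 < s & forall t', 0 <= t' -> `|t' - t| < s -> `|h (state t') - h (state t)| <= e.
Proof.
move=> t0 cu e0; have u0 := cu.1.
have chy : {for u, continuous (h \o y)}.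
  by apply: continuous_comp; [exact: cy|apply: ch; [exact: oy|exact: clock_at_neq0 cu]].
have /cvgrPdist_le/(_ _ e0)[eta /= eta0 etaP] := chy.
have [delta [v [d0 uv ve a E]]] := clock_at_right cy cu eta0.
have v0 : 0 <= v by rewrite (le_trans u0)// ltW.
have tv : t < pclock y delta v by rewrite -E pclock_lt.
pose l := u - eta / 2.
(* If l <= 0 every admissible time is to its right and no condition on the left is needed; 1 is a
   dummy value. *)
pose s := Num.min (pclock y delta v - t) (if 0 < l then t - pclock y delta l else 1).
have lu : l < u by rewrite gtrBl divr_gt0.
have s0 : 0 < s.
  rewrite lt_min subr_gt0 tv/=; case: ifP => // l0.
  by rewrite subr_gt0 -E pclock_lt// ltW.
exists s => // t' t'0; rewrite lt_min => /andP[s1 s2].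
have t'v : 0 <= t' <= pclock y delta v.
  by rewrite t'0/=; have := ler_norm (t' - t); lra.
have [x /andP[x0 xv] Ex] := pclock_ivt cy d0 v0 t'v.
have cx : clock_at y x t' by split => //; exists delta => //; split => //; exact: above_le a.
rewrite (state_alive t'0 cx) (state_alive t0 cu) distrC; apply: etaP; rewrite /ball_ /=.
have lx : l <= x.
  rewrite leNgt; apply/negP => xl; have l0 := le_lt_trans x0 xl.
  move: s2; rewrite l0; have := pclock_lt cy d0 x0 xl; rewrite Ex.
  by have := ler_norm (t - t'); rewrite distrC; lra.
have ul : u - l = eta / 2 by rewrite /l; lra.
move: xv ve lx ul eta0 {E Ex s1 s2 t'v tv s0 lu}; move: (l) => l' xv ve lx ul eta0.
by rewrite ltr_norml; apply/andP; split; lra.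
Qed.

(** A reading that is never reached excludes all later ones, so after death the state stays at the
    origin. Left limits at the lifetime are not controlled, so integrals over MAP time use Riemann
    sums tagged on the right. *)
Lemma state_right_continuous t e : 0 <= t -> 0 < e ->
  exists2 s, 0 < s & forall t', t < t' -> `|t' - t| < s -> `|h (state t') - h (state t)| <= e.
Proof.
move=> t0 e0; have [[u cu _]|[no E]] := state_cases t0.
  have [s s0 sP] := state_continuous t0 cu e0; exists s => // t' tt' ts.
  by apply: sP => //; rewrite (le_trans t0)// ltW.
exists 1 => // t' tt' _; have t'0 : 0 <= t' by rewrite (le_trans t0)// ltW.
rewrite E (state_dead t'0) ?subrr ?normr0 ?(ltW e0)// => u cu.
have [|v _ cv] := clock_at_le cy cu (s := t); first by rewrite t0 ltW.
exact: no cv.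
Qed.

Lemma state_subst delta a e s t : 0 <= s -> s <= t -> 0 < delta -> above g delta e ->
  clock_at y a s -> clock_at y e t ->
  \int[lebesgue_measure]_(r in `[s, t]) h (state r) =
  \int[lebesgue_measure]_(u in `[a, e]) (h (y u) * rate y delta u).
Proof.
move=> s0 st d0 ab ca ce; have a0 := ca.1; have e0 := ce.1.
have Ee := clock_atP d0 ab ce.
have ae : a <= e.
  have [|v /andP[v0 ve] cv] := clock_at_le cy ce (s := s); first by rewrite s0.
  by rewrite (clock_at_inj cy ca cv).
have Ea := clock_atP d0 (above_le ae ab) ca.
rewrite -{1}Ea -{1}Ee /pclock (@iclock_subst _ _ (delta ^+ 2)^-1)//.
- apply: eq_Rintegral => u; rewrite inE/= in_itv/= => /andP[au ue].
  have u0 := le_trans a0 au.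
  rewrite (@state_alive u)//; first by rewrite -/(pclock y delta u) -(pclock0 y delta) pclock_le.
  by split => //; exists delta => //; split => //; exact: above_le ab.
- exact: continuous_rate.
- by move=> u; exact: rate_gt0.
- by move=> u; exact: rate_le.
rewrite -!/(pclock y delta _) Ea Ee.
apply/subspace_continuousP => r /=; rewrite in_itv/= => /andP[sr rt].
have r0 := le_trans s0 sr.
have [|v _ cv] := clock_at_le cy ce (s := r); first by rewrite r0.
apply/cvgrPdist_le => c c0; have [x x0 xP] := state_continuous r0 cv c0.
exists x => // r' /= rr'; rewrite in_itv/= => /andP[sr' _].
by rewrite distrC; apply: xP; rewrite ?(le_trans s0)// distrC.
Qed.

End PathState.

Section CongruentPaths.
Context {R : realType} {d : nat}.

Lemma underlying_map_congr (x y : R -> 'rV[R]_d) : (forall t, 0 <= t -> x t = y t) ->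
  underlying_map (absorb0 x) = underlying_map (absorb0 y).
Proof.
move=> xy.
have H : hitting_time0 x = hitting_time0 y.
  congr ereal_inf; apply/seteqP; split => [_ [t [t0 E] <-]|_ [t [t0 E] <-]]; exists t => //;
    split => //; move: E; rewrite (xy t (ltW t0))//.
have axy t : 0 <= t -> absorb0 x t = absorb0 y t by move=> t0; rewrite /absorb0 H xy.
have H' : hitting_time0 (absorb0 x) = hitting_time0 (absorb0 y).
  congr ereal_inf; apply/seteqP; split => [_ [t [t0 E] <-]|_ [t [t0 E] <-]]; exists t => //;
    split => //; move: E; rewrite (axy t (ltW t0))//.
have Cl s : clock (absorb0 x) s = clock (absorb0 y) s.
  by apply: eq_integral => u; rewrite inE/= in_itv/= => /andP[u0 _]; rewrite axy.
have Li : map_lifetime (absorb0 x) = map_lifetime (absorb0 y).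
  by rewrite /map_lifetime H'; apply: eq_integral => u; rewrite inE/= => -[u0 _]; rewrite axy.
have Ti t : time_change (absorb0 x) t = time_change (absorb0 y) t.
  by rewrite /time_change; congr inf; apply/seteqP; split => s /=; rewrite Cl.
apply/funext => t; rewrite /underlying_map Li Ti; case: ifP => // _.
rewrite axy//; pose A := [set s : R | 0 < s /\ (t%:E < clock (absorb0 y) s)%E].
rewrite -[time_change _ _]/(inf A).
(* The infimum of the empty set is 0 by convention, so the time change is nonnegative even when the
   clock never passes t. *)
have [A0|/set0P A0] := eqVneq A set0; first by rewrite A0 inf0.
by apply: lb_le_inf => // s [/ltW].
Qed.

End CongruentPaths.

(** * The time change of reflected Brownian motion *)

Section BrownianClock.
Context {R : realType} {d : nat} {disp : measure_display} {T : measurableType disp}.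
Variables (P : probability T R) (r : 'rV[R]_d) (B : 'I_d -> R -> T -> R).
Hypotheses (or : orthant r) (r0 : r != 0) (hB : forall i, brownian_motion P (r 0 i) (B i)).

Definition bm_reflected w : R -> 'rV[R]_d := reflected_path (bm_path B w).

Local Notation Z := bm_reflected.
Local Notation g w := (fun u => norm1 (Z w u)).
Local Notation sT u := (g_sigma_algebraType (bm_events B (fun=> [set v | v <= u]))).

Lemma skorokhod_bm_reflected w t : 0 <= t ->
  skorokhod_reflection (fun i t => B i t w) t = Z w t.
Proof.
move=> t0; apply/rowP => i; rewrite !mxE /reflected /pushing bm_path_pos// max_r//.
congr (_ - Num.min 0 (inf _)); apply/seteqP; split => [_ [s st <-]|_ [s st <-]]; exists s => //;
  by rewrite bm_path_pos//; move: st; rewrite /= in_itv/= => /andP[].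
Qed.

Lemma continuous_Z w t : {for t, continuous (Z w)}.
Proof. by apply: continuous_path => i; exact: continuous_bm_path. Qed.

Lemma orthant_Z w t : 0 <= t -> orthant (Z w t).
Proof. by apply: orthant_path => i; exact: continuous_bm_path. Qed.

Lemma Z0 w : Z w 0 = r.
Proof.
apply/rowP => i; rewrite mxE /reflected /pushing maxxx.
have cb : continuous (bm_path B w i) by exact: continuous_bm_path.
have [c [c0 -> _]] := running_inf_attained (lexx 0) cb.
have -> : c = 0 by apply/eqP; rewrite eq_le andbC.
by rewrite bm_path_pos// (bm_start (hB i)) min_l ?oppr0 ?addr0//; exact: or.
Qed.

Lemma Z0_neq0 w : Z w 0 != 0. Proof. by rewrite Z0. Qed.

Lemma measurable_sT_mono dU (U : measurableType dU) u v (f : T -> U) : u <= v ->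
  measurable_fun [set: sT u] f -> measurable_fun [set: sT v] f.
Proof.
move=> uv mf _ Y mY; rewrite setTI; apply: (bm_sigma_mono uv).
by have := mf measurableT _ mY; rewrite setTI.
Qed.

Lemma measurable_Z_coord u v i : 0 <= v <= u -> measurable_fun [set: sT u] (fun w => Z w v 0 i).
Proof. by move=> /andP[v0 vu]; apply: measurable_sT_mono vu _; exact: measurable_path_coord. Qed.

Lemma measurable_norm1_Z u v : 0 <= v <= u -> measurable_fun [set: sT u] (fun w => norm1 (Z w v)).
Proof.
move=> vu; apply: measurable_sum => i; apply: measurableT_comp => //; exact: measurable_Z_coord.
Qed.

Lemma bm_sigma_above delta u : 0 <= u -> bm_sigma B u [set w | above (g w) delta u].
Proof.
move=> u0.
have cg w : continuous (g w) by exact: (continuous_norm1_comp (@continuous_Z w)).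
rewrite (_ : [set w | _] = [set w | delta <= running_inf (g w) u]); last first.
  by apply/seteqP; split => w /=; rewrite above_running_inf.
have mr : measurable_fun [set: sT u] (fun w => running_inf (g w) u).
  apply: (@measurable_running_inf _ _ (sT u) u (fun v w => norm1 (Z w v))) => //.
  by move=> v vu; exact: measurable_norm1_Z.
have := measurable_fun_ler (measurable_cst delta) mr measurableT (Y := [set true]) I.
by rewrite setTI.
Qed.

Lemma measurable_rate delta u v : 0 <= v <= u -> 0 < delta ->
  measurable_fun [set: sT u] (fun w => rate (Z w) delta v).
Proof.
move=> vu d0.
pose k (x : R) := (Num.max x delta ^+ 2)^-1.
rewrite (_ : (fun w => _) = k \o (fun w => norm1 (Z w v)))//.
apply: measurableT_comp; last exact: measurable_norm1_Z.
apply: continuous_measurable_fun => x.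
have mE (t : R) : Num.max t delta = (t + delta + `|t - delta|) / 2.
  by rewrite /Num.max; case: ltP => xd; [rewrite ltr0_norm|rewrite ger0_norm]; lra.
have cm : {for x, continuous (fun x => Num.max x delta)}.
  rewrite (_ : (fun u => _) = (fun u => (u + delta + `|u - delta|) / 2)); last by apply/funext => t.
  apply: cvgMl; apply: cvgD; first by apply: cvgD; [exact: cvg_id|exact: cvg_cst].
  by apply: cvg_norm; apply: cvgB; [exact: cvg_id|exact: cvg_cst].
have m0 : Num.max x delta ^+ 2 != 0 by rewrite expf_neq0// gt_eqF// lt_max d0 orbT.
by apply: cvgV => //; apply: (@continuous_comp _ _ _ (fun x => Num.max x delta) (fun x : R => x ^+ 2)) => //; exact: exprn_continuous.
Qed.

Lemma measurable_pclock delta u : 0 <= u -> 0 < delta ->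
  measurable_fun [set: sT u] (fun w => pclock (Z w) delta u).
Proof.
rewrite le_eqVlt => /predU1P[<- d0|u0 d0].
  by rewrite (_ : (fun w => _) = cst 0)//; apply/funext => w; exact: pclock0.
apply: (@measurable_fun_cvg _ (sT u) R setT (fun n w => \sum_(k < n.+1) rate (Z w) delta ((k + false)%:R * (u / n.+1%:R)) * (u / n.+1%:R))) => //.
  move=> n; apply: measurable_sum => k; apply: measurable_funM => //.
  by apply: measurable_rate => //; rewrite addn0; apply: grid_in; [exact: ltW|exact: ltnW].
move=> w _; apply: (@cvg_riemann_sum _ false _ _ (delta ^+ 2)^-1) => //.
  by move=> s _; rewrite gtr0_norm ?rate_gt0// rate_le.
move=> s _ e e0; have /cvgrPdist_le/(_ _ e0)[x /= x0 xP] := continuous_rate (@continuous_Z w) d0 (x := s).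
by exists x => // v _ vs; rewrite distrC; apply: xP; rewrite /ball_ /= distrC.
Qed.

(** By real time u the clock has passed the reading v and the path has stayed above [delta]: a form
    of survival up to MAP time v that is known at Brownian time u. *)
Definition clock_past delta u v : set T :=
  [set w | above (g w) delta u /\ v < pclock (Z w) delta u].

Lemma bm_sigma_clock_past delta u v : 0 <= u -> 0 < delta -> bm_sigma B u (clock_past delta u v).
Proof.
move=> u0 d0; apply: sigma_setI; first exact: bm_sigma_above.
have := measurable_fun_ltr (measurable_cst v) (measurable_pclock u0 d0) measurableT (Y := [set true]) I.
by rewrite setTI.
Qed.

Lemma clock_past_clock_at delta u v w : 0 <= u -> 0 < delta -> 0 <= v -> clock_past delta u v w ->
  exists2 a, 0 <= a <= u & clock_at (Z w) a v /\ pclock (Z w) delta a = v.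
Proof.
move=> u0 d0 v0 [ab lt]; have [|a /andP[a0 au] E] := pclock_ivt (@continuous_Z w) d0 u0 (t := v).
  by rewrite v0 ltW.
exists a; first by rewrite a0.
by split => //; split => //; exists delta => //; split => //; exact: above_le ab.
Qed.

(** On this event the state is Z at the random time a <= u where the clock reads v. It is a limit of
    stopped telescoping sums, in which the condition t_k <= a is replaced by the clock at t_k being
    at most v, which is known at time t_k. *)
Lemma measurable_state_past delta u v s i : 0 <= u -> 0 < delta -> 0 <= v <= s ->
  measurable_fun [set: sT u] (fun w => \1_(clock_past delta u s) w * state (Z w) v 0 i).
Proof.
rewrite le_eqVlt => /predU1P[<- d0 /andP[v0 vs]|u0 d0 /andP[v0 vs]].
  rewrite (_ : (fun w => _) = cst 0)//; apply/funext => w; rewrite indicE memNset ?mul0r//= => -[_].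
  by rewrite pclock0 => /(le_lt_trans (le_trans v0 vs)); rewrite ltxx.
have sE := bm_sigma_clock_past s (ltW u0) d0.
have mE : measurable_fun [set: sT u] (\1_(clock_past delta u s) : T -> R).
  exact: (@measurable_indic _ (sT u)).
pose t n k := k%:R * (u / n.+1%:R) : R.
pose S n w := Z w 0 0 i + \sum_(k < n.+1) (pclock (Z w) delta (t n k) <= v)%R%:R *
  (Z w (t n k.+1) 0 i - Z w (t n k) 0 i).
have tin n k : (k <= n.+1)%N -> 0 <= t n k <= u by apply: grid_in; exact: ltW.
apply: (@measurable_fun_cvg _ (sT u) R setT (fun n w => \1_(clock_past delta u s) w * S n w)) => //.
  move=> n; apply: measurable_funM => //; apply: measurable_funD.
    by apply: measurable_Z_coord; rewrite lexx ltW.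
  apply: measurable_sum => k; apply: measurable_funM.
    have /andP[t0 tu] := tin n k (ltnW (ltn_ord k)).
    have mp := measurable_sT_mono tu (measurable_pclock t0 d0).
    have mb := measurable_fun_ler mp (measurable_cst v).
    rewrite (_ : (fun w => _) = (\1_[set w | pclock (Z w) delta (t n k) <= v] : T -> R)).
      apply: (@measurable_indic _ (sT u)); have := mb measurableT [set true] I; by rewrite setTI.
    apply/funext => w; rewrite indicE; have [h|h] := boolP (_ <= v).
      by rewrite mem_set.
    by rewrite memNset//=; apply/negP.
  apply: measurable_funB; apply: measurable_Z_coord; apply: tin => //; exact: ltnW.
move=> w _; rewrite indicE; have [Ew|Ew] := boolP (w \in _); last first.
  by under eq_fun do rewrite mul0r; rewrite mul0r; exact: cvg_cst.
rewrite inE in Ew.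
have [|a /andP[a0 au] [ca Ea]] := @clock_past_clock_at delta u v w (ltW u0) d0 v0.
  by case: Ew => h1 h2; split => //; exact: le_lt_trans vs h2.
under eq_fun do rewrite mul1r; rewrite mul1r (state_alive (@continuous_Z w) (@orthant_Z w) (Z0_neq0 w) v0 ca).
have -> : Z w a 0 i = Z w 0 0 i + (Z w a 0 i - Z w 0 0 i) by rewrite addrC subrK.
apply: cvgD; first exact: cvg_cst.
have -> : (fun n => \sum_(k < n.+1) (pclock (Z w) delta (t n k) <= v)%R%:R *
  (Z w (t n k.+1) 0 i - Z w (t n k) 0 i)) =
  (fun n => \sum_(k < n.+1) (t n k <= a)%R%:R * (Z w (t n k.+1) 0 i - Z w (t n k) 0 i)).
  apply/funext => n; apply: eq_bigr => k _; congr (_%:R * _).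
  have /andP[t0 tu] := tin n k (ltnW (ltn_ord k)).
  have [ta|at_] := leP (t n k) a; first by rewrite -Ea pclock_le//; exact: continuous_Z.
  have lt : v < pclock (Z w) delta (t n k) by rewrite -Ea pclock_lt//; exact: continuous_Z.
  by rewrite leNgt lt.
apply: (@cvg_telescope_stopped _ (fun u => Z w u 0 i)) => //; first by rewrite a0.
apply: (@continuous_comp _ _ _ (Z w) (fun x : 'rV[R]_d => x 0 i)); first exact: continuous_Z.
exact: continuous_coord.
Qed.

End BrownianClock.

(** * The natural filtration of the MAP inside the Brownian one *)

Section NaturalFiltration.
Context {R : realType} {d : nat} {disp : measure_display} {T : measurableType disp}.
Variables (P : probability T R) (r : 'rV[R]_d) (B : 'I_d -> R -> T -> R).
Hypotheses (or : orthant r) (r0 : r != 0) (hB : forall i, brownian_motion P (r 0 i) (B i)).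

Local Notation Z := (bm_reflected B).
Local Notation g w := (fun u => norm1 (Z w u)).
Local Notation cZ w := (@continuous_Z _ _ _ _ _ _ _ hB w).
Local Notation oZ w := (@orthant_Z _ _ _ _ _ _ _ hB w).
Local Notation Z0n w := (Z0_neq0 or r0 hB w).

Definition bm_map t w := underlying_map (absorb0 (Z w)) t.

Local Notation natF := (natural_filtration bm_map).

(** The sets A with this property form a sigma-algebra, complements being taken relative to the
    event. On a generator, the MAP at v <= s is [polar] of the state at v, which is measurable at
    time u on the event. *)
Lemma filtration_past s A delta u : 0 <= s -> natF s A -> 0 <= u -> 0 < delta ->
  bm_sigma B u (A `&` clock_past B delta u s).
Proof.
move=> s0 sA u0 d0; set E := clock_past B delta u s.
have sE : bm_sigma B u E by apply: (bm_sigma_clock_past hB).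
suff : natF s `<=` [set A | bm_sigma B u (A `&` E)] by move=> /(_ _ sA).
apply: smallest_sub; first split.
- by rewrite /= set0I; exact: (@measurable0 _ (g_sigma_algebraType _)).
- move=> C /= sC; rewrite (_ : _ `&` E = E `\` (C `&` E)).
    exact: (@measurableD _ (g_sigma_algebraType _)).
  by apply/seteqP; split => w; [move=> [[_ nC] Ew]; split => // -[]|move=> [Ew nC]; split => //; split => // Cw; apply: nC].
- move=> F sF; rewrite /= setI_bigcupl; exact: (@bigcupT_measurable _ (g_sigma_algebraType _)).
move=> _ [v [j [Y [v0 vs mY ->]]]] /=.
pose z w : 'rV[R]_d := \1_E w *: state (Z w) v.
have zE w : E w -> z w = state (Z w) v by move=> Ew; rewrite /z indicE mem_set// scale1r.
have mp : measurable_fun [set: g_sigma_algebraType (bm_events B (fun=> [set v | v <= u]))] (fun w => polar (z w) 0 j).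
  apply: (@measurable_orthant_fun _ _ (g_sigma_algebraType _) d z (fun x => polar x 0 j)).
  - move=> i; rewrite (_ : (fun w => _) = (fun w => \1_E w * state (Z w) v 0 i)); last by apply/funext => w; rewrite mxE.
    by apply: (measurable_state_past or r0 hB) => //; rewrite v0.
  - move=> w i; rewrite mxE mulr_ge0 ?indicE//; exact: (orthant_state (cZ w) (oZ w) (Z0n w) v0).
  - move=> y oy y0; apply: (@continuous_comp _ _ _ polar (fun x : 'rV[R]_(1 + d) => x 0 j)).
      exact: continuous_polar (total_gt0 oy y0).
    exact: continuous_coord.
have := sigma_setI (mp measurableT _ mY) sE; rewrite setTI.
congr bm_sigma; apply/seteqP; split => w [h Ew]; split => //; move: (h).
  move=> /=; rewrite zE//.
all: have [|a _ [ca _]] := @clock_past_clock_at _ _ _ _ _ _ _ hB delta u v w u0 d0 v0.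
all: try by case: Ew => h1 h2; split => //; exact: le_lt_trans vs h2.
  rewrite (state_alive (cZ w) (oZ w) (Z0n w) v0 ca) => Yw.
  by exists (polar (Z w a)) => //; exact: (underlying_map_alive (cZ w) (oZ w) (Z0n w) v0 ca).
rewrite /= zE// (state_alive (cZ w) (oZ w) (Z0n w) v0 ca) => -[y].
by rewrite /bm_map (underlying_map_alive (cZ w) (oZ w) (Z0n w) v0 ca) => -[<-].
Qed.

(** A generator at v only concerns paths alive at v. Each of them is past v at some rational real
    time, above some level 1 / (l + 1), so the generator is a countable union of events from
    [filtration_past]. *)
Lemma natural_filtration_measurable t : natF t `<=` measurable.
Proof.
apply: smallest_sub; first exact: sigma_algebra_measurable.
move=> _ [v [j [Y [v0 vs mY ->]]]].
set A := [set w | _].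
have sA : natF v A by apply: sub_sigma_algebra; exists v, j, Y; split.
pose E (ql : rat * nat) := if 0 <= ratr ql.1 :> R then A `&` clock_past B ql.2.+1%:R^-1 (ratr ql.1) v else set0.
rewrite (_ : A = \bigcup_ql E ql).
  apply: countable_bigcupT_measurable => // -[q l]; rewrite /E /=; case: ifP => // q0.
  by apply: (bm_sigma_measurable hB (K := fun=> [set x | x <= ratr q])); exact: filtration_past.
apply/seteqP; split => [w Aw|w [[q l] _]]; last by rewrite /E; case: ifP => // _ [].
have [y Xy _] := Aw.
have [[u cu _]|[no _]] := state_cases (cZ w) (oZ w) (Z0n w) v0; last first.
  by move: Xy; rewrite /bm_map (underlying_map_dead (cZ w) (Z0n w) v0 no).
have [delta [x [d0 ux _ ab Eu]]] := clock_at_right (cZ w) cu ltr01.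
have [q] := rat_in_itvoo ux; rewrite in_itv/= => /andP[uq qx].
have q0 : 0 <= ratr q :> R by rewrite (le_trans cu.1)// ltW.
pose l := (Num.truncn delta^-1).
have ld : l.+1%:R^-1 <= delta.
  by rewrite invf_ple ?posrE//; apply/ltW/truncnS_gt.
exists (q, l) => //; rewrite /E /= q0; split => //.
have abq : above (g w) delta (ratr q) by apply: above_le ab; exact: ltW.
have abl : above (g w) l.+1%:R^-1 (ratr q) by exact: above_mono abq.
split => //; rewrite -(@pclockE _ _ _ delta l.+1%:R^-1)// -Eu.
by apply: pclock_lt => //; [exact: continuous_Z|exact: cu.1].
Qed.

Lemma natural_filtration_filtration : filtration natF.
Proof.
split.
- move=> t _; exact: smallest_sigma_algebra.
- by move=> t _; exact: natural_filtration_measurable.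
- move=> s t s0 st; apply: sigma_subset => _ [v [j [Y [v0 vs mY ->]]]].
  by apply: sub_sigma_algebra; exists v, j, Y; split => //; exact: le_trans st.
Qed.

Local Notation gens t := [set A | exists u (i : 'I_(1 + d)) (Y : set R),
         [/\ 0 <= u, u <= t, measurable Y &
             A = [set w | exists2 y, bm_map u w = Some y & Y (y 0 i)]]].
Local Notation nT t := (g_sigma_algebraType (gens t)).

Lemma measurable_map_coord t v j : 0 <= v <= t ->
  measurable_fun [set: nT t] (fun w => oapp (fun y : 'rV[R]_(1 + d) => y 0 j) 0 (bm_map v w)).
Proof.
move=> /andP[v0 vt] _ Y mY; rewrite setTI.
have G S : measurable S -> natF t [set w | exists2 y, bm_map v w = Some y & S (y 0 j)].
  by move=> mS; apply: sub_sigma_algebra; exists v, j, S.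
(* Dead paths take the value 0. If 0 lies in Y they belong to the preimage, and are obtained as the
   complement of the generator for the whole line. *)
have [Y0|Y0] := pselect (Y 0).
  rewrite (_ : _ @^-1` Y = [set w | exists2 y, bm_map v w = Some y & Y (y 0 j)] `|`
      ~` [set w | exists2 y, bm_map v w = Some y & [set: R] (y 0 j)]).
    apply: (@measurableU _ (nT t)); first exact: G.
    by apply: (@measurableC _ (nT t)); exact: G.
  apply/seteqP; split => w /=; case E: (bm_map v w) => [y|] /=.
  - by move=> Yy; left; exists y.
  - by move=> _; right => -[].
  - by move=> [[z [<-]]|] // h; exfalso; apply: h; exists y.
  - by [].
rewrite (_ : _ @^-1` Y = [set w | exists2 y, bm_map v w = Some y & Y (y 0 j)]); first exact: G.
apply/seteqP; split => w /=; case E: (bm_map v w) => [y|] //=.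
- by move=> Yy; exists y.
- by move=> [z [<-]].
- by move=> [].
Qed.

Lemma measurable_state t v i : 0 <= v <= t -> measurable_fun [set: nT t] (fun w => state (Z w) v 0 i).
Proof.
move=> vt; rewrite (_ : (fun w => _) = (fun w =>
  expR (oapp (fun y : 'rV[R]_(1 + d) => y 0 (lshift d 0)) 0 (bm_map v w)) *
  oapp (fun y : 'rV[R]_(1 + d) => y 0 (rshift 1 i)) 0 (bm_map v w))).
  apply: measurable_funM; last exact: measurable_map_coord.
  by apply: measurableT_comp => //; exact: measurable_map_coord.
apply/funext => w; rewrite /state /cartesian -/(bm_map v w).
by case: (bm_map v w) => [y|] /=; rewrite !mxE// mulr0.
Qed.

Lemma measurable_state_fun t v (h : 'rV[R]_d -> R) : 0 <= v <= t ->
  (forall x, orthant x -> x != 0 -> {for x, continuous h}) ->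
  measurable_fun [set: nT t] (fun w => h (state (Z w) v)).
Proof.
move=> vt ch; have v0 : 0 <= v by case/andP: vt.
apply: (@measurable_orthant_fun _ _ (nT t) d (fun w => state (Z w) v)) => //.
- by move=> i; exact: measurable_state.
- by move=> w; exact: (orthant_state (cZ w) (oZ w) (Z0n w) v0).
Qed.

Lemma measurable_state_integral t (h : 'rV[R]_d -> R) K : 0 <= t ->
  (forall x, orthant x -> x != 0 -> {for x, continuous h}) ->
  (forall x, orthant x -> `|h x| <= K) ->
  measurable_fun [set: nT t] (fun w => \int[lebesgue_measure]_(s in `[0, t]) h (state (Z w) s)).
Proof.
rewrite le_eqVlt => /predU1P[<- _ _|t0 ch hK].
  by rewrite (_ : (fun w => _) = cst 0)//; apply/funext => w; rewrite set_itv1 Rintegral_set1.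
apply: (@measurable_fun_cvg _ (nT t) R setT (fun n w => \sum_(k < n.+1) h (state (Z w) ((k + true)%:R * (t / n.+1%:R))) * (t / n.+1%:R))) => //.
  move=> n; apply: measurable_sum => k; apply: measurable_funM => //.
  by apply: measurable_state_fun => //; apply: grid_in; [exact: ltW|rewrite addn1].
move=> w _; apply: (@cvg_riemann_sum _ true (fun s => h (state (Z w) s)) _ K) => //.
  by move=> s /andP[s0 _]; apply: hK; exact: (orthant_state (cZ w) (oZ w) (Z0n w) s0).
move=> s; rewrite in_itv/= => /andP[s0 _] e e0.
exact: (state_right_continuous (cZ w) (oZ w) (Z0n w) ch s0 e0).
Qed.

End NaturalFiltration.

Lemma sigma_cst (T : pointedType) (G : set (set T)) (Q : Prop) : <<s G >> [set _ : T | Q].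
Proof.
have [q|q] := pselect Q.
  by rewrite (_ : [set _ | _] = setT); [exact: sigma_setT|apply/seteqP; split].
rewrite (_ : [set _ | _] = set0); first exact: (@measurable0 _ (g_sigma_algebraType G)).
by apply/seteqP; split.
Qed.

Section Indicators.
Context {R : realType} {disp : measure_display} {T : measurableType disp}.
Variable P : probability T R.

Lemma Rintegral_indicator (D : set T) : measurable D ->
  P.-integrable [set: T] (EFin \o (\1_D : T -> R)) /\ \int[P]_w (\1_D w : R) = fine (P D).
Proof.
move=> mD; split; last by rewrite /Rintegral integral_indic// setIT.
apply: (integrable_le (g := fun=> 1)); first exact: measurable_indic.
  by move=> w; rewrite indicE; case: (_ \in _); rewrite ?normr0 ?normr1.
exact: (mean_le_cst P 1).1.
Qed.

Lemma markov_mean (D : set T) (Y : T -> R) (a C : R) : measurable D -> (forall w, 0 <= Y w) ->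
  0 <= a -> (forall w, D w -> a <= Y w) -> mean_le P Y C -> a * fine (P D) <= C.
Proof.
move=> mD Y0 a0 DY [iY YC]; have [i1 <-] := Rintegral_indicator mD.
rewrite -RintegralZl//; apply: le_trans YC.
apply: le_Rintegral_setT => //; first exact: (integrableZl measurableT a i1).
move=> w; rewrite indicE; case: (boolP (w \in D)) => [|_]; last by rewrite mulr0.
by rewrite inE mulr1 => /DY.
Qed.

End Indicators.

(** * Neither absorption nor explosion of the clock *)

Section Survival.
Context {R : realType} {d : nat} {disp : measure_display} {T : measurableType disp}.
Variables (P : probability T R) (r : 'rV[R]_d) (B : 'I_d -> R -> T -> R).
Hypotheses (hd : (2 <= d)%N) (or : orthant r) (r0 : r != 0)
  (hB : forall i, brownian_motion P (r 0 i) (B i)) (hBind : independent_processes P B).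

Local Notation Z := (bm_reflected B).
Local Notation g w := (fun u => norm1 (Z w u)).
Local Notation S N w := (path_bound (bm_path B w) N).

Let cb w i : continuous (bm_path B w i). Proof. exact: continuous_bm_path. Qed.

Let cg w : continuous (g w). Proof. exact: (continuous_norm1_comp (@continuous_Z _ _ _ _ _ _ _ hB w)). Qed.

Lemma measurable_above delta u : 0 <= u -> measurable [set w | above (g w) delta u].
Proof.
by move=> u0; apply: (bm_sigma_measurable hB (K := fun=> [set v | v <= u])); exact: (bm_sigma_above hB).
Qed.

Lemma norm1_Z_le N w u : 0 <= u <= N -> norm1 (Z w u) <= 2 * S N w.
Proof. by move=> uN; exact: (norm1_path_le (@cb w) uN). Qed.

Let K N := 32 * d%:R * \sum_i (r 0 i ^+ 2 + N).

(* Dynkin's formula for the subharmonic function [ln (delta^2 + |x|^2)], stopped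
   when the norm falls below [delta]. *)
Lemma low_norm_prob N delta : 0 < N -> 0 < delta -> delta <= norm1 r ->
  - ln (2 * delta ^+ 2) * fine (P (~` [set w | above (g w) delta N])) <=
  delta ^+ 2 + 4 * K N - ln (delta ^+ 2 + sqnorm r).
Proof.
move=> N0 d0 dr.
have e0 : 0 < delta ^+ 2 by rewrite exprn_gt0.
have [C nd] := neumann_data_log_sq (d := d) e0 delta.
set G := log_sq (delta ^+ 2) in nd; set q := log_sq_q (delta ^+ 2) in nd.
pose J u : set T := [set w | 0 < u] `&` [set w | above (g w) delta u].
have sJ u : 0 <= u <= N -> bm_sigma B u (J u).
  move=> /andP[u0 _]; apply: sigma_setI; last exact: (bm_sigma_above hB).
  exact: sigma_cst.
have gd w : delta <= g w 0 by rewrite (Z0 or hB).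
have ex w := cid (last_time (ltW N0) (@cg w) (gd w)).
pose e w := sval (ex w).
have eP w : [/\ 0 <= e w <= N, forall u, 0 <= u <= N -> above (g w) delta u <-> u <= e w & e w = N \/ g w (e w) = delta] := svalP (ex w).
have [|||iD ED] := @dynkin_formula _ _ _ _ P r B hB hBind delta C G _ q d0 nd N J (fun=> 0) e N0 sJ.
- by move=> w; have [/andP[e1 e2] _ _] := eP w; rewrite lexx.
- move=> u w uN; have [_ eE _] := eP w; split => [[/= u0 /(eE u uN) ue]|/andP[u0 /(eE u uN) ab]]; first by rewrite u0.
  by split.
- move=> u w /andP[u0 ue]; have [/andP[e1 e2] eE _] := eP w.
  have uN : 0 <= u <= N by rewrite (ltW u0) (le_trans ue).
  by apply: ((eE u uN).2 ue); rewrite (ltW u0) lexx.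
pose H := ~` [set w | above (g w) delta N].
have mH : measurable H by apply: measurableC; apply: measurable_above; exact: ltW.
have [i1 E1] := Rintegral_indicator P mH.
set D := (fun w => _ - _ - _) in iD ED.
have S2 := path_bound_moment2 hB hBind N0.
have mU := mean_leD (mean_le_cst P (delta ^+ 2 - G r)) (mean_leZ (ler0n _ 4) S2).
have le w : D w + (- ln (2 * delta ^+ 2)) * \1_H w <= delta ^+ 2 - G r + 4 * S N w ^+ 2.
  have [/andP[e1 e2] eE eN] := eP w.
  have I0 : 0 <= 2^-1 * \int[lebesgue_measure]_(s in `[0, N]) (\1_(J s) w * \sum_i q i i (Z w s)).
    rewrite mulr_ge0//; apply: Rintegral_ge0 => s _; rewrite mulr_ge0 ?indicE//.
    exact: log_sq_laplacian_ge0.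
  have S0 : 0 <= 4 * S N w ^+ 2 by rewrite mulr_ge0 ?sqr_ge0.
  have sq0 : 0 <= sqnorm (Z w (e w)) by exact: sqnorm_ge0.
  have sq1 := sqnorm_le_norm1 (Z w (e w)).
  (* On H the path is stopped at norm [delta], where G is at most ln (2 delta^2). Elsewhere ln x <=
     x and |Z| <= 2 S are used. *)
  have GZ : G (Z w (e w)) - ln (2 * delta ^+ 2) * \1_H w <= delta ^+ 2 + 4 * S N w ^+ 2.
    rewrite indicE; have [Hw|Hw] := boolP (w \in H).
      rewrite mulr1 (@le_trans _ _ 0)//; last by rewrite addr_ge0 ?(ltW e0).
      rewrite subr_le0 /G /log_sq ler_ln ?posrE ?mulr_gt0// ?ltr_wpDr//.
      case: eN => [eN|eN].
        by move: Hw; rewrite inE => -[]; apply: (eE N _).2; rewrite ?eN ?lexx ?ltW.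
      by move: sq1; rewrite -/(g w (e w)) eN; lra.
    rewrite mulr0 subr0 /G /log_sq (le_trans (ltW (ln_sublinear _)))// ?ltr_wpDr// lerD2l.
    apply: (le_trans sq1).
    have -> : 4 * S N w ^+ 2 = (2 * S N w) ^+ 2 by ring.
    by rewrite lerXn2r ?nnegrE ?norm1_ge0 ?mulr_ge0 ?path_bound_ge0// norm1_Z_le// e1.
  rewrite /D -!/(bm_reflected B w) (Z0 or hB); move: I0 GZ; lra.
have iA : P.-integrable [set: T] (EFin \o (fun w => D w + (- ln (2 * delta ^+ 2)) * \1_H w)).
  exact: (integrableD measurableT iD (integrableZl measurableT (- ln (2 * delta ^+ 2)) i1)).
have := le_trans (le_Rintegral_setT iA mU.1 le) mU.2.
rewrite RintegralD//; last exact: (integrableZl measurableT (- ln (2 * delta ^+ 2)) i1).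
by rewrite ED add0r RintegralZl// E1 addrAC.
Qed.

Lemma nonhit_prob N eps : 0 < N -> 0 < eps -> exists2 delta, 0 < delta &
  fine (P (~` [set w | above (g w) delta N])) <= eps.
Proof.
move=> N0 eps0.
pose M := 2 + 4 * `|K N| + `|ln (sqnorm r)|.
have M0 : 0 < M by rewrite /M ltr_pwDl// ltr_pwDl// mulr_ge0.
have nr : 0 < norm1 r by exact: norm1_gt0.
(* As delta^2 <= delta <= x and 2 <= e^2, this gives -ln (2 delta^2) >= M / eps, so the probability
   is at most eps. *)
pose x := expR (- (M / eps) - 2).
have x0 : 0 < x by exact: expR_gt0.
pose delta := Num.min 1 (Num.min (norm1 r) x).
have d0 : 0 < delta by rewrite !lt_min ltr01 nr x0.
have d1 : delta <= 1 by rewrite ge_min lexx.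
have dr : delta <= norm1 r by rewrite !ge_min lexx orbT.
have dx : delta <= x by rewrite !ge_min lexx !orbT.
have x1 : x <= 1.
  have : 0 <= M / eps by rewrite divr_ge0 ?ltW.
  by rewrite -expR0 ler_expR; lra.
exists delta => //.
have := low_norm_prob N0 d0 dr; set p := fine _.
have p0 : 0 <= p by exact: fine_ge0.
have sr : 0 < sqnorm r.
  rewrite lt_neqAle sqnorm_ge0 andbT eq_sym; apply: contra r0 => /eqP sr.
  apply/eqP/rowP => i; rewrite mxE; apply/eqP; rewrite -sqrf_eq0 eq_le sqr_ge0 andbT -sr.
  by rewrite /sqnorm (bigD1 i)//= lerDl sumr_ge0// => j _; exact: sqr_ge0.
have lr : ln (sqnorm r) <= ln (delta ^+ 2 + sqnorm r).
  by rewrite ler_ln ?posrE ?ltr_pwDl ?exprn_gt0// ?lerDr ?sqr_ge0// ltW.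
have dd : delta ^+ 2 <= 1 by rewrite expr_le1// ltW.
have lx : M / eps <= - ln (2 * delta ^+ 2).
  rewrite lerNr -(expRK (- (M / eps))) ler_ln ?posrE ?expR_gt0 ?mulr_gt0 ?exprn_gt0//.
  have -> : expR (- (M / eps)) = expR 2 * x by rewrite /x -expRD; congr expR; ring.
  have e2 : 2 <= expR 2 :> R by rewrite (le_trans _ (expR_ge1Dx 2))//; lra.
  apply: (@le_trans _ _ (expR 2 * delta ^+ 2)); first by rewrite ler_wpM2r// sqr_ge0.
  rewrite ler_wpM2l ?expR_ge0// (le_trans _ dx)// expr2 ler_piMl// ltW//.
move=> h.
have hM : M / eps * p <= M.
  apply: (le_trans (ler_wpM2r p0 lx)); apply: (le_trans h).
  have := ler_norm (K N); have := ler_norm (- ln (sqnorm r)); rewrite normrN /M; lra.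
by move: hM; rewrite mulrAC ler_pdivrMr// ler_pM2l.
Qed.

(** On [2^k, 2^(k+1)] the rate is at least 1 / (4 S^2) and the length is 2^k, so the clock advances
    by at least 1 / W. The added 1 keeps W positive. *)
Let W k w : R := 4 * (1 + S (2 ^+ k.+1) w ^+ 2) / 2 ^+ k.

Let C1 : R := 4 * (1 + 32 * d%:R * \sum_i (r 0 i ^+ 2 + 2)).

(** Brownian scaling: the second moment of S at time 2^(k+1) grows at most like 2^k, which the
    denominator cancels. *)
Let mW k : mean_le P (W k) C1.
Proof.
have k0 : 0 < 2 ^+ k :> R by rewrite exprn_gt0.
have k1 : 1 <= 2 ^+ k :> R by rewrite exprn_ege1// ler1n.
have mS := path_bound_moment2 hB hBind (exprn_gt0 k.+1 (ltr0Sn R 1)).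
have i0 : 0 <= 4 / 2 ^+ k :> R by rewrite divr_ge0// ltW.
have := mean_leZ i0 (mean_leD (mean_le_cst P 1) mS).
rewrite (_ : (fun w => _) = W k); last by apply/funext => w; rewrite /W mulrAC.
move=> [iW EW]; split => //; apply: (le_trans EW); rewrite mulrAC ler_pdivrMr// /C1 -[leRHS]mulrA ler_wpM2l//.
have sle : \sum_i (r 0 i ^+ 2 + 2 ^+ k.+1) <= (\sum_i (r 0 i ^+ 2 + 2)) * 2 ^+ k.
  rewrite mulr_suml; apply: ler_sum => i _; rewrite (exprS 2 k); have := sqr_ge0 (r 0 i); move: k1.
  by move: (2 ^+ k) (r 0 i ^+ 2) => z a; nra.
have := ler_wpM2l (ler0n R d) sle; move: k1.
move: (\sum_i _) (\sum_i _) (2 ^+ k) (d%:R) => x y z t; lra.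
Qed.

(** Expanding (1 - c W)^2 >= 0 bounds 1 / W below by a function affine in W, so that a bound on the
    mean of W is enough. The parameter c is free until [alive_prob]. *)
Lemma pclock_ge c delta n w : 0 < delta -> above (g w) delta (2 ^+ n) ->
  2 * c * n%:R - c ^+ 2 * \sum_(k < n) W k w <= pclock (Z w) delta (2 ^+ n).
Proof.
move=> d0; elim: n => [|n IH] ab.
  rewrite big_ord0 !mulr0 subr0 -(pclock0 (Z w) delta).
  by apply: pclock_le => //; exact: continuous_Z.
have n0 : 0 <= 2 ^+ n :> R by rewrite exprn_ge0.
have ngt0 : 0 < 2 ^+ n :> R by rewrite exprn_gt0.
have nn : 2 ^+ n <= 2 ^+ n.+1 :> R by rewrite ler_weXn2l// ler1n.
have {}IH := IH (above_le nn ab).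
have cr := continuous_rate (@continuous_Z _ _ _ _ _ _ _ hB w) d0.
suff step : 2 * c - c ^+ 2 * W n w <= pclock (Z w) delta (2 ^+ n.+1) - pclock (Z w) delta (2 ^+ n).
  by rewrite big_ord_recr/= -natr1; move: IH step; lra.
have V0 : 0 < 4 * (1 + S (2 ^+ n.+1) w ^+ 2) :> R by rewrite mulr_gt0// ltr_wpDr// sqr_ge0.
rewrite /pclock iclockB//.
apply: (@le_trans _ _ ((4 * (1 + S (2 ^+ n.+1) w ^+ 2))^-1 * (2 ^+ n.+1 - 2 ^+ n))).
  have -> : 2 ^+ n.+1 - 2 ^+ n = 2 ^+ n :> R by rewrite exprS; ring.
  have -> : (4 * (1 + S (2 ^+ n.+1) w ^+ 2))^-1 * 2 ^+ n = (W n w)^-1 by rewrite /W invf_div mulrC.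
  have W0 : 0 < W n w by rewrite divr_gt0.
  have Wi : W n w * (W n w)^-1 = 1 by rewrite divff// gt_eqF.
  have Wi0 : 0 < (W n w)^-1 by rewrite invr_gt0.
  have := mulr_ge0 (ltW Wi0) (sqr_ge0 (1 - c * W n w)).
  have -> : (W n w)^-1 * (1 - c * W n w) ^+ 2 = (W n w)^-1 - 2 * c * (W n w * (W n w)^-1) + c ^+ 2 * W n w * (W n w * (W n w)^-1) by ring.
  by rewrite Wi; lra.
rewrite -Rintegral_itv_cst//; apply: le_Rintegral => //.
- exact: integrable_itv_cst.
- exact: continuous_integrable_itv.
move=> u; rewrite /= in_itv/= => /andP[nu un].
have u0 : 0 <= u by exact: le_trans nu.
have gu : delta <= g w u by apply: ab; rewrite u0.
have g0 : 0 < g w u by exact: lt_le_trans gu.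
rewrite /rate max_l// lef_pV2 ?posrE ?exprn_gt0//.
have := norm1_Z_le w (N := 2 ^+ n.+1) (u := u); rewrite u0 un => /(_ isT) gS.
have -> : 4 * (1 + S (2 ^+ n.+1) w ^+ 2) = 4 + (2 * S (2 ^+ n.+1) w) ^+ 2 by ring.
by rewrite ler_wpDl// lerXn2r ?nnegrE ?(ltW g0)// (le_trans (ltW g0)).
Qed.

Lemma alive_prob t eps : 0 <= t -> 0 < eps -> exists N delta, [/\ 0 <= N, 0 < delta &
  fine (P (~` clock_past B delta N t)) <= eps].
Proof.
move=> t0 eps0; have e2 : 0 < eps / 2 by rewrite divr_gt0.
have C10 : 0 < C1.
  rewrite /C1 mulr_gt0// ltr_wpDr// !mulr_ge0//; apply: sumr_ge0 => i _.
  by rewrite addr_ge0 ?sqr_ge0.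
(* With n such that t <= c n, failure to reach t forces c^2 times the sum of the W_k to be at least
   c n. Its mean is at most c^2 n C1, so Markov's inequality gives probability at most c C1 = eps /
   2. *)
pose c := eps / 2 / C1; have c0 : 0 < c by rewrite divr_gt0.
pose n := (Num.truncn (t / c)).+1.
have tn : t <= c * n%:R by rewrite mulrC -ler_pdivrMr// ltW// truncnS_gt.
have n0 : 0 < n%:R :> R by [].
have N0 : 0 < 2 ^+ n :> R by rewrite exprn_gt0.
have [delta d0 dP] := nonhit_prob N0 e2.
exists (2 ^+ n), delta; split => //.
pose D := [set w | 2 * c * n%:R - t <= c ^+ 2 * \sum_(k < n) W k w].
have mY := mean_leZ (sqr_ge0 c) (mean_le_sum (fun k : 'I_n => mW k)).
have mD : measurable D.
  rewrite -[D]setTI; have mYf : measurable_fun [set: T] (fun w => c ^+ 2 * \sum_(k < n) W k w).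
    by apply/measurable_EFinP; exact: measurable_int mY.1.
  exact: (measurable_fun_ler (measurable_cst (2 * c * n%:R - t)) mYf measurableT (Y := [set true])).
have mA := measurable_above delta (ltW N0).
have W0 k w : 0 <= W k w.
  by rewrite /W divr_ge0 ?exprn_ge0// mulr_ge0// addr_ge0// sqr_ge0.
have cn : c * n%:R <= 2 * c * n%:R - t by move: tn; lra.
have cn0 : 0 < c * n%:R by rewrite mulr_gt0.
have PD : fine (P D) <= eps / 2.
  have Y0 w : 0 <= c ^+ 2 * \sum_(k < n) W k w.
    by rewrite mulr_ge0 ?sqr_ge0//; apply: sumr_ge0 => k _.
  have := markov_mean mD Y0 (ltW cn0) (fun w Dw => le_trans cn Dw) mY.
  rewrite sumr_const card_ord -[C1 *+ n]mulr_natl => h.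
  have E : c ^+ 2 * (n%:R * C1) = c * n%:R * (eps / 2).
    by rewrite /c; field; rewrite gt_eqF.
  by move: h; rewrite E ler_pM2l.
have sub : ~` clock_past B delta (2 ^+ n) t `<=` ~` [set w | above (g w) delta (2 ^+ n)] `|` D.
  move=> w nw; have [ab|ab] := pselect (above (g w) delta (2 ^+ n)); last by left.
  right; rewrite /D /=; have := pclock_ge c d0 ab.
  have : pclock (Z w) delta (2 ^+ n) <= t by rewrite leNgt; apply/negP => lt; apply: nw.
  lra.
have mP : measurable (clock_past B delta (2 ^+ n) t).
  apply: (bm_sigma_measurable hB (K := fun=> [set v | v <= 2 ^+ n])).
  exact: (bm_sigma_clock_past hB).
have h : (P (~` clock_past B delta (2 ^+ n) t) <= P (~` [set w | above (g w) delta (2 ^+ n)] `|` D))%E.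
  by apply: le_measure => //; rewrite inE; [exact: measurableC|apply: measurableU => //; exact: measurableC].
have h' := le_trans h (measureU2 _ (measurableC mA) mD).
have f1 := fin_num_measure P _ (measurableC mA); have f2 := fin_num_measure P _ mD.
have f3 := fin_num_measure P _ (measurableC mP).
have := fine_le f3 _ h'; rewrite fineD// fin_numD f1 f2 => /(_ isT); lra.
Qed.

End Survival.

(** * The martingale problem *)

Section AlmostSure.
Context {R : realType} {disp : measure_display} {T : measurableType disp}.
Variable P : probability T R.

Lemma negligible_small (S : set T) : (forall e, 0 < e -> exists A, [/\ measurable A, S `<=` A & fine (P A) <= e]) ->
  P.-negligible S.
Proof.
move=> H; have H' n : {A | [/\ measurable A, S `<=` A & fine (P A) <= n.+1%:R^-1]}.
  by apply: cid; apply: H.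
exists (\bigcap_n sval (H' n)); split.
- by apply: bigcapT_measurable => n; have [] := svalP (H' n).
- have mI : measurable (\bigcap_n sval (H' n)) by apply: bigcapT_measurable => n; have [] := svalP (H' n).
  have f0 := fin_num_measure P _ mI.
  rewrite -(fineK f0); congr EFin; apply/eqP; rewrite eq_le fine_ge0// andbT.
  apply/ler_addgt0Pr => e e0; rewrite add0r.
  pose n := Num.truncn e^-1.
  have ne : n.+1%:R^-1 <= e by rewrite invf_ple ?posrE//; apply/ltW/truncnS_gt.
  have [mA _ h] := svalP (H' n); apply: le_trans ne; apply: le_trans h.
  apply: fine_le => //; first exact: fin_num_measure.
  by apply: le_measure; rewrite ?inE//; exact: bigcap_inf.
- by move=> w Sw n _; have [_ h _] := svalP (H' n); exact: h.
Qed.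

Lemma cvg_Rintegral_ae (f_ : (T -> R)^nat) (f : T -> R) (C : R) :
  (forall n, measurable_fun [set: T] (f_ n)) -> measurable_fun [set: T] f ->
  P.-negligible [set w | ~ f_ n w @[n --> \oo] --> f w] ->
  (forall n x, `|f_ n x| <= C) ->
  \int[P]_x f_ n x @[n --> \oo] --> \int[P]_x f x.
Proof.
move=> mf_ mf cf fC.
have := @dominated_convergence _ _ _ P _ measurableT (fun n => EFin \o f_ n)
  (EFin \o f) (cst C%:E).
case.
- by move=> n; exact/measurable_EFinP.
- exact/measurable_EFinP.
- case: cf => A [mA A0 sA]; exists A; split => // w /= nw; apply: sA => /= h; apply: nw => _.
  by apply: cvg_EFin => //; near=> n.
- exact: finite_measure_integrable_cst.
- by apply: aeW => x n _; rewrite /= lee_fin.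
move=> If _ h; apply: fine_cvg.
by rewrite fineK//; exact: integrable_fin_num.
Unshelve. all: by end_near. Qed.

End AlmostSure.

(** * The window of real times whose clock reading lies in ]s, t] *)

Section ClockWindow.
Context {R : realType} {d : nat}.
Variable y : R -> 'rV[R]_d.
Hypotheses (cy : forall t, {for t, continuous y}) (oy : forall t, 0 <= t -> orthant (y t))
  (y0 : y 0 != 0).

Local Notation g := (fun u => norm1 (y u)).

(** e is the last time in [0, N] up to which the path is above [delta] and the clock at most t, both
    conditions being merged into the minimum [phi]; a is the last time before e with clock at most
    s. If the clock reads t before N and above [delta], these are the exact times of the readings s
    and t. *)
Lemma clock_window delta N s t : 0 < delta -> delta <= g 0 -> 0 <= N -> 0 <= s -> s <= t ->
  exists a e, [/\ 0 <= a <= e /\ e <= N,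
    forall u, 0 <= u <= N -> (above g delta u /\ s < pclock y delta u <= t) <-> a < u <= e,
    above g delta e /\ pclock y delta e <= t &
    forall x z, clock_at y x s -> clock_at y z t -> above g delta z -> z <= N -> a = x /\ e = z].
Proof.
move=> d0 dg N0 s0 st.
have ct := @continuous_pclock _ _ _ cy _ d0.
have cg := @continuous_norm1_comp _ _ _ cy.
have t0 := le_trans s0 st.
pose phi v := Num.min (g v - delta) (t - pclock y delta v).
have cphi : continuous phi.
  move=> v; have mE (x z : R) : Num.min x z = (x + z - `|x - z|) / 2.
    by rewrite /Num.min; case: ltP => xz; [rewrite ltr0_norm|rewrite ger0_norm]; lra.
  rewrite (_ : phi = (fun v => ((g v - delta) + (t - pclock y delta v) - `|(g v - delta) - (t - pclock y delta v)|) / 2)); last first.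
    by apply/funext => x; rewrite /phi mE.
  have c1 : {for v, continuous (fun v => g v - delta)} by apply: cvgB; [exact: cg|exact: cvg_cst].
  have c2 : {for v, continuous (fun v => t - pclock y delta v)} by apply: cvgB; [exact: cvg_cst|exact: ct].
  by apply: cvgMl; apply: cvgB; [exact: cvgD|apply: cvg_norm; exact: cvgB].
have phi0 : 0 <= phi 0 by rewrite /phi le_min subr_ge0 dg pclock0 subr0.
have [e [/andP[e0 eN] eP _]] := last_time N0 cphi phi0.
have phiP u : above phi 0 u <-> above g delta u /\ (forall v, 0 <= v <= u -> pclock y delta v <= t).
  split=> [h|[h1 h2] v vu].
    by split => v vu; have := h v vu; rewrite /phi le_min !subr_ge0 => /andP[].
  by rewrite /phi le_min !subr_ge0 h1//= h2.
have phiP' u : 0 <= u -> above phi 0 u <-> above g delta u /\ pclock y delta u <= t.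
  move=> u0; rewrite phiP; split=> -[h1 h2]; split => //; first by apply: h2; rewrite u0 lexx.
  by move=> v /andP[v0 vu]; apply: le_trans h2; exact: pclock_le.
have cpsi : continuous (fun v => s - pclock y delta v) by move=> v; apply: cvgB; [exact: cvg_cst|exact: ct].
have psi0 : 0 <= s - pclock y delta 0 by rewrite pclock0 subr0.
have [a [/andP[a0 ae] aP _]] := last_time e0 cpsi psi0.
have psiP u : 0 <= u -> above (fun v => s - pclock y delta v) 0 u <-> pclock y delta u <= s.
  move=> u0; split=> [h|h v /andP[v0 vu]]; first by rewrite -subr_ge0; apply: h; rewrite u0 lexx.
  by rewrite subr_ge0; apply: le_trans h; exact: pclock_le.
have ee : 0 <= e <= N by rewrite e0.
have [abe te] : above g delta e /\ pclock y delta e <= t by apply/(phiP' _ e0)/(eP _ ee).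
exists a, e; split => //; first by rewrite a0.
- move=> u /andP[u0 uN]; have uN' : 0 <= u <= N by rewrite u0.
  split=> [[ab /andP[su ut]]|/andP[au ue]].
    have ue : u <= e by apply/(eP _ uN')/(phiP' _ u0).
    rewrite ue andbT ltNge; apply/negP => ua.
    have ue' : 0 <= u <= e by rewrite u0.
    have /(aP _ ue')/(psiP _ u0) := ua.
    by rewrite leNgt su.
  have /(eP _ uN')/(phiP' _ u0)[ab ut] := ue.
  split => //; rewrite ut andbT ltNge; apply/negP => us.
  have ue' : 0 <= u <= e by rewrite u0.
  by have /(psiP _ u0)/(aP _ ue') := us; rewrite leNgt au.
move=> x z cx cz abz zN; have z0 := cz.1; have x0 := cx.1.
have Ez := clock_atP d0 abz cz.
have xz : x <= z.
  have [|v /andP[v0 vz] cv] := clock_at_le cy cz (s := s); first by rewrite s0.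
  by rewrite (clock_at_inj cy cx cv).
have Ex := clock_atP d0 (above_le xz abz) cx.
have zN' : 0 <= z <= N by rewrite z0.
have ze : z <= e by apply/(eP _ zN')/(phiP' _ z0); rewrite Ez.
have ez : e <= z.
  by rewrite leNgt; apply/negP => h; have := pclock_lt cy d0 z0 h; rewrite Ez ltNge te.
have {ez} ez : e = z by apply/eqP; rewrite eq_le ez.
split => //.
have aa : 0 <= a <= e by rewrite a0.
have as_ : pclock y delta a <= s by apply/(psiP _ a0)/(aP _ aa).
have xe : 0 <= x <= e by rewrite x0 ez.
have xa : x <= a by apply/(aP _ xe)/(psiP _ x0); rewrite Ex.
apply/eqP; rewrite eq_le xa andbT leNgt; apply/negP => h.
by have := pclock_lt cy d0 x0 h; rewrite Ex ltNge as_.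
Qed.

Lemma Rintegral_window (z h : R -> R) a e N : 0 <= a -> a <= e -> e <= N ->
  (forall u, 0 <= u <= N -> z u = (a < u <= e)%R%:R) ->
  lebesgue_measure.-integrable `[a, e] (EFin \o h) ->
  \int[lebesgue_measure]_(u in `[0, N]) (z u * h u) = \int[lebesgue_measure]_(u in `[a, e]) h u.
Proof.
move=> a0 ae eN zE ih.
have ih' : lebesgue_measure.-integrable `]a, e] (EFin \o h).
  apply: integrableS ih => //; by move=> x; rewrite /= !in_itv/= => /andP[/ltW -> ->].
rewrite -(Rintegral_itv_obnd_cbnd ih').
transitivity (\int[lebesgue_measure]_(u in `[0, N]) (h \_ `]a, e]) u).
  apply: eq_Rintegral => u; rewrite inE/= in_itv/= => uN; rewrite zE// patchE.
  have [ue|ue] := boolP (a < u <= e); first by rewrite mul1r mem_set//= in_itv.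
  by rewrite mul0r memNset//= in_itv/=; apply/negP.
have E : (`[0, N] `&` `]a, e] = `]a, e] :> set R)%classic.
  apply/seteqP; split => [u []//|u ue]; split => //.
  move: ue; rewrite /= !in_itv/= => /andP[au ue].
  by rewrite (le_trans a0 (ltW au)) (le_trans ue).
by rewrite -Rintegral_mkcondr E.
Qed.

End ClockWindow.

Section GeneratorBound.
Context {R : realType} {d : nat}.
Variable f : 'rV[R]_(1 + d) -> R.
Hypothesis fD : classD f.

Lemma classD_bound : exists2 K, 0 <= K & forall x, RxS x ->
  [/\ `|f x| <= K, forall i, `|pderiv i f x| <= K & forall i j, `|pderiv i (pderiv j f) x| <= K].
Proof.
have [[_ [K HK]] _] := fD; exists (Num.max K 0); first by rewrite le_max lexx orbT.
move=> x /HK[h1 h2 h3]; split => [|i|i j]; rewrite le_max; apply/orP; left.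
- exact: h1.
- exact: h2.
- exact: h3.
Qed.

Lemma simplex_le1 (theta : 'rV[R]_d) k : simplex theta -> 0 <= theta 0 k <= 1.
Proof.
move=> [ot t1]; rewrite ot/= -t1 norm1_orthant// (bigD1 k)//= lerDl.
by apply: sumr_ge0 => j _; exact: ot.
Qed.

Lemma drift_le (theta : 'rV[R]_d) i : simplex theta -> `|drift theta i| <= d%:R + 2.
Proof.
move=> st; have d0 : 0 <= d%:R :> R by [].
rewrite /drift; case: fintype.split => k.
  by rewrite normrN ger0_norm ?divr_ge0//; lra.
have /andP[h1 h2] := simplex_le1 k st.
rewrite ler_norml; apply/andP; split; nra.
Qed.

Lemma diffusion_le (theta : 'rV[R]_d) i j : simplex theta -> `|diffusion theta i j| <= d%:R + 2.
Proof.
move=> st; have d0 : 0 <= d%:R :> R by [].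
have one k : `|1 - d%:R * theta 0 k| <= d%:R + 2.
  by have /andP[h1 h2] := simplex_le1 k st; rewrite ler_norml; apply/andP; split; nra.
rewrite /diffusion; case: fintype.split => k; case: fintype.split => l //.
  by rewrite ger0_norm// lerDl.
have /andP[h1 h2] := simplex_le1 k st; have /andP[h3 h4] := simplex_le1 l st.
move: h1 h2 h3 h4; move: (theta 0 k) (theta 0 l) (d%:R : R) d0 => x z D D0 x0 x1 z0 z1.
have xz0 : 0 <= x * z by exact: mulr_ge0.
have xz1 : x * z <= 1 by rewrite mulr_ile1.
have xx0 : 0 <= x * x by exact: mulr_ge0.
have xx1 : x * x <= 1 by rewrite mulr_ile1.
have d1 : 0 <= D * (x * z) <= D by rewrite mulr_ge0// ler_piMr.
have d2 : 0 <= D * (x * x) <= D by rewrite mulr_ge0// ler_piMr.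
case: ifP => _; rewrite ler_norml; move: d1 d2 => /andP[d1 d1'] /andP[d2 d2'].
  by apply/andP; split; lra.
by apply/andP; split; lra.
Qed.

Lemma generator_bound : exists K, forall x, RxS x -> `|generator f x| <= K.
Proof.
have [K K0 HK] := classD_bound.
exists (\sum_(i < 1 + d) (d%:R + 2) * K + 2^-1 * \sum_(i < 1 + d) \sum_(j < 1 + d) (d%:R + 2) * K).
move=> x xS; have [_ h1 h2] := HK x xS.
have D0 : 0 <= d%:R + 2 :> R by rewrite addr_ge0.
rewrite /generator (le_trans (ler_normD _ _))// lerD//.
  rewrite (le_trans (ler_norm_sum _ _ _))//; apply: ler_sum => i _.
  by rewrite normrM ler_pM//; exact: drift_le.
rewrite normrM ger0_norm ?invr_ge0// ler_wpM2l ?invr_ge0//.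
rewrite (le_trans (ler_norm_sum _ _ _))//; apply: ler_sum => i _.
rewrite (le_trans (ler_norm_sum _ _ _))//; apply: ler_sum => j _.
by rewrite normrM ler_pM//; exact: diffusion_le.
Qed.

(* [f o polar] and [generator f o polar] as functions of the state, the
   cemetery being the origin; the second is written through the Laplacian so
   as to be visibly continuous. *)
Definition state_fun (z : 'rV[R]_d) : R := if z == 0 then 0 else polar_fun f z.

Definition state_gen (z : 'rV[R]_d) : R :=
  if z == 0 then 0 else 2^-1 * (total z * total z) * \sum_i polar_q f i i z.

Lemma state_genE z : orthant z -> z != 0 -> state_gen z = generator f (polar z).
Proof.
move=> oz z0; rewrite /state_gen (negbTE z0) polar_laplacian//.
by have t0 := total_gt0 oz z0; field; rewrite gt_eqF.
Qed.

Lemma continuous_off0 (h : 'rV[R]_d -> R) (z : 'rV[R]_d) : orthant z -> z != 0 -> {for z, continuous h} ->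
  {for z, continuous (fun x : 'rV[R]_d => if x == 0 then 0 else h x)}.
Proof.
move=> oz z0 ch A; rewrite /= (negbTE z0) => hA.
have ct : total x @[x --> z] --> total z := @continuous_total _ _ z.
have n1 : \forall x \near z, 0 < total x by apply: cvgr_gt ct _ _; exact: total_gt0.
have n2 : \forall x \near z, A (h x) := ch A hA.
have E x : 0 < total x -> (x == 0) = false.
  by move=> x0; apply/negbTE; apply: contraTneq x0 => ->; rewrite /total big1 ?ltxx// => i _; rewrite mxE.
suff : \forall x \near z, A (if x == 0 then 0 else h x) by [].
by apply: filterS2 n1 n2 => x x0 Ax; rewrite E.
Qed.

Lemma continuous_state_fun z : orthant z -> z != 0 -> {for z, continuous state_fun}.
Proof.
move=> oz z0; apply: continuous_off0 => //.
have [C nd] := neumann_data_polar fD ltr01; exact: (nd_contG nd).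
Qed.

Lemma continuous_state_gen z : orthant z -> z != 0 -> {for z, continuous state_gen}.
Proof.
move=> oz z0; have [C nd] := neumann_data_polar fD ltr01.
apply: continuous_off0 => //; apply: continuous_at_mul.
  apply: continuous_at_mul; first exact: continuous_at_cst.
  by apply: continuous_at_mul; exact: continuous_total.
by apply: continuous_at_sum => i; exact: (nd_contq nd).
Qed.

Lemma state_fun_bound : exists2 K, 0 <= K & forall z, orthant z -> `|state_fun z| <= K.
Proof.
have [K K0 HK] := classD_bound; exists K => // z oz; rewrite /state_fun.
by case: (eqVneq z 0) => [_|z0]; [rewrite normr0|have [h _ _] := HK _ (polar_RxS oz z0)].
Qed.

Lemma state_gen_bound : exists2 K, 0 <= K & forall z, orthant z -> `|state_gen z| <= K.
Proof.
have [K HK] := generator_bound; exists `|K| => // z oz.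
have [->|z0] := eqVneq z 0; first by rewrite /state_gen eqxx normr0.
by rewrite state_genE//; apply: le_trans (ler_norm K); apply: HK; exact: polar_RxS.
Qed.

End GeneratorBound.

(** * Mean-zero increments on past events, and the martingale property *)

Section MartingaleProblem.
Context {R : realType} {d : nat} {disp : measure_display} {T : measurableType disp}.
Variables (P : probability T R) (r : 'rV[R]_d) (B : 'I_d -> R -> T -> R).
Hypotheses (hd : (2 <= d)%N) (or : orthant r) (r0 : r != 0)
  (hB : forall i, brownian_motion P (r 0 i) (B i)) (hBind : independent_processes P B).
Variable f : 'rV[R]_(1 + d) -> R.
Hypothesis fD : classD f.

Local Notation Z := (bm_reflected B).
Local Notation g w := (fun u => norm1 (Z w u)).
Local Notation cZ w := (@continuous_Z _ _ _ _ _ _ _ hB w).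
Local Notation oZ w := (@orthant_Z _ _ _ _ _ _ _ hB w).
Local Notation Z0n w := (Z0_neq0 or r0 hB w).
Local Notation F0 := (state_fun f).
Local Notation A0 := (state_gen f).
Local Notation X := (bm_map B).

Lemma map_fun t w : 0 <= t -> oapp f 0 (X t w) = F0 (state (Z w) t).
Proof.
move=> t0; have [[u cu E]|[no E]] := state_cases (cZ w) (oZ w) (Z0n w) t0; rewrite E /bm_map.
  rewrite (underlying_map_alive (cZ w) (oZ w) (Z0n w) t0 cu)/= /state_fun.
  by rewrite (negbTE (clock_at_neq0 cu)).
by rewrite (underlying_map_dead (cZ w) (Z0n w) t0 no)/= /state_fun eqxx.
Qed.

Lemma map_gen t w : 0 <= t -> oapp (generator f) 0 (X t w) = A0 (state (Z w) t).
Proof.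
move=> t0; have [[u cu E]|[no E]] := state_cases (cZ w) (oZ w) (Z0n w) t0; rewrite E /bm_map.
  rewrite (underlying_map_alive (cZ w) (oZ w) (Z0n w) t0 cu)/=.
  by rewrite state_genE//; [apply: (oZ w); exact: cu.1|exact: clock_at_neq0 cu].
by rewrite (underlying_map_dead (cZ w) (Z0n w) t0 no)/= /state_gen eqxx.
Qed.

Definition mp_process t w : R := oapp f 0 (X t w) - oapp f 0 (X 0 w)
       - \int[lebesgue_measure]_(s in `[0, t]) oapp (generator f) 0 (X s w).

Lemma mp_processE t w : 0 <= t -> mp_process t w = F0 (state (Z w) t) - F0 (state (Z w) 0) -
  \int[lebesgue_measure]_(s in `[0, t]) A0 (state (Z w) s).
Proof.
move=> t0.
have E : \int[lebesgue_measure]_(s in `[0, t]) oapp (generator f) 0 (X s w) =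
    \int[lebesgue_measure]_(s in `[0, t]) A0 (state (Z w) s).
  by apply: eq_Rintegral => s; rewrite inE/= in_itv/= => /andP[s0 _]; rewrite map_gen.
have E1 := map_fun w t0; have E2 := map_fun w (lexx (0 : R)).
exact: (f_equal2 (fun a b => a - b) (f_equal2 (fun a b => a - b) E1 E2) E).
Qed.

Lemma mp_process_adapted t Y : 0 <= t -> measurable Y ->
  natural_filtration X t (mp_process t @^-1` Y).
Proof.
move=> t0 mY; have [K _ AK] := state_gen_bound fD.
have tt : 0 <= t <= t by rewrite t0 lexx.
have t00 : 0 <= (0 : R) <= t by rewrite lexx t0.
have m1 := measurable_state_fun or r0 hB tt (@continuous_state_fun _ _ _ fD).
have m2 := measurable_state_fun or r0 hB t00 (@continuous_state_fun _ _ _ fD).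
have m3 := measurable_state_integral or r0 hB t0 (@continuous_state_gen _ _ _ fD) AK.
have := measurable_funB (measurable_funB m1 m2) m3.
move=> /(_ measurableT _ mY); rewrite setTI.
rewrite (_ : mp_process t = (fun w => F0 (state (Z w) t) - F0 (state (Z w) 0) -
  \int[lebesgue_measure]_(s in `[0, t]) A0 (state (Z w) s)))//.
by apply/funext => w; exact: mp_processE.
Qed.

Lemma measurable_mp_process t : 0 <= t -> measurable_fun [set: T] (mp_process t).
Proof.
move=> t0 _ Y mY; rewrite setTI; apply: (natural_filtration_measurable or r0 hB (t := t)).
exact: mp_process_adapted.
Qed.

Lemma dead_negligible t : 0 <= t -> P.-negligible [set w | forall u, ~ clock_at (Z w) u t].
Proof.
move=> t0; apply: negligible_small => e e0.
have [N [delta [N0 d0 PN]]] := alive_prob hd or r0 hB hBind t0 e0.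
exists (~` clock_past B delta N t); split => //.
  apply: measurableC; apply: (bm_sigma_measurable hB (K := fun=> [set v | v <= N])).
  exact: (bm_sigma_clock_past hB).
move=> w /= no cp; have [a _ [ca _]] := clock_past_clock_at hB N0 d0 t0 cp.
exact: no ca.
Qed.

Lemma continuous_gen_rate delta w u : 0 < delta -> 0 <= u -> Z w u != 0 ->
  {for u, continuous (fun u => A0 (Z w u) * rate (Z w) delta u)}.
Proof.
move=> d0 u0 zu; apply: cvgM; last exact: (continuous_rate (cZ w) d0).
by apply: (@continuous_comp _ _ _ (Z w) A0); [exact: continuous_Z|apply: (continuous_state_gen fD) => //; exact: (oZ w)].
Qed.

Lemma integrable_gen_rate delta w a e : 0 < delta -> 0 <= a -> above (g w) delta e ->
  lebesgue_measure.-integrable `[a, e] (EFin \o (fun u => A0 (Z w u) * rate (Z w) delta u)).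
Proof.
move=> d0 a0 ab; apply: continuous_compact_integrable; first exact: segment_compact.
apply: continuous_in_subspaceT => u; rewrite inE/= in_itv/= => /andP[au ue].
have u0 := le_trans a0 au.
by apply: continuous_gen_rate => //; apply: (above_neq0 u0 d0); exact: above_le ab.
Qed.

(** The factor |z|^2 of the generator cancels against the rate of the clock, leaving half the
    Laplacian, which is the integrand of Dynkin's formula. *)
Lemma gen_rateE delta w u : 0 < delta -> 0 <= u -> delta <= g w u ->
  A0 (Z w u) * rate (Z w) delta u = 2^-1 * \sum_i polar_q f i i (Z w u).
Proof.
move=> d0 u0 du; have zn : Z w u != 0 by rewrite -norm1_gt0P (lt_le_trans d0).
rewrite /state_gen (negbTE zn) /rate max_l// total_orthant; last exact: (oZ w).
by field; rewrite gt_eqF// (lt_le_trans d0).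
Qed.

(** Measuring the window by the clock rather than by its length gives a bound that is uniform in
    [delta] and N once the clock is at most t. *)
Lemma gen_rate_bound delta w a e K : 0 < delta -> 0 <= a -> a <= e -> above (g w) delta e ->
  0 <= K -> (forall z, orthant z -> `|A0 z| <= K) ->
  `|\int[lebesgue_measure]_(u in `[a, e]) (A0 (Z w u) * rate (Z w) delta u)| <= K * pclock (Z w) delta e.
Proof.
move=> d0 a0 ae ab K0 AK.
have ig := integrable_gen_rate d0 a0 ab.
have cr := continuous_rate (cZ w) d0.
have ir := continuous_integrable_itv cr a e.
apply: (le_trans (le_normr_Rintegral _ ig)) => //.
apply: (@le_trans _ _ (\int[lebesgue_measure]_(u in `[a, e]) (K * rate (Z w) delta u))).
  apply: le_Rintegral => //.
  - exact: integrable_abse ig.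
  - apply: continuous_integrable_itv => u; apply: cvgMr; exact: cr.
  - move=> u; rewrite /= in_itv/= => /andP[au _]; rewrite normrM.
    have r1 := rate_gt0 (Z w) u d0; rewrite (gtr0_norm r1) ler_wpM2r ?(ltW r1)//.
    by apply: AK; apply: (oZ w); exact: le_trans au.
rewrite RintegralZl// ler_wpM2l// /pclock -(iclockB cr a0 ae) lerBlDr lerDl.
by rewrite -(pclock0 (Z w) delta) pclock_le//; exact: continuous_Z.
Qed.

Section Increment.
Variables (s t : R) (A : set T).
Hypotheses (s0 : 0 <= s) (st : s <= t) (sA : natural_filtration X s A).

Let t0 : 0 <= t := le_trans s0 st.
(** The level tends to 0 and never exceeds the starting norm, so that the path starts above it. *)
Let delta n : R := norm1 r / n.+1%:R.
Let N n : R := n.+1%:R.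
Let J n u := A `&` clock_past B (delta n) u s `&` [set w | pclock (Z w) (delta n) u <= t].

Let delta0 n : 0 < delta n.
Proof. by rewrite divr_gt0// norm1_gt0. Qed.

Let delta_g n w : delta n <= g w 0.
Proof.
have E := Z0 or hB w.
by rewrite E /delta ler_pdivrMr// ler_peMr ?norm1_ge0// ler1n.
Qed.

(** The window of [clock_window] on A, and the empty window (0, 0) off A. Restricting to A keeps the
    window adapted, because inside it the clock has passed s. *)
Lemma stopping_window n : exists ae : T -> R * R, forall w,
  [/\ 0 <= (ae w).1 <= (ae w).2 /\ (ae w).2 <= N n,
    forall u, 0 <= u <= N n -> J n u w <-> (ae w).1 < u <= (ae w).2,
    above (g w) (delta n) (ae w).2 /\ pclock (Z w) (delta n) (ae w).2 <= t,
    ~ A w -> ae w = (0, 0) &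
    A w -> forall x z : R, clock_at (Z w) x s -> clock_at (Z w) z t ->
      above (g w) (delta n) z -> z <= N n -> ae w = (x, z)].
Proof.
have H w : exists ae : R * R, [/\ 0 <= ae.1 <= ae.2 /\ ae.2 <= N n,
    forall u, 0 <= u <= N n -> J n u w <-> ae.1 < u <= ae.2,
    above (g w) (delta n) ae.2 /\ pclock (Z w) (delta n) ae.2 <= t,
    ~ A w -> ae = (0, 0) &
    A w -> forall x z : R, clock_at (Z w) x s -> clock_at (Z w) z t ->
      above (g w) (delta n) z -> z <= N n -> ae = (x, z)]; last first.
  by exists (fun w => sval (cid (H w))) => w; exact: svalP (cid (H w)).
have [Aw|nA] := pselect (A w); last first.
  exists (0, 0); split => //=.
  - by rewrite lexx.
  - by move=> u _; split => [[[]]//|/andP[u0 ue]]; move: (lt_le_trans u0 ue); rewrite ltxx.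
  - split; last by rewrite pclock0.
    by move=> v; rewrite -eq_le => /eqP <-.
have [a [e [h1 h2 h3 h4]]] := clock_window (cZ w) (delta0 n) (delta_g n w) (ler0n _ n.+1) s0 st.
exists (a, e); split => //=.
- move=> u uN; rewrite -(h2 u uN); split => [[[_ [ab su]] ut]|[ab /andP[su ut]]].
    by split => //; rewrite su.
  by split.
- by move=> _ x z cx cz ab zN; have [-> ->] := h4 x z cx cz ab zN.
Qed.

Lemma bm_sigma_J n u : 0 <= u -> bm_sigma B u (J n u).
Proof.
move=> u0; apply: sigma_setI; first exact: (filtration_past or r0 hB).
have := measurable_fun_ler (measurable_pclock hB u0 (delta0 n)) (measurable_cst t) measurableT (Y := [set true]) I.
by rewrite setTI.
Qed.

Let V w := \1_A w * (mp_process t w - mp_process s w).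

Lemma mp_increment w x z delta' : clock_at (Z w) x s -> clock_at (Z w) z t -> 0 < delta' ->
  above (g w) delta' z -> mp_process t w - mp_process s w =
  F0 (Z w z) - F0 (Z w x) -
  \int[lebesgue_measure]_(u in `[x, z]) (A0 (Z w u) * rate (Z w) delta' u).
Proof.
move=> cx cz d0 ab.
rewrite !mp_processE// (state_alive (cZ w) (oZ w) (Z0n w) s0 cx) (state_alive (cZ w) (oZ w) (Z0n w) t0 cz).
rewrite -(state_subst (cZ w) (oZ w) (Z0n w) (@continuous_state_gen _ _ _ fD) s0 st d0 ab cx cz).
have ist : lebesgue_measure.-integrable `[0, t] (EFin \o (fun v => A0 (state (Z w) v))).
  apply: continuous_compact_integrable; first exact: segment_compact.
  apply/subspace_continuousP => v /=; rewrite in_itv/= => /andP[v0 vt].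
  have [|y _ cy] := clock_at_le (cZ w) cz (s := v); first by rewrite v0.
  apply/cvgrPdist_le => c c0.
  have [e e0 eP] := state_continuous (cZ w) (oZ w) (Z0n w) (@continuous_state_gen _ _ _ fD) v0 cy c0.
  exists e => // v' /= vv'; rewrite in_itv/= => /andP[v'0 _].
  by rewrite distrC; apply: eP => //; rewrite distrC.
have := @Rintegral_itvB _ (fun v => A0 (state (Z w) v)) (BLeft 0) (BRight t) s ist.
rewrite !bnd_simp => /(_ s0 st) E.
rewrite -[in RHS]Rintegral_itv_obnd_cbnd; last first.
  apply: integrableS ist => // v; rewrite /= !in_itv/= => /andP[sv ->].
  by rewrite (le_trans s0 (ltW sv)).
rewrite -E; ring.
Qed.

(** [D n] is the stopped increment: it has mean 0 by Dynkin's formula and is bounded uniformly in n.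
    On a path alive at t it equals V for all large n, and the other paths are negligible. *)
Lemma mp_increment_mean : \int[P]_w V w = 0.
Proof.
have [K K0 FK] := state_fun_bound fD; have [K' K'0 AK] := state_gen_bound fD.
have aeE n := cid (stopping_window n).
pose a n w := (sval (aeE n) w).1; pose e n w := (sval (aeE n) w).2.
have aeP n w := svalP (aeE n) w.
pose D n w := polar_fun f (Z w (e n w)) - polar_fun f (Z w (a n w)) -
  2^-1 * \int[lebesgue_measure]_(u in `[0, N n]) (\1_(J n u) w * \sum_i polar_q f i i (Z w u)).
have DD n : P.-integrable [set: T] (EFin \o D n) /\ \int[P]_w D n w = 0.
  have [C nd] := neumann_data_polar fD (delta0 n).
  apply: (dynkin_formula hB hBind (delta0 n) nd) => //.
  - by move=> u /andP[u0 _]; exact: bm_sigma_J.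
  - by move=> w; have [] := aeP n w.
  - by move=> u w uN; have [_ h _ _ _] := aeP n w; exact: h.
  - move=> u w /andP[au ue]; have [[/andP[h0 _] _] _ [ab _] _ _] := aeP n w.
    by apply: ab; rewrite ue andbT (le_trans h0)// ltW.
have DE n w : D n w = F0 (Z w (e n w)) - F0 (Z w (a n w)) -
    \int[lebesgue_measure]_(u in `[a n w, e n w]) (A0 (Z w u) * rate (Z w) (delta n) u).
  have [[/andP[h0 ae] eN] Jae [ab _] _ _] := aeP n w.
  have e0 := le_trans h0 ae.
  have ze : Z w (e n w) != 0 by exact: above_neq0 ab.
  have za : Z w (a n w) != 0 by apply: (above_neq0 h0 (delta0 n)); exact: above_le ab.
  rewrite /D /state_fun (negbTE ze) (negbTE za); congr (_ - _).
  have zE u : 0 <= u <= N n -> (\1_(J n u) w : R) = (a n w < u <= e n w)%R%:R.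
    move=> uN; rewrite indicE; have [du|du] := boolP (a n w < u <= e n w).
      by rewrite mem_set//; apply/(Jae u uN).
    by rewrite memNset// => /(Jae u uN); apply/negP.
  have ig := integrable_gen_rate (delta0 n) h0 ab.
  have E u : u \in `[a n w, e n w]%classic ->
      A0 (Z w u) * rate (Z w) (delta n) u = 2^-1 * \sum_i polar_q f i i (Z w u).
    rewrite inE/= in_itv/= => /andP[au ue]; have u0 := le_trans h0 au.
    by apply: gen_rateE => //; apply: ab; rewrite u0.
  have iq : lebesgue_measure.-integrable `[a n w, e n w]
      (EFin \o (fun u => \sum_i polar_q f i i (Z w u))).
    apply: eq_integrable (integrableZl _ 2 ig) => // u /E /= Eu.
    by rewrite -EFinM Eu mulrA divff// mul1r.
  by rewrite (Rintegral_window h0 ae eN zE iq) -RintegralZl//; apply: eq_Rintegral => u /E.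
have DK n w : `|D n w| <= 2 * K + K' * t.
  have [[/andP[h0 ae] eN] _ [ab le] _ _] := aeP n w.
  have e0 := le_trans h0 ae.
  rewrite DE (le_trans (ler_normB _ _))// lerD//.
    rewrite (le_trans (ler_normB _ _))// mulr2n mulrDl !mul1r lerD//; apply: FK; exact: (oZ w).
  apply: (le_trans (gen_rate_bound (delta0 n) h0 ae ab K'0 AK)).
  by rewrite ler_wpM2l.
have mA : measurable A by exact: (natural_filtration_measurable or r0 hB sA).
have mV : measurable_fun [set: T] V.
  apply: measurable_funM; first exact: measurable_indic.
  by apply: measurable_funB; exact: measurable_mp_process.
have mD n : measurable_fun [set: T] (D n).
  by apply/measurable_EFinP; exact: measurable_int (DD n).1.
have : \int[P]_w D n w @[n --> \oo] --> \int[P]_w V w.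
  apply: (cvg_Rintegral_ae mD mV _ DK).
  apply: negligibleS (dead_negligible t0) => w; rewrite /= => nc u cu; apply: nc.
  have [Aw|nA] := pselect (A w); last first.
    have -> : V w = 0 by rewrite /V indicE memNset// mul0r.
    rewrite (_ : (fun n => _) = cst 0); first exact: cvg_cst.
    apply/funext => n; have [_ _ _ h _] := aeP n w.
    rewrite DE /a /e; move: (h nA) => -> /=.
    by rewrite set_itv1 Rintegral_set1 subrr subr0.
  have [|x _ cx] := clock_at_le (cZ w) cu (s := s); first by rewrite s0.
  have [u0 [d' d'0 [ab _]]] := cu.
  have : \forall n \near \oo, delta n <= d' /\ u <= N n.
    have /cvgrPdist_le/(_ _ d'0) n1 := @cvg_mesh R (norm1 r).
    apply: filterS2 n1 (nbhs_infty_ger u) => n; rewrite sub0r normrN => h1 h2; split.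
      exact: le_trans (ler_norm _) h1.
    by rewrite (le_trans h2)// ler_nat.
  move=> near_n; apply: cvg_near_cst; apply: filterS near_n => n [dn un].
  have abn : above (g w) (delta n) u by exact: above_mono ab.
  have [_ _ _ _ h] := aeP n w.
  rewrite DE /V indicE mem_set// mul1r (mp_increment cx cu (delta0 n) abn).
  by rewrite /a /e (h Aw x u cx cu abn un).
rewrite (_ : (fun n => _) = cst 0); last by apply/funext => n; exact: (DD n).2.
by move=> h; apply/esym/(cvg_unique _ _ h) => //; exact: cvg_cst.
Qed.

End Increment.

(** The bound is read off the Riemann sums, whose convergence needs only right continuity, so paths
    dead before t are covered as well. *)
Lemma mp_integral_bound t w K : 0 <= t -> (forall z, orthant z -> `|A0 z| <= K) ->
  `|\int[lebesgue_measure]_(s in `[0, t]) A0 (state (Z w) s)| <= K * t.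
Proof.
rewrite le_eqVlt => /predU1P[<- _|t0 AK]; first by rewrite set_itv1 Rintegral_set1 normr0 mulr0.
have sK s : 0 <= s <= t -> `|A0 (state (Z w) s)| <= K.
  by move=> /andP[s0 _]; apply: AK; exact: (orthant_state (cZ w) (oZ w) (Z0n w) s0).
have rc s : s \in Interval (BSide true 0) (BSide true t) ->
    forall e, 0 < e -> exists2 c, 0 < c & forall u,
      s < u -> `|u - s| < c -> `|A0 (state (Z w) u) - A0 (state (Z w) s)| <= e.
  rewrite in_itv/= => /andP[s0 _] e e0.
  exact: (state_right_continuous (cZ w) (oZ w) (Z0n w) (@continuous_state_gen _ _ _ fD) s0 e0).
have /cvg_norm c := @cvg_riemann_sum _ true (fun s => A0 (state (Z w) s)) t K t0 sK rc.
apply: (cvgr_to_le c); near=> n.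
rewrite (le_trans (ler_norm_sum _ _ _))//.
have h0 : 0 <= t / n.+1%:R by rewrite divr_ge0// ltW.
apply: (@le_trans _ _ (\sum_(k < n.+1) K * (t / n.+1%:R))).
  apply: ler_sum => k _; rewrite normrM (ger0_norm h0) ler_wpM2r//.
  by apply: sK; apply: grid_in; [exact: ltW|rewrite addn1].
by rewrite sumr_const card_ord -[leLHS]mulr_natr -[leLHS]mulrA divfK.
Unshelve. all: by end_near. Qed.

Lemma mp_process_integrable t : 0 <= t -> P.-integrable [set: T] (EFin \o mp_process t).
Proof.
move=> t0; have [K K0 FK] := state_fun_bound fD; have [K' K'0 AK] := state_gen_bound fD.
apply: (integrable_le (g := fun=> 2 * K + K' * t)).
- exact: measurable_mp_process.
- move=> w; rewrite mp_processE// (le_trans (ler_normB _ _))// lerD//.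
    have oS v : 0 <= v -> orthant (state (Z w) v) by exact: (orthant_state (cZ w) (oZ w) (Z0n w)).
    by rewrite (le_trans (ler_normB _ _))// mulr2n mulrDl !mul1r lerD//; apply: FK; exact: oS.
  exact: mp_integral_bound.
exact: (mean_le_cst P (2 * K + K' * t)).1.
Qed.

Lemma mp_process_martingale : martingale P (natural_filtration X) mp_process.
Proof.
split.
- exact: (natural_filtration_filtration or r0 hB).
- by move=> t t0 Y mY; exact: mp_process_adapted.
- exact: mp_process_integrable.
move=> s t s0 st A sA; have t0 := le_trans s0 st.
have mA : measurable A by exact: (natural_filtration_measurable or r0 hB sA).
have it := integrableS measurableT mA (@subsetT _ A) (mp_process_integrable t0).
have is_ := integrableS measurableT mA (@subsetT _ A) (mp_process_integrable s0).
have := mp_increment_mean s0 st sA.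
rewrite (_ : \int[P]_w _ = \int[P]_(w in A) (mp_process t w - mp_process s w)); last first.
  rewrite [RHS]Rintegral_mkcond; apply: eq_Rintegral => w _; rewrite patchE indicE.
  by case: ifP => _; rewrite ?mul1r ?mul0r.
move=> h; have /eqP := etrans (esym (RintegralB mA it is_)) h; rewrite subr_eq0 => /eqP E.
rewrite -(fineK (integrable_fin_num mA it)) -(fineK (integrable_fin_num mA is_)).
exact: (congr1 EFin E).
Qed.

End MartingaleProblem.

Theorem theorem6p1 (R : realType) (d : nat) (hd : (2 <= d)%N)
    (disp : measure_display) (T : measurableType disp) (P : probability T R)
    (r : 'rV[R]_d) (hr : orthant r) (hr0 : r != 0)
    (B : 'I_d -> R -> T -> R)
    (hB : forall i, brownian_motion P (r 0 i) (B i))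
    (hBind : independent_processes P B) :
  let refl (w : T) : R -> 'rV[R]_d :=
    absorb0 (skorokhod_reflection (fun i t => B i t w)) in
  solves_martingale_problem P classD generator
    (fun t w => underlying_map (refl w) t).
Proof.
move=> refl f fD.
have E : (fun t w => underlying_map (refl w) t) = bm_map B.
  apply/funext => t; apply/funext => w; apply: (congr1 (fun y => y t)); apply: underlying_map_congr => u u0.
  exact: skorokhod_bm_reflected.
have := mp_process_martingale hd hr hr0 hB hBind fD.
by rewrite /mp_process -E.
Qed.
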